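(* Let $q(t)$, $t\in[0,T]$, be the trajectory of $\dot q(t)=\sum_{i=1}^lu_i(t)X_i(q(t))$, $q(0)=q_0$, corresponding to a control $u\in\Omega$, and let $\Psi^{(k)}(t)$, $k\in\mathbb{N}$, be the transformations of adapted coordinates along $q(t)$. Then for each $k\in\mathbb{N}$ there exists an affine distribution $\mathcal{D}^{(k)}=\partial_t+\mathrm{span}_{\mathbb{R}}\{Y_1^{(k)},\dots,Y_l^{(k)}\}$ on $\mathbb{R}\times\underbrace{\mathbb{R}^n\times\dots\times\mathbb{R}^n}_k\ni(t,q^{(1)},\dots,q^{(k)})$ with the following properties. (i) Equip $\mathbb{R}^{1+kn}$ with the natural graded space structure given by $\deg(t)=0$ and $\deg(q^{(m)}_a)=m$. Then for every $i=1,\dots,l$ the field $Y_i^{(k)}$ is a homogeneous vector field of degree $-1$. (ii) For every control $\Delta u\in T_u\Omega\simeq\Omega$ the curve $p^{(k)}(t):=(t,q^{(1)}(t,\Delta u),\dots,q^{(k)}(t,\Delta u))$, where $(q^{(1)}(t,\Delta u),\dots,q^{(k)}(t,\Delta u))$ is the image under $\Psi^{(k)}(t)$ of the $k$-jet at $s=0$ of $s\mapsto\mathrm{End}^t[u+s\cdot\Delta u]$, is a trajectory of the control-affine system defined by $\mathcal{D}^{(k)}$ for the control $\Delta u$, that is $$\dot p^{(k)}(t)=\partial_t+\sum_{i=1}^l\Delta u_i(t)\cdot Y_i^{(k)}(p^{(k)}(t)),\qquad p^{(k)}(0)=(0,0,\dots,0).$$ Moreover, for each $k=2,3,\dots$ the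 field $Y_i^{(k)}$ projects to $Y_i^{(k-1)}$ under the mapping $\mathbb{R}^{1+nk}\ni(t,q^{(1)},\dots,q^{(k-1)},q^{(k)})\mapsto(t,q^{(1)},\dots,q^{(k-1)})\in\mathbb{R}^{1+n(k-1)}$.
   Context: Control system. $M$ is a smooth $n$-dimensional manifold, $X_1,\dots,X_l$ are smooth, pointwise linearly independent vector fields on $M$, $T>0$, $q_0\in M$ is fixed, and $\Omega$ is a vector subspace of the space $\mathrm{Meas}([0,T],\mathbb{R}^l)$ of measurable maps. For $u\in\Omega$ one considers the Carathéodory solution on $[0,T]$ of $\dot q(t)=\sum_{i=1}^l u_i(t)X_i(q(t))$, $q(0)=q_0$. For $t\in[0,T]$ the end-point map is $\mathrm{End}^t:\Omega\to M$, $\mathrm{End}^t(u)=q(t)$; it is assumed to be defined on all of $\Omega$. Jets and multi-indices. $T^k_pM$ is the space of $k$-jets at $s=0$ of curves in $M$ passing through $p$ at $s=0$; in a chart a $k$-jet is written $(b^{(1)},\dots,b^{(k)})\in(\mathbb{R}^n)^k$, representing $p+sb^{(1)}+\dots+s^kb^{(k)}+o(s^k)$. A multi-index is $\alpha=(a_1,\dots,a_k)$ with $a_i\ge0$ integers; $|\alpha|=\sum_i a_i$, $w(\alpha)=\sum_i i\cdot a_i$, $\alpha!=a_1!\cdots a_k!$. For a $|\alpha|$-linear map $\Phi$ and $\vec b=(b^{(1)},\dots,b^{(k)})$, $\Phi[\vec b^{\,\alpha}]$ means $\Phi$ evaluated with $b^{(i)}$ inserted $a_i$ times for each $i$. $D^j_{q(t)}X_i$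 is the $j$-th derivative of $X_i$ at $q(t)$ in local coordinates (a symmetric $j$-linear map). Adapted coordinates. Choose local coordinates on $M$ along $q(t)$. For $m=1,2,\dots$ let $\Phi^{(m)}(t)=(\Phi^{(m)}_a(t))_{a=1,\dots,n}:(T_{q(t)}M)^{\times m}\to\mathbb{R}^n$, $t\in[0,T]$, be symmetric $m$-linear maps such that $\{\Phi^{(1)}_a(0)\}_{a}$ is a basis of $T^*_{q(0)}M$, the $\Phi^{(m)}(0)$ for $m\ge2$ are arbitrary, and, for all $b$, $$\dot\Phi^{(m)}(t)[\underbrace{b,\dots,b}_m]+\sum_{i=1}^l u_i(t)\Big\{\sum_{s=1}^m\binom ms\,\Phi^{(m-s+1)}(t)\big[D^s_{q(t)}X_i[\underbrace{b,\dots,b}_s],\underbrace{b,\dots,b}_{m-s}\big]\Big\}=0 .$$ The transformation of adapted coordinates of degree $k$ at time $t$ is $\Psi^{(k)}(t):T^k_{q(t)}M\ni(b^{(1)},\dots,b^{(k)})\mapsto(q^{(1)},\dots,q^{(k)})\in\mathbb{R}^{nk}$, $q^{(m)}=(q^{(m)}_a)_{a=1,\dots,n}=\sum_{w(\alpha)=m}\frac1{\alpha!}\Phi^{(|\alpha|)}(t)[\vec b^{\,\alpha}]$. The same collection $(\Phi^{(m)})_{m\ge1}$ is used for all $k$. If $q([0,T])$ is not contained in one chart domain, the ODEs are understood on successive subintervals on which $q$ stays in one chart, and at a switching time the collection $(\Phi^{(m)})$ is re-expressed in the new chart so that all the maps $\Psi^{(k)}$ on $T^k_{q(t)}M$ are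 unchanged. Homogeneity. With $E=\sum_{m=1}^k\sum_{a=1}^n m\,q^{(m)}_a\,\partial_{q^{(m)}_a}$ the Euler (weight) vector field of the graded structure, a vector field $Y$ is homogeneous of degree $d$ if $[E,Y]=d\cdot Y$. Since controls are only measurable, the vector fields $Y^{(k)}_i$ are not required to be smooth in $t$; trajectories are understood in the Carathéodory sense for $t\in[0,T]$. *)

(* Defs.v *)
From HB Require Import structures.
From mathcomp Require Import all_boot all_order all_algebra perm.
From mathcomp Require Import all_classical all_reals all_analysis.
From mathcomp Require Import measurable_realfun.
Set Implicit Arguments.
Unset Strict Implicit.
Unset Printing Implicit Defensive.
Import Order.TTheory GRing.Theory Num.Theory.
Import numFieldNormedType.Exports.
Local Open Scope classical_set_scope.
Local Open Scope ring_scope.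

(* Iterated directional derivative.  For a smooth f, [iterD f [:: v1; ...; vs] x]
   is the s-th derivative of f at x evaluated on (v1, ..., vs). *)
Fixpoint iterD (R : realType) (V W : normedModType R) (f : V -> W) (vs : seq V)
    : V -> W :=
  if vs is v :: vs' then fun x => 'D_v (iterD f vs') x else f.

(* C^infinity; only used for open U. *)
Definition smooth_on (R : realType) (V W : normedModType R) (U : set V)
    (f : V -> W) : Prop :=
  forall (vs : seq V) x, U x -> differentiable (iterD f vs) x.

(* The values of cmap outside cdom, and of cinv outside the image of cdom, are
   irrelevant. *)
Record chart (R : realType) (M : topologicalType) (n : nat) := Chart {
  cdom : set M;
  cmap : M -> 'rV[R]_n;
  cinv : 'rV[R]_n -> M }.

Section Manifold.
Variables (R : realType) (M : topologicalType) (n : nat).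
Local Notation chart := (chart R M n).
Implicit Types (c : chart) (A : set chart).

Definition is_chart c : Prop :=
  [/\ open (cdom c),
      open (cmap c @` cdom c),
      forall p, cdom c p -> cinv c (cmap c p) = p,
      {within cdom c, continuous (cmap c)} &
      {within cmap c @` cdom c, continuous (cinv c)}].

Definition transition c c' : 'rV[R]_n -> 'rV[R]_n := cmap c' \o cinv c.

Definition smooth_atlas A : Prop :=
  [/\ forall c, A c -> is_chart c,
      forall p, exists2 c, A c & cdom c p &
      forall c c', A c -> A c' ->
        smooth_on (cmap c @` (cdom c `&` cdom c')) (transition c c')].

Definition smooth_manifold A : Prop :=
  [/\ hausdorff_space M, @second_countable M & smooth_atlas A].

(* A vector field is given by its coordinate expression in every chart of the
   atlas; the expressions are related by the differentials of the transition
   maps. *)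
Definition smooth_vector_field A (X : chart -> 'rV[R]_n -> 'rV[R]_n) : Prop :=
  (forall c, A c -> smooth_on (cmap c @` cdom c) (X c)) /\
  (forall c c' p, A c -> A c' -> cdom c p -> cdom c' p ->
     X c' (cmap c' p) = 'd (transition c c') (cmap c p) (X c (cmap c p))).

Definition pointwise_independent (l : nat) A
    (X : 'I_l -> chart -> 'rV[R]_n -> 'rV[R]_n) : Prop :=
  forall c p, A c -> cdom c p -> free [seq X i c (cmap c p) | i <- enum 'I_l].

(* In the chart c, gamma s = p + s b_1 + ... + s^k b_k + o(s^k) as s -> 0, where
   p = gamma 0 and b_i is the i-th row of b. *)
Definition is_jet c (k : nat) (gamma : R -> M) (b : 'M[R]_(k, n)) : Prop :=
  (\forall s \near (0 : R), cdom c (gamma s)) /\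
  (fun s : R => cmap c (gamma s) -
     (cmap c (gamma 0) + \sum_(i < k) s ^+ i.+1 *: row i b))
    =o_ (0 : R) (fun s : R => s ^+ k).

End Manifold.

Section Caratheodory.
Variables (R : realType) (V : normedModType R).

Definition absolutely_continuous_on (a b : R) (x : R -> V) : Prop :=
  forall e : R, 0 < e -> exists2 d : R, 0 < d &
    forall (N : nat) (lo hi : 'I_N -> R),
      (forall j, [/\ a <= lo j, lo j <= hi j & hi j <= b]) ->
      trivIset setT (fun j => `]lo j, hi j[%classic) ->
      \sum_j (hi j - lo j) < d ->
      \sum_j `|x (hi j) - x (lo j)| < e.

Definition caratheodory (a b : R) (x g : R -> V) : Prop :=
  absolutely_continuous_on a b x /\
  {ae lebesgue_measure, forall t : R, t \in `]a, b[ -> is_derive t (1 : R) x (g t)}.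

End Caratheodory.

(* Measurability on D with respect to the Lebesgue sigma-algebra, i.e. the
   completion of the Borel sigma-algebra; the library's [measurable_fun] on R
   is Borel measurability. *)
Definition lebesgue_measurable_fun (R : realType) (D : set R) (f : R -> R)
    : Prop :=
  forall B : set R, measurable B ->
    completed_algebra_gen (@lebesgue_measure R) (D `&` f @^-1` B).

(* Controls are functions on R of which only the restriction to [0, T] matters. *)
Definition control_space (R : realType) (l : nat) (T : R)
    (Omega : set (R -> 'rV[R]_l)) : Prop :=
  [/\ forall u, Omega u -> forall i,
        lebesgue_measurable_fun `[0, T]%classic (fun t => u t ord0 i),
      Omega 0 &
      forall (a : R) u v, Omega u -> Omega v -> Omega (a *: u + v)].

Definition is_trajectory (R : realType) (M : topologicalType) (n l : nat)
    (A : set (chart R M n)) (X : 'I_l -> chart R M n -> 'rV[R]_n -> 'rV[R]_n)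
    (T : R) (q0 : M) (u : R -> 'rV[R]_l) (q : R -> M) : Prop :=
  [/\ q 0 = q0,
      {within `[0, T]%classic, continuous q} &
      forall c (a b : R), A c -> 0 <= a -> a <= b -> b <= T ->
        (forall t, a <= t <= b -> cdom c (q t)) ->
        caratheodory a b (cmap c \o q)
          (fun t => \sum_(i < l) u t ord0 i *: X i c (cmap c (q t)))].

Section Adapted.
Variables (R : realType) (n : nat).
Local Notation V := 'rV[R]_n.

Definition multilinear (m : nat) (F : ('I_m -> V) -> V) : Prop :=
  forall (v : 'I_m -> V) (j : 'I_m) (a : R) (x y : V),
    let put w := fun i => if i == j then w else v i in
    F (put (a *: x + y)) = a *: F (put x) + F (put y).

Definition symmetric_map (m : nat) (F : ('I_m -> V) -> V) : Prop :=
  forall (s : 'S_m) (v : 'I_m -> V), F (v \o s) = F v.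

(* The arguments of an m-linear map, listed in a sequence of size m. *)
Definition args (m : nat) (vs : seq V) : 'I_m -> V := fun i => nth 0 vs i.

(* Phi m t stands for Phi^(m)(t); only m >= 1 is relevant. *)
Definition coefs := forall m : nat, R -> ('I_m -> V) -> V.

(* sum_(s = 1..m) C(m, s) Phi^(m-s+1)(t)[D^s_x F[b, ..., b], b, ..., b] *)
Definition adapted_rhs (Phi : coefs) (m : nat) (t : R) (F : V -> V) (x b : V)
    : V :=
  \sum_(1 <= s < m.+1) 'C(m, s)%:R *:
    Phi (m - s).+1 t (args (iterD F (nseq s b) x :: nseq (m - s) b)).

Definition weight (k : nat) (al : {ffun 'I_k -> 'I_k.+1}) : nat :=
  (\sum_(i < k) i.+1 * al i)%N.

(* Row i of b is b^(i+1), and row m of the result is q^(m+1).  A multi-index of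
   weight at most k has all its entries at most k, hence the finite range. *)
Definition Psi (k : nat) (Phi : coefs) (t : R) (b : 'M[R]_(k, n))
    : 'M[R]_(k, n) :=
  \matrix_(m < k)
    \sum_(al : {ffun 'I_k -> 'I_k.+1} | weight al == m.+1)
      ((\prod_(i < k) (al i)`!)%:R)^-1 *:
      Phi (\sum_(i < k) al i)%N t
        (args (flatten [seq nseq (al i) (row i b) | i <- enum 'I_k])).

End Adapted.

(* On the j-th subinterval [time j, time j.+1], j < pieces, coordinates are those
   of chart_at j and the maps are coef j. *)
Record adapted_coords (R : realType) (M : topologicalType) (n : nat) :=
  AdaptedCoords {
    pieces : nat;
    time : nat -> R;
    chart_at : nat -> chart R M n;
    coef : nat -> coefs R n }.

Definition is_adapted (R : realType) (M : topologicalType) (n l : nat)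
    (A : set (chart R M n)) (X : 'I_l -> chart R M n -> 'rV[R]_n -> 'rV[R]_n)
    (T : R) (u : R -> 'rV[R]_l) (q : R -> M) (P : adapted_coords R M n)
    : Prop :=
  [/\ [/\ time P 0%N = 0, time P (pieces P) = T &
          forall j, (j < pieces P)%N ->
            [/\ time P j < time P j.+1, A (chart_at P j) &
                forall t, time P j <= t <= time P j.+1 ->
                  cdom (chart_at P j) (q t)]],
      (forall j m t, (j < pieces P)%N -> (0 < m)%N ->
         time P j <= t <= time P j.+1 ->
         multilinear (coef P j (m := m) t) /\
         symmetric_map (coef P j (m := m) t)),
      (* the covectors Phi^(1)_a(0), by their values on the standard basis *)
      basis_of fullv
        [seq (\row_(i < n)
                coef P 0%N (m := 1) 0 (fun=> delta_mx ord0 i) ord0 a : 'rV[R]_n)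
           | a <- enum 'I_n],
      (forall j m, (j < pieces P)%N -> (0 < m)%N ->
         (forall v, absolutely_continuous_on (time P j) (time P j.+1)
                      (fun t => coef P j (m := m) t v)) /\
         (forall b : 'rV[R]_n, caratheodory (time P j) (time P j.+1)
            (fun t => coef P j (m := m) t (fun=> b))
            (fun t => - \sum_(i < l) u t ord0 i *:
               adapted_rhs (coef P j) m t (X i (chart_at P j))
                 (cmap (chart_at P j) (q t)) b))) &
      (* the maps on jets agree at the switching times *)
      (forall j k (gamma : R -> M) (b b' : 'M[R]_(k, n)),
         (j.+1 < pieces P)%N -> gamma 0 = q (time P j.+1) ->
         is_jet (chart_at P j) gamma b -> is_jet (chart_at P j.+1) gamma b' ->
         Psi (coef P j) (time P j.+1) b = Psi (coef P j.+1) (time P j.+1) b')].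

(* x is the image under Psi^(k)(t) of the k-jet of gamma at 0. *)
Definition jet_image (R : realType) (M : topologicalType) (n k : nat)
    (P : adapted_coords R M n) (t : R) (gamma : R -> M) (x : 'M[R]_(k, n))
    : Prop :=
  forall j, (j < pieces P)%N -> time P j <= t <= time P j.+1 ->
    exists2 b : 'M[R]_(k, n),
      is_jet (chart_at P j) gamma b & x = Psi (coef P j) t b.

Section Graded.
Variables (R : realType) (n : nat).

(* R^(1 + kn) with coordinates (t, q), where row m of q is q^(m+1). *)
Definition gspace (k : nat) := (R * 'M[R]_(k, n))%type.

Definition dt (k : nat) : gspace k := (1, 0).

Definition euler (k : nat) (p : gspace k) : gspace k :=
  (0, \matrix_(m < k, a < n) (m.+1%:R * p.2 m a)).

Definition lie_bracket (W : normedModType R) (F G : W -> W) (p : W) : W :=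
  'D_(F p) G p - 'D_(G p) F p.

(* euler has no component along t, so the bracket only differentiates Y in q. *)
Definition homogeneous (k : nat) (d : int) (Y : gspace k -> gspace k) : Prop :=
  (forall t : R, smooth_on setT (fun q : 'M[R]_(k, n) => Y (t, q))) /\
  (forall p, lie_bracket (@euler k) Y p = d%:~R *: Y p).

Definition affine_distribution (k l : nat) (Y : 'I_l -> gspace k -> gspace k)
    (p : gspace k) : set (gspace k) :=
  [set w | exists c : 'I_l -> R, w = dt k + \sum_(i < l) c i *: Y i p].

Definition gproj (k : nat) (p : gspace k.+1) : gspace k :=
  (p.1, row' ord_max p.2).

Definition projects_to (W W' : normedModType R) (f : W -> W')
    (Y : W -> W) (Y' : W' -> W') : Prop :=
  forall p, 'd f p (Y p) = Y' (f p).

End Graded.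

(* Main.v *)
(** In a chart, let b(t, s) be the difference of the trajectories of u + s du and u, and let
    x(t, s) = sum_m Phi^(m)(t)[b(t, s)^m] / m!, the sum being truncated at degree k.  The equations
    of the Phi^(m) are made to cancel the u-part of the evolution: for a.e. t,
    d/dt x = s sum_i du_i DF_t(b)[X_i(q(t) + b)] + O(s^(k+1)) (|u| + |du|),
    where F_t is the polynomial b |-> x.  No smooth dependence on parameters is needed:
    a Gronwall estimate gives b = O(s) uniformly in t; if x is known modulo s^(r+1), then b is,
    because Phi^(1) is invertible, so d/dt x is known modulo s^(r+2), and integration gives x modulo
    s^(r+2).  After k steps the coefficients of s, ..., s^k in x solve the system
    d/dt q^(m+1) = sum_i du_i (coefficient of s^m in DF_t(b)[X_i(q(t) + b)]), where b is the polynomial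
    in s with F_t(b) = sum_m s^m q^(m).  This coefficient is a polynomial
    of weight m in q^(1), ..., q^(m), and it does not depend on k.

    The trajectories are covered by finitely many pieces.  On each piece the curve of u + s du stays
    in the chart for small s by a continuation argument, and at a switching time the expansion of b
    is transported by the Taylor formula for the transition map. *)
From HB Require Import structures.
Require Import Defs.
From mathcomp Require Import all_boot all_order all_algebra.
From mathcomp Require Import all_classical all_reals all_analysis.
From mathcomp Require Import perm measurable_realfun ring lra zify.
Set Implicit Arguments.
Unset Strict Implicit.
Unset Printing Implicit Defensive.
Import Order.TTheory GRing.Theory Num.Theory.
Import numFieldNormedType.Exports.
Local Open Scope classical_set_scope.
Local Open Scope ring_scope.

(** * Absolutely continuous functions *)

(** The controls are assumed measurable only. Their integrability is recovered from the
    trajectories: an absolutely continuous curve has a summable derivative, and pointwise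
    independence of the X_i lets u be read off from that derivative through a continuous left
    inverse. The majorant [w] of |u_i| and |du_i|, with primitive [W], then stands in for a sup
    bound on the controls. The equation of Phi^(m) is given for each b outside a null set depending
    on b; polarization and the density of rational vectors give one null set for all b, as required
    when b becomes the moving displacement b(t, s). Phi^(1) is a basis at t = 0 only: a backward
    Gronwall estimate keeps it invertible on each piece, and agreement on 1-jets carries this across
    switching times. Finally, the iteration b := M (x - Q b) has to run both on polynomials in s and
    on functions of (t, s). Both are rings filtered by the order in s, in which the terms of degree
    at least 2 make the iteration a contraction, so the two solutions are compared algebraically. *)

Section AbsolutelyContinuous.
Variable R : realType.
Implicit Types (a b c d : R).

Lemma trivIset_subset (I T : Type) (D : set I) (F G : I -> set T) :
  (forall i, D i -> G i `<=` F i) -> trivIset D F -> trivIset D G.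
Proof.
move=> GF tF i j Di Dj [x [/(GF _ Di) Fx /(GF _ Dj) Gx]].
by apply: tF => //; exists x.
Qed.

Lemma ac_sub (V : normedModType R) a b c d (f : R -> V) :
  a <= c -> d <= b ->
  absolutely_continuous_on a b f -> absolutely_continuous_on c d f.
Proof.
move=> ac db H e e0; have [dl dl0 Hd] := H e e0; exists dl => // N lo hi h.
apply: Hd => j; have [h1 h2 h3] := h j; split => //; first exact: le_trans h1.
exact: le_trans db.
Qed.

(** Sums, products, multiples and coordinates inherit absolute continuity through such a bound on
    increments. The sign of [C] is free, hence [|C| + 1] in the proof. *)
Lemma ac_dom (V W1 W2 : normedModType R) a b (C : R) (f : R -> V)
    (g : R -> W1) (h : R -> W2) :
  (forall s t, a <= s -> s <= t -> t <= b ->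
     `|f t - f s| <= C * (`|g t - g s| + `|h t - h s|)) ->
  absolutely_continuous_on a b g -> absolutely_continuous_on a b h ->
  absolutely_continuous_on a b f.
Proof.
move=> fgh Hg Hh e e0; set C' := `|C| + 1.
have C0 : 0 < C' by rewrite /C' ltr_wpDl.
have e'0 : 0 < e / (2 * C') by rewrite divr_gt0// mulr_gt0.
have [d1 d10 H1] := Hg _ e'0; have [d2 d20 H2] := Hh _ e'0.
exists (Num.min d1 d2); first by rewrite lt_min d10.
move=> N lo hi hlh dj; rewrite lt_min => /andP[s1 s2].
have {}H1 := H1 _ _ _ hlh dj s1; have {}H2 := H2 _ _ _ hlh dj s2.
apply: (@le_lt_trans _ _ (C' * (\sum_j `|g (hi j) - g (lo j)|
                               + \sum_j `|h (hi j) - h (lo j)|))).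
  rewrite -big_split/= mulr_sumr; apply: ler_sum => j _.
  have [h1 h2 h3] := hlh j; apply: (le_trans (fgh _ _ h1 h2 h3)).
  rewrite ler_wpM2r ?addr_ge0//.
  by rewrite /C' (le_trans (ler_norm C))// lerDl.
have -> : e = C' * (e / (2 * C') + e / (2 * C')).
  by field; rewrite gt_eqF.
by rewrite ltr_pM2l// ltrD.
Qed.

Lemma ac_cst (V : normedModType R) a b (v : V) :
  absolutely_continuous_on a b (fun=> v).
Proof.
move=> e e0; exists 1 => // N lo hi _ _ _.
by rewrite big1// => j _; rewrite subrr normr0.
Qed.

Lemma ac_lip (V W : normedModType R) a b (C : R) (f : R -> V) (g : R -> W) :
  (forall s t, a <= s -> s <= t -> t <= b ->
     `|f t - f s| <= C * `|g t - g s|) ->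
  absolutely_continuous_on a b g -> absolutely_continuous_on a b f.
Proof.
move=> fg Hg; apply: (@ac_dom _ _ _ a b C f g (fun=> 0 : R)) => //.
  by move=> s t h1 h2 h3; rewrite subrr normr0 addr0; exact: fg.
exact: ac_cst.
Qed.

Section Cut.
Variables (a b c : R) (N : nat) (lo hi : 'I_N -> R).
Hypothesis hlh : forall j, [/\ a <= lo j, lo j <= hi j & hi j <= c].
Hypothesis dj : trivIset setT (fun j => `]lo j, hi j[%classic).

(** A family of intervals is cut at b by clamping its endpoints: an interval on the wrong side
    collapses to a point and contributes no increment, so the index set stays ['I_N]. *)
Lemma cut_left_le : a <= b -> forall j, [/\ a <= Num.min (lo j) b,
  Num.min (lo j) b <= Num.min (hi j) b & Num.min (hi j) b <= b].
Proof.
move=> ab j; have [h1 h2 h3] := hlh j; split.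
- by rewrite le_min h1.
- by rewrite le_min ge_min h2 ge_min lexx orbT.
- by rewrite ge_min lexx orbT.
Qed.

Lemma cut_right_le : b <= c -> forall j, [/\ b <= Num.max (lo j) b,
  Num.max (lo j) b <= Num.max (hi j) b & Num.max (hi j) b <= c].
Proof.
move=> bc j; have [h1 h2 h3] := hlh j; split.
- by rewrite le_max lexx orbT.
- by rewrite ge_max !le_max h2 lexx orbT.
- by rewrite ge_max h3.
Qed.

Lemma trivIset_cut_left :
  trivIset setT (fun j => `]Num.min (lo j) b, Num.min (hi j) b[%classic).
Proof.
apply: (trivIset_subset _ dj) => j _ x /=.
rewrite !in_itv/= gt_min lt_min => /andP[+ /andP[-> xb]].
by rewrite (ltNge b) (ltW xb) orbF => ->.
Qed.

Lemma trivIset_cut_right :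
  trivIset setT (fun j => `]Num.max (lo j) b, Num.max (hi j) b[%classic).
Proof.
apply: (trivIset_subset _ dj) => j _ x /=.
rewrite !in_itv/= gt_max lt_max => /andP[/andP[-> xb]].
by rewrite (ltNge x b) (ltW xb) orbF => ->.
Qed.

End Cut.

Lemma cut_norm_le (V : normedModType R) (f : R -> V) x y b : x <= y ->
  `|f y - f x| <= `|f (Num.min y b) - f (Num.min x b)|
                  + `|f (Num.max y b) - f (Num.max x b)|.
Proof.
move=> h2; rewrite /Num.min /Num.max; case: ltP => hb; case: ltP => lb.
- by rewrite subrr normr0 addr0.
- by have := le_lt_trans lb (le_lt_trans h2 hb); rewrite ltxx.
- by rewrite (le_trans _ (ler_normD _ _))// [f b - f x + _]addrC addrA subrK.
- by rewrite subrr normr0 add0r.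
Qed.

Lemma ac_cat (V : normedModType R) a b c (f : R -> V) : a <= b -> b <= c ->
  absolutely_continuous_on a b f -> absolutely_continuous_on b c f ->
  absolutely_continuous_on a c f.
Proof.
move=> ab bc H1 H2 e e0.
have e2 : 0 < e / 2 by rewrite divr_gt0.
have [d1 d10 {}H1] := H1 _ e2; have [d2 d20 {}H2] := H2 _ e2.
exists (Num.min d1 d2); first by rewrite lt_min d10.
move=> N lo hi hlh dj; rewrite lt_min => /andP[s1 s2].
have K1 : \sum_j `|f (Num.min (hi j) b) - f (Num.min (lo j) b)| < e / 2.
  apply: H1; [exact: cut_left_le hlh ab | exact: trivIset_cut_left |].
  apply: le_lt_trans s1; apply: ler_sum => j _.
  have [h1 h2 h3] := hlh j.
  by rewrite /Num.min; do 2 case: ltP => ?; lra.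
have K2 : \sum_j `|f (Num.max (hi j) b) - f (Num.max (lo j) b)| < e / 2.
  apply: H2; [exact: cut_right_le hlh bc | exact: trivIset_cut_right |].
  apply: le_lt_trans s2; apply: ler_sum => j _.
  have [h1 h2 h3] := hlh j.
  by rewrite /Num.max; do 2 case: ltP => ?; lra.
rewrite [e](splitr e); apply: le_lt_trans (ltrD K1 K2).
rewrite -big_split/=; apply: ler_sum => j _.
by have [_ h _] := hlh j; exact: cut_norm_le.
Qed.

Lemma ac_uniform (V : normedModType R) a b (f : R -> V) :
  absolutely_continuous_on a b f ->
  forall e, 0 < e -> exists2 d, 0 < d & forall s t,
    a <= s <= b -> a <= t <= b -> `|t - s| < d -> `|f t - f s| < e.
Proof.
move=> H e e0; have [d d0 {}H] := H e e0; exists d => //.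
suff K s t : a <= s -> s <= t -> t <= b -> t - s < d -> `|f t - f s| < e.
  move=> s t /andP[a1 a2] /andP[a3 a4].
  have [st|/ltW ts] := leP s t; first by rewrite ger0_norm ?subr_ge0//; exact: K.
  by rewrite distrC [X in X < e]distrC ger0_norm ?subr_ge0//; exact: K.
move=> as_ st tb std.
have := H 1%N (fun=> s) (fun=> t); rewrite !big_ord1; apply => //.
by move=> i j _ _ _; rewrite !ord1.
Qed.

Lemma ac_continuous (V : normedModType R) a b (f : R -> V) :
  absolutely_continuous_on a b f -> {within `[a, b], continuous f}.
Proof.
move=> H; apply/subspace_continuousP => s /=; rewrite in_itv/= => sab.
apply/cvgrPdist_lt => e e0; have [d d0 Hd] := ac_uniform H e0.
rewrite near_withinE; near=> t => /=; rewrite in_itv/= => tab.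
rewrite distrC; apply: (Hd _ _ sab tab); near: t.
by apply/nbhs_normP; exists d => // t /=; rewrite distrC.
Unshelve. all: by end_near. Qed.

(** Induction on an interval: let s be the supremum of the t with [P a t]. The local property at s
    joins a point just below s to a point beyond s, so s = b and it is reached. The compactness
    arguments on time intervals below (tubes, continuation, local integrability) go through this
    lemma. *)
Lemma cousin (P : R -> R -> Prop) a b : a <= b ->
  (forall x y z, a <= x -> x <= y -> y <= z -> z <= b ->
     P x y -> P y z -> P x z) ->
  (forall t, a <= t <= b -> exists2 d, 0 < d & forall x y,
     a <= x -> x <= t -> t <= y -> y <= b -> t - d < x -> y < t + d -> P x y) ->
  P a b.
Proof.
move=> ab Pcat Ploc.
pose S := [set t | a <= t <= b /\ P a t].
have Sa : S a.
  split; first by rewrite lexx.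
  have [|d d0] := Ploc a; first by rewrite lexx.
  by apply => //; lra.
have Sub : has_sup S.
  by split; [exists a | exists b => t -[/andP[]]].
pose s := sup S.
have sa : a <= s by apply: ub_le_sup => //; exact: Sub.2.
have sb : s <= b by apply: ge_sup; [exists a | move=> t -[/andP[]]].
have [|d d0 Hd] := Ploc s; first by rewrite sa.
have [t [/andP[ta tb] Pt] st] : exists2 t, S t & s - d < t.
  exact: sup_adherent.
have ts : t <= s by apply: ub_le_sup; [exact: Sub.2 | split => //; rewrite ta].
(* A point beyond s but inside the neighbourhood given at s, capped at b; that it cannot exceed s
   forces s = b. *)
pose y := Num.min b (s + d / 2).
have sy : s <= y by rewrite le_min sb lerDl divr_ge0// ltW.
have yb : y <= b by rewrite ge_min lexx.
have Pay : P a y.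
  apply: (Pcat a t y) => //; first exact: le_trans sy.
  apply: Hd => //.
  by rewrite gt_min ltrD2l ltr_pdivrMr// ltr_pMr// ltr1n orbT.
have : y <= s.
  apply: ub_le_sup; first exact: Sub.2.
  by split => //; rewrite (le_trans sa sy).
rewrite {1}/y ge_min => /orP[bs|]; last first.
  by rewrite gerDl leNgt divr_gt0.
suff -> : b = y by [].
by apply/eqP; rewrite eq_le yb andbT; exact: le_trans sy.
Qed.


(** The increment is split at t and each half compared with the difference quotient at t, so nothing
    is asked of the derivative at nearby points. *)
Lemma is_derive_upper (f : R -> R) t df e : is_derive t (1 : R) f df -> df <= 0 ->
  0 < e -> exists2 d, 0 < d & forall x y, t - d < x -> x <= t -> t <= y ->
    y < t + d -> f y - f x <= e * (y - x).
Proof.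
move=> [fd fv] df0 e0.
have : (fun h : R => h^-1 *: ((f \o shift t) (h *: (1 : R)) - f t)) @ 0^' --> df.
  by rewrite -fv; exact: fd.
move/cvgrPdist_lt => /(_ _ e0); rewrite near_withinE => -[d /= d0 Hd].
exists d => // x y tx xt ty yt.
have U h : `|h| < d -> h != 0 -> h^-1 * (f (h + t) - f t) < e.
  move=> hd h0; have := Hd h; rewrite /= sub0r normrN => /(_ hd h0).
  rewrite [h%:A]mulr1 => Hh.
  have := ltr_normlW Hh; rewrite distrC in Hh; have := ltr_normlW Hh.
  by rewrite ltrBlDr => /lt_le_trans + _; apply; rewrite gerDl.
have Uy : f y - f t <= e * (y - t).
  move: ty; rewrite le_eqVlt => /predU1P[->|ty]; first by rewrite !subrr mulr0.
  have h0 : 0 < y - t by rewrite subr_gt0.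
  have := U (y - t); rewrite gtr0_norm// gt_eqF// subrK => /(_ _ isT).
  rewrite mulrC ltr_pdivrMr//; have -> : y - t < d by lra.
  by move=> /(_ isT)/ltW.
have Ux : f t - f x <= e * (t - x).
  move: xt; rewrite le_eqVlt => /predU1P[->|xt]; first by rewrite !subrr mulr0.
  have h0 : x - t < 0 by rewrite subr_lt0.
  have := U (x - t); rewrite ltr0_norm// lt_eqF// subrK => /(_ _ isT).
  rewrite mulrC ltr_ndivrMr//; have -> : - (x - t) < d by lra.
  by move=> /(_ isT)/ltW; lra.
lra.
Qed.

(** The exceptional null set is covered by an open U of small measure. Cousin's lemma bounds the
    increment of f by a slope term from the good points plus the increments over disjoint intervals
    inside U; absolute continuity makes the latter small. *)
Lemma ac_nincr a b (f : R -> R) : a <= b -> absolutely_continuous_on a b f ->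
  {ae lebesgue_measure, forall t : R, t \in `]a, b[ ->
     exists2 df, df <= 0 & is_derive t (1 : R) f df} ->
  f b <= f a.
Proof.
move=> ab acf [N [mN N0 HN]].
apply/ler_addgt0Pr => e0 e00.
(* Chosen so that e (b - a), from the slopes, plus e, from the intervals in U, is [e0]. *)
pose e := e0 / (b - a + 1).
have ba0 : 0 < b - a + 1 by rewrite ltr_wpDl// subr_ge0.
have ep : 0 < e by rewrite divr_gt0.
have [dl dl0 Hdl] := acf e ep.
(* The endpoints join the exceptional set, since the derivative is only controlled on the open
   interval. *)
pose N' : set R := N `|` ([set a] `|` [set b]).
have mN' : measurable N' by apply: measurableU => //; apply: measurableU.
have N'0 : lebesgue_measure N' = 0.
  rewrite measureU0//; first by apply: measurableU.
  by rewrite measureU0; try exact: lebesgue_measure_set1.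
have [|U [oU NU mU]] := lebesgue_regularity_outer mN' _ dl0.
  by apply: (@le_lt_trans _ _ 0%E) => //; rewrite le_eqVlt; apply/orP; left; apply/eqP.
have mUd : (lebesgue_measure U < dl%:E)%E.
  apply: le_lt_trans mU.
  have mUN : measurable (U `\` N') by apply: measurableD => //; exact: open_measurable.
  by rewrite -[X in (lebesgue_measure X <= _)%E](setDUK NU) setUC measureU0.
pose P x y := exists n (lo hi : 'I_n -> R), [/\ forall j,
  [/\ x <= lo j, lo j <= hi j & hi j <= y] /\ `]lo j, hi j[ `<=` U,
  trivIset setT (fun j => `]lo j, hi j[%classic) &
  f y - f x <= e * (y - x) + \sum_j `|f (hi j) - f (lo j)|].
have : P a b.
  apply: cousin => //.
  - move=> x y z ax xy yz zb [n [lo [hi [H1 H2 H3]]]] [n' [lo' [hi' [H1' H2' H3']]]].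
    pose lo2 (k : 'I_(n + n')) :=
      match fintype.split k with inl i => lo i | inr i => lo' i end.
    pose hi2 (k : 'I_(n + n')) :=
      match fintype.split k with inl i => hi i | inr i => hi' i end.
    exists (n + n')%N, lo2, hi2; split.
    + move=> j; rewrite /lo2 /hi2; case: (fintype.split j) => i.
        by have [[h1 h2 h3] h4] := H1 i; split => //; split => //; exact: le_trans yz.
      by have [[h1 h2 h3] h4] := H1' i; split => //; split => //; exact: le_trans h1.
    + move=> i j _ _; rewrite /lo2 /hi2.
      case Ei: (fintype.split i) => [i'|i']; case Ej: (fintype.split j) => [j'|j'];
        move=> /= [w /= []]; rewrite !in_itv/= => /andP[w1 w2] /andP[w3 w4].
      * rewrite -(splitK i) -(splitK j) Ei Ej (H2 i' j')//.
        by exists w; rewrite /= !in_itv/= w1 w2 w3.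
      * have [[_ _ h] _] := H1 i'; have [[h' _ _] _] := H1' j'; exfalso; lra.
      * have [[_ _ h] _] := H1 j'; have [[h' _ _] _] := H1' i'; exfalso; lra.
      * rewrite -(splitK i) -(splitK j) Ei Ej (H2' i' j')//.
        by exists w; rewrite /= !in_itv/= w1 w2 w3.
    + rewrite big_split_ord/=.
      rewrite (eq_bigr (fun j => `|f (hi j) - f (lo j)|)); last first.
        by move=> j _; rewrite /hi2 /lo2 -[lshift _ _]/(unsplit (inl _)) unsplitK.
      rewrite [X in _ + (_ + X)](eq_bigr (fun j => `|f (hi' j) - f (lo' j)|)); last first.
        by move=> j _; rewrite /hi2 /lo2 -[rshift _ _]/(unsplit (inr _)) unsplitK.
      lra.
  - move=> t tab.
    (* Around a point of U the whole interval [x, y] is recorded as one interval in U; around any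
       other point no interval is recorded and the slope estimate applies. *)
    have [Ut|nUt] := pselect (U t).
      have [d /= d0 Hd] := open_subball oU Ut.
      exists (d / 2); first by rewrite divr_gt0.
      move=> x y ax xt ty yb tx yt; exists 1%N, (fun=> x), (fun=> y); split.
      + move=> _; split; first by split => //; exact: le_trans ty.
        move=> w /=; rewrite in_itv/= => /andP[xw wy].
        apply: (Hd (d / 2)) => //=.
        * by rewrite sub0r normrN gtr0_norm ?divr_gt0//; lra.
        * by rewrite divr_gt0.
        * rewrite /ball/= ltr_distlC; apply/andP; split; lra.
      + by move=> i j _ _ _; rewrite !ord1.
      + rewrite big_ord1; have : 0 <= e * (y - x).
          by rewrite mulr_ge0 ?(ltW ep)// subr_ge0; exact: le_trans ty.
        have := ler_norm (f y - f x); lra.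
    have tN : t \in `]a, b[.
      rewrite in_itv/= !lt_neqAle; case/andP: tab => -> ->; rewrite !andbT.
      apply/andP; split; apply/eqP => E; apply: nUt; apply: NU; right; [left|right].
        by [].
      by [].
    have [df df0 Hdf] : exists2 df, df <= 0 & is_derive t (1 : R) f df.
      apply: contrapT => nP; apply: nUt; apply: NU; left; apply: HN => /=.
      by move=> /(_ tN).
    have [d d0 Hd] := is_derive_upper Hdf df0 ep.
    exists d => // x y ax xt ty yb tx yt.
    exists 0%N, (fun=> 0), (fun=> 0); split; first by move=> -[].
      by move=> -[].
    by rewrite big_ord0 addr0; exact: Hd.
move=> [n [lo [hi [H1 H2 H3]]]].
have : \sum_j `|f (hi j) - f (lo j)| < e.
  apply: Hdl => //; first by move=> j; have [] := H1 j.
  rewrite -lte_fin; apply: le_lt_trans mUd.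
  rewrite -sumEFin.
  rewrite (eq_bigr (fun j => lebesgue_measure `]lo j, hi j[%classic)); last first.
    move=> j _; rewrite lebesgue_measure_itv/= lte_fin.
    have [[_ h _] _] := H1 j; case: ltP => // h'.
    by have -> : hi j = lo j; [apply/eqP; rewrite eq_le h h' | rewrite subrr].
  rewrite -measure_semi_additive_ord//; last exact: bigsetU_measurable.
  apply: le_measure; rewrite ?inE.
  - exact: bigsetU_measurable.
  - exact: open_measurable.
  - by elim/big_ind: _ => [|A B AU BU|j _]; [exact: sub0set|rewrite subUset|exact: (H1 _).2].
move=> H4.
have -> : e0 = e * (b - a) + e by rewrite /e; field; rewrite gt_eqF.
lra.
Qed.

Lemma continuous_itv_bounded (V : normedModType R) a b (f : R -> V) :
  {within `[a, b], continuous f} ->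
  exists2 M, 0 < M & forall t, a <= t <= b -> `|f t| <= M.
Proof.
move=> cf; have := continuous_compact cf (@segment_compact R a b).
move=> /compact_bounded[M0 [_ HM]].
exists (`|M0| + 1); first by rewrite ltr_wpDl.
move=> t tab; apply: (HM (`|M0| + 1)); first by rewrite (le_lt_trans (ler_norm M0))// ltrDl.
by exists t => //=; rewrite in_itv.
Qed.

Lemma acD (V : normedModType R) a b (f g : R -> V) :
  absolutely_continuous_on a b f -> absolutely_continuous_on a b g ->
  absolutely_continuous_on a b (fun t => f t + g t).
Proof.
apply: (@ac_dom _ _ _ a b 1) => s t _ _ _; rewrite mul1r.
have -> : f t + g t - (f s + g s) = (f t - f s) + (g t - g s).
  by rewrite opprD addrACA.
exact: ler_normD.
Qed.

Lemma ac_sum (V : normedModType R) a b (I : Type) (r : seq I) (P : pred I)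
    (f : I -> R -> V) :
  (forall i, P i -> absolutely_continuous_on a b (f i)) ->
  absolutely_continuous_on a b (fun t => \sum_(i <- r | P i) f i t).
Proof.
move=> H; elim: r => [|i r IH].
  by under eq_fun do rewrite big_nil; exact: ac_cst.
under eq_fun do rewrite big_cons.
have [Pi|nPi] := boolP (P i); last exact: IH.
exact: acD (H _ Pi) IH.
Qed.

Lemma acZl (V : normedModType R) a b (f : R -> R) (v : V) :
  absolutely_continuous_on a b f -> absolutely_continuous_on a b (fun t => f t *: v).
Proof.
by apply: (@ac_lip _ _ a b `|v|) => s t _ _ _; rewrite -scalerBl normrZ mulrC.
Qed.

Lemma acZr (V : normedModType R) a b (f : R -> V) (c : R) :
  absolutely_continuous_on a b f -> absolutely_continuous_on a b (fun t => c *: f t).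
Proof.
by apply: (@ac_lip _ _ a b `|c|) => s t _ _ _; rewrite -scalerBr normrZ.
Qed.

Lemma acM a b (f g : R -> R) :
  absolutely_continuous_on a b f -> absolutely_continuous_on a b g ->
  absolutely_continuous_on a b (fun t => f t * g t).
Proof.
move=> acf acg.
have [M M0 HM] := continuous_itv_bounded (ac_continuous acf).
have [N N0 HN] := continuous_itv_bounded (ac_continuous acg).
apply: (@ac_dom _ _ _ a b (M + N)) acf acg => s t as_ st tb.
have -> : f t * g t - f s * g s = (f t - f s) * g t + f s * (g t - g s) by ring.
apply: (le_trans (ler_normD _ _)); rewrite !normrM mulrDr.
apply: lerD; [rewrite mulrC|]; apply: ler_wpM2r => //.
  by rewrite (le_trans (HN t _)) ?lerDr ?(ltW M0)// (le_trans as_ st).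
by rewrite (le_trans (HM s _)) ?lerDl ?(ltW N0)// as_ (le_trans st tb).
Qed.

Lemma ac_id a b : absolutely_continuous_on a b (fun t : R => t).
Proof.
move=> e e0; exists e => // N lo hi h _.
move=> le_e; rewrite (eq_bigr (fun j => hi j - lo j))// => j _.
by have [_ ? _] := h j; rewrite ger0_norm// subr_ge0.
Qed.

Lemma mx_norm_coord m n (x : 'M[R]_(m, n)) i j : `|x i j| <= `|x|.
Proof.
rewrite [leRHS]mx_normrE.
exact: (le_bigmax_cond _ (fun ij : 'I_m * 'I_n => `|x ij.1 ij.2|) (j := (i, j))).
Qed.

Lemma mx_norm_le m n (x : 'M[R]_(m, n)) c : 0 <= c ->
  (forall i j, `|x i j| <= c) -> `|x| <= c.
Proof.
move=> c0 H; rewrite [leLHS]mx_normrE; apply: bigmax_le => // -[i j] _; exact: H.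
Qed.

Lemma ac_mxP a b m n (x : R -> 'M[R]_(m, n)) :
  absolutely_continuous_on a b x <->
  forall i j, absolutely_continuous_on a b (fun t => x t i j).
Proof.
split=> H.
  move=> i j; apply: (@ac_lip _ _ a b 1) H => s t _ _ _.
  by rewrite mul1r (le_trans _ (mx_norm_coord _ i j))// !mxE.
have -> : x = fun t => \sum_i \sum_j x t i j *: delta_mx i j.
  by apply/funext => t; exact: matrix_sum_delta.
by apply: ac_sum => i _; apply: ac_sum => j _; exact: acZl.
Qed.

(** Lets [filterS] and its variants combine almost everywhere statements. *)
#[global] Instance ae_lebesgue_filter :
  Filter (nbhs (almost_everywhere (@lebesgue_measure R))).
Proof. exact: ae_filter_ringOfSetsType. Qed.

Lemma car_eq (V : normedModType R) a b (f g h : R -> V) :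
  (forall t, a < t < b -> g t = h t) ->
  caratheodory a b f g -> caratheodory a b f h.
Proof.
move=> gh [acf H]; split => //; apply: filterS H => t H tab.
by rewrite -gh; [exact: H | rewrite in_itv in tab].
Qed.

Lemma car_sub (V : normedModType R) a b c d (f g : R -> V) : a <= c -> d <= b ->
  caratheodory a b f g -> caratheodory c d f g.
Proof.
move=> ac db [acf H]; split; first exact: ac_sub acf.
apply: filterS H => t H; rewrite in_itv/= => /andP[ct td]; apply: H.
by rewrite in_itv/= (le_lt_trans ac ct) (lt_le_trans td db).
Qed.

Lemma car_cat (V : normedModType R) a b c (f g : R -> V) : a <= b -> b <= c ->
  caratheodory a b f g -> caratheodory b c f g -> caratheodory a c f g.
Proof.
move=> ab bc [acf H1] [acg H2]; split; first exact: ac_cat acf acg.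
(* The derivative may fail to exist at the junction b, which is a null set. *)
have H3 : {ae lebesgue_measure, forall t : R, t != b}.
  exists [set b]; split => //; first exact: lebesgue_measure_set1.
  by move=> t /= /negP; rewrite negbK => /eqP.
apply: filterS3 H1 H2 H3 => t H1 H2 tb; rewrite in_itv/= => /andP[a_t tc].
case: (ltgtP t b) tb => // tb _; [apply: H1|apply: H2]; rewrite in_itv/=.
  by rewrite a_t.
by rewrite tb.
Qed.

Lemma car_cst (V : normedModType R) a b (v : V) :
  caratheodory a b (fun=> v) (fun=> 0).
Proof. by split; [exact: ac_cst | apply: aeW => t _; exact: is_derive_cst]. Qed.

Lemma carD (V : normedModType R) a b (f g df dg : R -> V) :
  caratheodory a b f df -> caratheodory a b g dg ->
  caratheodory a b (fun t => f t + g t) (fun t => df t + dg t).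
Proof.
move=> [acf H1] [acg H2]; split; first exact: acD.
by apply: filterS2 H1 H2 => t H1 H2 tab; apply: is_deriveD; [exact: H1|exact: H2].
Qed.

Lemma carZr (V : normedModType R) a b (f df : R -> V) (c : R) :
  caratheodory a b f df -> caratheodory a b (fun t => c *: f t) (fun t => c *: df t).
Proof.
move=> [acf H1]; split; first exact: acZr.
by apply: filterS H1 => t H1 tab; apply: is_deriveZ; exact: H1.
Qed.

Lemma car_sum (V : normedModType R) a b (I : Type) (r : seq I) (P : pred I)
    (f df : I -> R -> V) :
  (forall i, P i -> caratheodory a b (f i) (df i)) ->
  caratheodory a b (fun t => \sum_(i <- r | P i) f i t)
    (fun t => \sum_(i <- r | P i) df i t).
Proof.
move=> H; elim: r => [|i r IH].
  by under eq_fun do rewrite big_nil; under [X in caratheodory _ _ _ X]eq_fun do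
    rewrite big_nil; exact: car_cst.
under eq_fun do rewrite big_cons; under [X in caratheodory _ _ _ X]eq_fun do
  rewrite big_cons.
have [Pi|nPi] := boolP (P i); last exact: IH.
exact: carD (H _ Pi) IH.
Qed.

Lemma carB (V : normedModType R) a b (f g df dg : R -> V) :
  caratheodory a b f df -> caratheodory a b g dg ->
  caratheodory a b (fun t => f t - g t) (fun t => df t - dg t).
Proof.
move=> Hf /(carZr (-1)) Hg; have := carD Hf Hg.
by under eq_fun do rewrite scaleN1r; under [X in caratheodory _ _ _ X]eq_fun do
  rewrite scaleN1r.
Qed.

Lemma carM a b (f g df dg : R -> R) :
  caratheodory a b f df -> caratheodory a b g dg ->
  caratheodory a b (fun t => f t * g t) (fun t => df t * g t + f t * dg t).
Proof.
move=> [acf H1] [acg H2]; split; first exact: acM.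
apply: filterS2 H1 H2 => t H1 H2 tab.
have := is_deriveM (H1 tab) (H2 tab).
by rewrite addrC /GRing.scale/= [g t * _]mulrC.
Qed.

Lemma is_derive_mxP m n (x : R -> 'M[R]_(m, n)) t dx :
  is_derive t (1 : R) x dx <-> forall i j, is_derive t (1 : R) (fun s => x s i j) (dx i j).
Proof.
split=> H.
  move=> i j; have dxt : derivable x t 1 by exact: ex_derive.
  split; first exact: (derivable_mxP _ _ _).1 dxt i j.
  by have <- := @derive_val _ _ _ _ _ _ _ H; rewrite derive_mx// mxE.
have dxt : derivable x t 1 by apply/derivable_mxP => i j; exact: ex_derive.
split=> //; rewrite derive_mx//; apply/matrixP => i j; rewrite mxE.
exact: derive_val.
Qed.

Lemma ae_forall_fin (I : finType) (P : I -> R -> Prop) :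
  (forall i, {ae lebesgue_measure, forall t, P i t}) ->
  {ae lebesgue_measure, forall t, forall i, P i t}.
Proof.
move=> H; suff : {ae lebesgue_measure, forall t, forall i, i \in enum I -> P i t}.
  by apply: filterS => t K i; apply: K; rewrite mem_enum.
elim: (enum I) => [|i s IH]; first exact: aeW.
apply: filterS2 (H i) IH => t Pi Ps j; rewrite in_cons => /predU1P[->//|].
exact: Ps.
Qed.

Lemma car_mxP a b m n (x dx : R -> 'M[R]_(m, n)) :
  caratheodory a b x dx <->
  forall i j, caratheodory a b (fun t => x t i j) (fun t => dx t i j).
Proof.
split=> [[acx H] i j|H].
  split; first exact: (ac_mxP _ _ _).1.
  by apply: filterS H => t H tab; exact: ((is_derive_mxP _ _ _).1 (H tab)).
split; first by apply/ac_mxP => i j; case: (H i j).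
have := @ae_forall_fin ('I_m * 'I_n)%type _ (fun ij => (H ij.1 ij.2).2).
apply: filterS => t K tab; apply/is_derive_mxP => i j; exact: (K (i, j)).
Qed.

(* Only the sign of a.e. derivatives matters, so no Lebesgue integral is needed. *)
Lemma car_le a b (f g df dg : R -> R) : a <= b ->
  caratheodory a b f df -> caratheodory a b g dg ->
  {ae lebesgue_measure, forall t, a < t < b -> df t <= dg t} ->
  f b - f a <= g b - g a.
Proof.
move=> ab Hf Hg Hle; have [acfg H] := carB Hf Hg.
suff : f b - g b <= f a - g a by lra.
apply: (ac_nincr ab acfg); apply: filterS2 H Hle => t H Hle tab.
by exists (df t - dg t); [rewrite subr_le0; apply: Hle; rewrite in_itv in tab|exact: H].
Qed.

Lemma car_norm_le a b (f g df dg : R -> R) : a <= b ->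
  caratheodory a b f df -> caratheodory a b g dg ->
  {ae lebesgue_measure, forall t, a < t < b -> `|df t| <= dg t} ->
  `|f b - f a| <= g b - g a.
Proof.
move=> ab Hf Hg Hle; rewrite ler_norml; apply/andP; split; last first.
  apply: (car_le ab Hf Hg); apply: filterS Hle => t Hle tab.
  exact: le_trans (ler_norm _) (Hle tab).
have Hf' := carB (car_cst a b 0) Hf.
have : (0 - f b) - (0 - f a) <= g b - g a.
  apply: (car_le ab Hf' Hg); apply: filterS Hle => t Hle tab.
  by rewrite sub0r (le_trans (ler_norm _))// normrN; exact: Hle.
lra.
Qed.

End AbsolutelyContinuous.

(** * Summable functions: derivatives of absolutely continuous functions, and primitives *)

Section Summable.
Variable R : realType.
Implicit Types (a b c d : R).
Local Notation mu := (@lebesgue_measure R).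

Lemma is_derive_straddle (f : R -> R) t df e : is_derive t (1 : R) f df ->
  0 < e -> exists2 d, 0 < d & forall x y, t - d < x -> x <= t -> t <= y ->
    y < t + d -> `|f y - f x - df * (y - x)| <= e * (y - x).
Proof.
move=> Hf e0.
have H1 : is_derive t (1 : R) (fun s => f s - df * s) 0.
  rewrite -(subrr df); apply: is_deriveB.
  by have := @is_deriveZ _ _ _ id df t 1 1 _; rewrite /GRing.scale/= mulr1; apply.
have H2 : is_derive t (1 : R) (fun s => - (f s - df * s)) 0.
  by rewrite -oppr0; apply: is_deriveN.
have [d1 d10 K1] := is_derive_upper H1 (lexx 0) e0.
have [d2 d20 K2] := is_derive_upper H2 (lexx 0) e0.
exists (Num.min d1 d2); first by rewrite lt_min d10.
move=> x y h1 xt ty h2.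
have m1 : Num.min d1 d2 <= d1 by rewrite ge_min lexx.
have m2 : Num.min d1 d2 <= d2 by rewrite ge_min lexx orbT.
have {}K1 := K1 x y _ xt ty _; have {}K2 := K2 x y _ xt ty _.
rewrite ler_norml; apply/andP; split.
  have := K2 _ _; rewrite -[X in X -> _]/(t - d2 < x -> _).
  by move=> K; have := K ltac:(lra) ltac:(lra); lra.
by have := K1 ltac:(lra) ltac:(lra); lra.
Qed.

(** Absolute continuity bounds the variation by 1 on every interval shorter than some d; [cousin]
    adds up these local bounds. *)
Lemma ac_bv a b (f : R -> R) : a <= b -> absolutely_continuous_on a b f ->
  exists V : R, forall (N : nat) (lo hi : 'I_N -> R),
    (forall j, [/\ a <= lo j, lo j <= hi j & hi j <= b]) ->
    trivIset setT (fun j => `]lo j, hi j[%classic) ->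
    \sum_j `|f (hi j) - f (lo j)| <= V.
Proof.
move=> ab acf.
apply: (@cousin _ (fun x y => exists V : R, forall (N : nat) (lo hi : 'I_N -> R),
    (forall j, [/\ x <= lo j, lo j <= hi j & hi j <= y]) ->
    trivIset setT (fun j => `]lo j, hi j[%classic) ->
    \sum_j `|f (hi j) - f (lo j)| <= V) a b) => //.
  move=> x y z ax xy yz zb [V1 H1] [V2 H2]; exists (V1 + V2) => N lo hi hlh dj.
  have {}H1 := H1 _ _ _ (cut_left_le hlh xy) (trivIset_cut_left dj).
  have {}H2 := H2 _ _ _ (cut_right_le hlh yz) (trivIset_cut_right dj).
  apply: le_trans (lerD H1 H2).
  rewrite -big_split/=; apply: ler_sum => j _.
  by have [_ h _] := hlh j; exact: cut_norm_le.
move=> t tab; have [d d0 Hd] := acf _ ltr01.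
exists (d / 2) => [|x y ax xt ty yb tx yt]; first by rewrite divr_gt0.
exists 1 => N lo hi hlh dj; apply/ltW/Hd => //.
  by move=> j; have [h1 h2 h3] := hlh j; split => //; lra.
rewrite -lte_fin -sumEFin.
rewrite (eq_bigr (fun j => mu `]lo j, hi j[%classic)); last first.
  move=> j _; rewrite lebesgue_measure_itv/= lte_fin.
  have [_ h _] := hlh j; case: ltP => // h'.
  by have -> : hi j = lo j; [apply/eqP; rewrite eq_le h h' | rewrite subrr].
rewrite -measure_semi_additive_ord//; last exact: bigsetU_measurable.
apply: (@le_lt_trans _ _ (mu `[x, y]%classic)).
  apply: le_measure; rewrite ?inE//; first exact: bigsetU_measurable.
  elim/big_ind: _ => [|A B AU BU|j _]; [exact: sub0set|by rewrite subUset|].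
  have [h1 h2 h3] := hlh j.
  by move=> w /=; rewrite !in_itv/= => /andP[w1 w2]; apply/andP; split; lra.
rewrite lebesgue_measure_itv/= [(x%:E < y%:E)%E]lte_fin; case: (ltP x y) => _.
  by rewrite -EFinB lte_fin; lra.
by rewrite lte_fin.
Qed.


Lemma integral_indic_step (D : set R) (K : nat) (c lo hi : 'I_K -> R) (d : R) :
  measurable D -> (forall j, hi j - lo j = d) -> 0 <= d ->
  (\int[mu]_(x in D) (`|\sum_(j < K) c j * \1_(`[lo j, hi j[%classic) x|%:E)
    <= (\sum_(j < K) `|c j| * d)%:E)%E.
Proof.
move=> mD hd d0.
apply: (@le_trans _ _ (\int[mu]_(x in D) (\sum_(j < K)
    (`|c j| * \1_(`[lo j, hi j[%classic) x)%:E))%E).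
  apply: ge0_le_integral => //.
  - apply/measurable_EFinP/measurableT_comp => //.
    by apply: measurable_sum => j; apply: measurable_funM.
  - by apply: emeasurable_sum => j; apply/measurable_EFinP/measurable_funM.
  - move=> x _; rewrite sumEFin lee_fin (le_trans (ler_norm_sum _ _ _))//.
    by apply: ler_sum => j _; rewrite normrM (ger0_norm (_ : 0 <= \1_ _ x)).
rewrite ge0_integral_sum//; last first.
  by move=> j; apply/measurable_EFinP/measurable_funM.
rewrite -sumEFin; apply: lee_sum => j _.
under eq_integral do rewrite EFinM.
rewrite ge0_integralZl//; last exact/measurable_EFinP.
rewrite EFinM lee_wpmul2l// ?lee_fin// integral_indic//.
apply: (@le_trans _ _ (mu `[lo j, hi j[%classic)).
  by apply: le_measure; rewrite ?inE//; exact: measurableI.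
rewrite lebesgue_measure_itv/= lte_fin; case: (ltP (lo j) (hi j)) => _.
  by rewrite -EFinB hd.
by rewrite lee_fin.
Qed.


(** Integrability up to a null set and regardless of values outside ]a, b[. The function g itself
    may fail to be Borel measurable, as a control may; only the representative h is integrable in
    the sense of the library. *)
Definition summable_on a b (g : R -> R) : Prop := exists2 h : R -> R,
  mu.-integrable setT (EFin \o h) &
  {ae mu, forall t, a < t < b -> g t = h t}.

Lemma limn_einf_ub (u : (\bar R) ^nat) (V : \bar R) :
  (forall n, (u n <= V)%E) -> (limn_einf u <= V)%E.
Proof.
move=> uV; rewrite limn_einf_lim; apply: lime_le; first exact: is_cvg_einfs.
apply: nearW => n; apply: le_trans (uV n).
by apply: ereal_inf_lbound; exists n => //=.
Qed.

(* Fatou applied to the difference quotients of f over finer and finer uniform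
   partitions, whose integrals are bounded by the variation of f. *)
Lemma car_summable a b (f g : R -> R) : a <= b ->
  caratheodory a b f g -> summable_on a b g.
Proof.
rewrite le_eqVlt => /predU1P[<- _|ab [acf [N [mN N0 HN]]]].
  exists (cst 0); first exact: integrable0.
  by apply: aeW => t /andP[h1 h2]; have := lt_trans h1 h2; rewrite ltxx.
have [V HV] := ac_bv (ltW ab) acf.
pose D := `]a, b[%classic `\` N.
have mD : measurable D by apply: measurableD.
pose d (K : nat) := (b - a) / K.+1%:R.
have d0 K : 0 < d K by rewrite divr_gt0// subr_gt0.
pose p K (j : nat) := a + j%:R * d K.
have pS K j : p K j.+1 - p K j = d K by rewrite /p -natr1; ring.
have pb K : p K K.+1 = b by rewrite /p /d mulrCA divff ?mulr1 ?pnatr_eq0//; ring.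
have pmono K i j : (i <= j)%N -> p K i <= p K j.
  by move=> ij; rewrite lerD2l ler_wpM2r ?ler_nat// ltW.
pose c K j := (f (p K j.+1) - f (p K j)) / d K.
pose h K (t : R) := \sum_(j < K.+1) c K j * \1_(`[p K j, p K j.+1[%classic) t.
have mh K : measurable_fun D (h K).
  by apply: measurable_sum => j; apply: measurable_funM.
have gN t : D t -> is_derive t (1 : R) f (g t).
  move=> [tab tN]; apply: contrapT => nP; apply: tN; apply: HN => /=.
  by move=> K; apply: nP; apply: K.
have hg t : D t -> h ^~ t @ \oo --> g t.
  move=> Dt; have [/= tab _] := Dt; rewrite in_itv/= in tab; case/andP: tab => at_ tb.
  apply/cvgrPdist_le => e e0; have [r r0 Hr] := is_derive_straddle (gN _ Dt) e0.
  have : (fun K => d K) @ \oo --> (0 : R).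
    rewrite -[0](mulr0 (b - a)); apply: cvgMr.
    exact: (@cvg_harmonic R).
  move/cvgrPdist_lt => /(_ _ r0); apply: filterS => K; rewrite sub0r normrN gtr0_norm// => dr.
  have ta0 : 0 <= (t - a) / d K by rewrite divr_ge0 ?(ltW (d0 K))// subr_ge0 ltW.
  pose j := Num.trunc ((t - a) / d K).
  have /andP[j1 j2] := truncn_itv ta0; rewrite -/j in j1 j2.
  have {}j1 : p K j <= t by move: j1; rewrite ler_pdivlMr// /p; lra.
  have {}j2 : t < p K j.+1 by move: j2; rewrite ltr_pdivrMr// /p; lra.
  have jK : (j < K.+1)%N.
    rewrite ltnNge; apply/negP => Kj; have := pmono K _ _ Kj; rewrite pb; lra.
  have -> : h K t = c K j.
    rewrite /h (bigD1 (Ordinal jK))//= indicE mem_set ?mulr1/=; last first.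
      by rewrite in_itv/= j1.
    rewrite big1 ?addr0// => i ij; rewrite indicE memNset ?mulr0//= in_itv/=.
    move=> /andP[i1 i2]; case: (ltngtP i j) => [lij|lji|eij].
    - by have := pmono K _ _ lij; lra.
    - by have := pmono K _ _ lji; lra.
    - by move/eqP: ij; apply; apply: val_inj.
  have := Hr (p K j) (p K j.+1); rewrite pS => Hr'.
  have pSj := pS K j.
  have {}Hr := Hr' ltac:(lra) j1 (ltW j2) ltac:(lra).
  have dK0 : d K != 0 by rewrite gt_eqF.
  rewrite distrC (_ : c K j - g t = (f (p K j.+1) - f (p K j) - g t * d K) / d K).
    by rewrite normrM normfV (gtr0_norm (d0 K)) ler_pdivrMr.
  by rewrite [RHS]mulrBl mulfK.
have hV K : (\int[mu]_(x in D) `|h K x|%:E <= V%:E)%E.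
  apply: le_trans (integral_indic_step _ mD (fun j => pS K j) (ltW (d0 K))) _.
  rewrite lee_fin; apply: le_trans (HV K.+1 (fun j => p K j) (fun j => p K j.+1) _ _).
  - apply: ler_sum => j _; rewrite /c normrM normfV (gtr0_norm (d0 K)) divfK//.
    by rewrite gt_eqF.
  - move=> j; split; [|exact: pmono|].
      by have := pmono K _ _ (leq0n j); rewrite {1}/p mul0r addr0.
    by rewrite -(pb K); exact: pmono.
  - move=> i j _ _ [w /= []]; rewrite !in_itv/= => /andP[w1 w2] /andP[w3 w4].
    apply: val_inj; case: (ltngtP i j) => // lij.
    + by exfalso; have := pmono K _ _ lij; lra.
    + by exfalso; have := pmono K _ _ lij; lra.
have mg : measurable_fun D g by exact: (measurable_fun_cvg mh hg).
have gV : (\int[mu]_(x in D) `|g x|%:E <= V%:E)%E.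
  have -> : (\int[mu]_(x in D) `|g x|%:E
      = \int[mu]_(x in D) limn_einf (fun K => `|h K x|%:E))%E.
    apply: eq_integral => x; rewrite inE => Dx.
    have ghx : (fun K => `|h K x|%:E) @ \oo --> `|g x|%:E.
      by apply: cvg_EFin; [exact: nearW|]; apply: cvg_norm; exact: hg.
    by rewrite is_cvg_limn_einfE; [apply/esym/cvg_lim|apply/cvg_ex; exists `|g x|%:E].
  apply: le_trans (fatou _ _ _ _) _ => //.
    by move=> K; apply/measurable_EFinP/measurableT_comp => //; exact: mh.
  exact: limn_einf_ub.
exists (g \_ D).
  have : mu.-integrable D (EFin \o g).
    apply/integrableP; split; first exact/measurable_EFinP.
    exact: le_lt_trans gV (ltry _).
  by move=> intg; rewrite -restrict_EFin; apply/integrable_restrict => //=; rewrite setTI.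
exists N; split => // t /=; apply: contra_notP => tN tab.
by rewrite patchE mem_set//; split => //=; rewrite in_itv.
Qed.


Lemma summable_sub a b c d (g : R -> R) : a <= c -> d <= b ->
  summable_on a b g -> summable_on c d g.
Proof.
move=> ac db [h hi H]; exists h => //; apply: filterS H => t H /andP[ct td].
by apply: H; rewrite (le_lt_trans ac ct) (lt_le_trans td db).
Qed.

Lemma summable_eq a b (g k : R -> R) : {ae mu, forall t, a < t < b -> g t = k t} ->
  summable_on a b g -> summable_on a b k.
Proof.
move=> gk [h hi H]; exists h => //; apply: filterS2 gk H => t H1 H2 tab.
by rewrite -H1// H2.
Qed.

Lemma summable0 a b : summable_on a b (fun=> 0).
Proof. by exists (cst 0); [exact: integrable0 | exact: aeW]. Qed.

Lemma summableD a b (g k : R -> R) : summable_on a b g -> summable_on a b k ->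
  summable_on a b (fun t => g t + k t).
Proof.
move=> [h hi H] [h' hi' H']; exists (h \+ h').
  have := integrableD measurableT hi hi'.
  by congr (_.-integrable _ _).
by apply: filterS2 H H' => t H H' tab; rewrite /= H ?H'.
Qed.

Lemma summable_sum a b (I : Type) (r : seq I) (P : pred I) (g : I -> R -> R) :
  (forall i, P i -> summable_on a b (g i)) ->
  summable_on a b (fun t => \sum_(i <- r | P i) g i t).
Proof.
move=> H; elim: r => [|i r IH].
  by under eq_fun do rewrite big_nil; exact: summable0.
under eq_fun do rewrite big_cons.
have [Pi|nPi] := boolP (P i); last exact: IH.
exact: summableD (H _ Pi) IH.
Qed.

Lemma summable_norm a b (g : R -> R) : summable_on a b g ->
  summable_on a b (fun t => `|g t|).
Proof.
move=> [h hi H]; exists (Num.norm \o h); first exact: integrable_norm.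
by apply: filterS H => t H tab; rewrite /= H.
Qed.

Lemma summableM a b (c g : R -> R) : {within `[a, b], continuous c} ->
  summable_on a b g -> summable_on a b (fun t => c t * g t).
Proof.
move=> cc [h hi H]; exists ((fun t => c t * h t) \_ `[a, b]); last first.
  apply: filterS H => t H tab; rewrite patchE mem_set ?H//=.
  by rewrite in_itv/=; case/andP: tab => /ltW-> /ltW->.
have mI : measurable (`[a, b] : set R) by exact: measurable_itv.
have mc : measurable_fun (`[a, b] : set R) c by exact: subspace_continuous_measurable_fun.
have [M M0 HM] := continuous_itv_bounded cc.
have hi' : mu.-integrable `[a, b] (EFin \o h) by exact: integrableS hi.
have bc : [bounded c x | x in `[a, b]%classic].
  exists M; split; first exact: num_real.
  move=> x Mx y /=; rewrite in_itv/= => yab; exact: le_trans (HM _ yab) (ltW Mx).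
have intg : mu.-integrable `[a, b] (EFin \o (fun t => c t * h t)).
  have := @integrableMr _ _ R mu (`[a, b]%classic) _ c (EFin \o h).
  by apply => //; exact: measurable_itv.
by rewrite -restrict_EFin; apply/integrable_restrict => //=; rewrite setTI.
Qed.

Lemma summable_cat a b c (g : R -> R) : a <= b -> b <= c ->
  summable_on a b g -> summable_on b c g -> summable_on a c g.
Proof.
move=> ab bc [h hi H] [k ki K].
pose E : set R := `]-oo, b]%classic.
have rst (f : R -> R) (D : set R) : measurable D -> mu.-integrable setT (EFin \o f) ->
    mu.-integrable setT (EFin \o (f \_ D)).
  move=> mD fi; rewrite -restrict_EFin; apply/integrable_restrict => //=.
  by rewrite setTI; apply: integrableS fi.
exists (h \_ E \+ k \_ (~` E)).
  have := integrableD measurableT (rst h E _ hi) (rst k (~` E) _ ki).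
  by move=> L; have := L ltac:(exact: measurable_itv)
    ltac:(by apply: measurableC; exact: measurable_itv); congr (_.-integrable _ _).
have H3 : {ae mu, forall t : R, t != b}.
  exists [set b]; split => //; first exact: lebesgue_measure_set1.
  by move=> t /= /negP; rewrite negbK => /eqP.
apply: filterS3 H K H3 => t H K tb /andP[a_t tc] /=.
rewrite !patchE; case: (ltgtP t b) tb => // tb _.
  rewrite mem_set; last by rewrite /E/= in_itv/= ltW.
  rewrite memNset ?addr0; first by rewrite H// a_t.
  by apply; rewrite /E/= in_itv/= ltW.
rewrite memNset; last by rewrite /E/= in_itv/=; apply/negP; rewrite -ltNge.
rewrite mem_set ?add0r; first by rewrite K// tb.
by rewrite /E/= in_itv/=; apply/negP; rewrite -ltNge.
Qed.

(** Absolute continuity of the integral of the representative h gives that of F, and the Lebesgue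
    differentiation theorem gives its derivative. This produces the majorant [W] and the coordinates
    of the solution of the triangular system. *)
Lemma summable_primitive a b (g : R -> R) : summable_on a b g ->
  exists F, caratheodory a b F g.
Proof.
move=> [h hi H]; pose F x := \int[mu]_(t in `]-oo, x]) h t; exists F.
have hiD (i : interval R) : mu.-integrable [set` i] (EFin \o h).
  by apply: integrableS hi => //; exact: measurable_itv.
have Flh x y : x <= y -> `|F y - F x|%:E = `|\int[mu]_(t in `]x, y[) h t|%:E.
  move=> xy; rewrite /F (Rintegral_itvB (hiD _)) ?bnd_simp//.
  by rewrite (Rintegral_itv_bndo_bndc (hiD _)).
split; last first.
  have li : locally_integrable setT h.
    have := @integrable_locally R h setT measurableT hi.
    by rewrite patch_setT.
  have := FTC1Ny (fun y => hiD `]-oo, y]) li.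
  apply: filterS2 H => t Hg [F1 F2]; rewrite in_itv/= => tab.
  by split => //; rewrite (Hg tab) -F2 derive1E.
move=> e e0; have [d [d0 Hd]] := integral_normr_continuous hi e0.
exists d => // N lo hi' hlh dj sd.
have mI j : measurable (`]lo j, hi' j[%classic : set R) by exact: measurable_itv.
have mU : measurable (\big[setU/set0]_(j < N) `]lo j, hi' j[%classic : set R).
  exact: bigsetU_measurable.
have : (mu (\big[setU/set0]_(j < N) `]lo j, hi' j[%classic) < d%:E)%E.
  rewrite measure_semi_additive_ord//.
  rewrite (eq_bigr (fun j => (hi' j - lo j)%:E)) ?sumEFin ?lte_fin// => j _.
  transitivity (mu `]lo j, hi' j[%classic); first by [].
  rewrite lebesgue_measure_itv/= lte_fin.
  have [_ hh _] := hlh j; case: ltP => // h'.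
  by have -> : hi' j = lo j; [apply/eqP; rewrite eq_le hh h' | rewrite subrr].
move=> /(Hd _ mU); apply: le_lt_trans.
have hn0 : mu.-integrable setT (EFin \o (Num.norm \o h)) by exact: integrable_norm.
have hn (D : set R) : measurable D -> mu.-integrable D (EFin \o (Num.norm \o h)).
  by move=> mD; apply: integrableS hn0.
rewrite -lee_fin -sumEFin /Rintegral fineK; last first.
  by apply: integrable_fin_num => //; exact: hn.
rewrite ge0_integral_bigsetU//=; last 3 first.
- exact: index_enum_uniq.
- by move: dj; apply: sub_trivIset.
- exact: measurable_int (hn _ mU).
apply: lee_sum => j _; have [_ hh _] := hlh j.
rewrite Flh// -[leRHS]fineK; last by apply: integrable_fin_num; [exact: mI|exact: hn].
by rewrite lee_fin; exact: le_normr_Rintegral (hiD _).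
Qed.

End Summable.

(** * Multilinear forms and filtrations *)

Section MultilinearForms.
Variables (A : comNzRingType) (n : nat).
Implicit Types (c : seq 'I_n -> A) (v : 'I_n -> A) (C : nat -> seq 'I_n -> A).

(* c lists the values on the standard basis of forms of every degree; only those on
   sequences of size [size vs] are used. *)
Fixpoint mform c (vs : seq ('I_n -> A)) : A :=
  if vs is v :: vs' then \sum_j v j * mform (fun a => c (j :: a)) vs' else c [::].

(** A polynomial in v cut at degree [K - 1]. The factors 1/m! are not part of it: [taylor_coef] puts
    them into [C]. *)
Definition pform (K : nat) C v : A := \sum_(m < K) mform (C m) (nseq m v).

Lemma eq_mform c c' vs : (forall a, size a = size vs -> c a = c' a) ->
  mform c vs = mform c' vs.
Proof.
elim: vs c c' => [|v vs IH] c c' H /=; first exact: H.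
by apply: eq_bigr => j _; congr (_ * _); apply: IH => a sa; rewrite H//= sa.
Qed.

Lemma mformZ k c vs : mform (fun a => k * c a) vs = k * mform c vs.
Proof.
elim: vs c => [|v vs IH] c //=; rewrite mulr_sumr; apply: eq_bigr => j _.
by rewrite IH mulrCA.
Qed.

Lemma mform_scale_nseq k c v m ws :
  mform c (nseq m (fun j => k * v j) ++ ws) = k ^+ m * mform c (nseq m v ++ ws).
Proof.
elim: m c => [|m IH] c; first by rewrite expr0 mul1r.
rewrite /= mulr_sumr; apply: eq_bigr => j _.
by rewrite IH exprS; ring.
Qed.

Lemma mform0 c vs : (forall a, c a = 0) -> mform c vs = 0.
Proof.
elim: vs c => [|w ws IH] c c0 /=; first exact: c0.
by rewrite big1// => j _; rewrite IH ?mulr0// => a; exact: c0.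
Qed.

Definition symmetric_coef c := forall a a', perm_eq a a' -> c a = c a'.

Lemma symmetric_coef_cons c j : symmetric_coef c -> symmetric_coef (fun a => c (j :: a)).
Proof. by move=> sc a a' aa'; apply: sc; rewrite perm_cons. Qed.

Lemma mform_swap c u v vs : symmetric_coef c ->
  mform c (u :: v :: vs) = mform c (v :: u :: vs).
Proof.
move=> sc /=; under eq_bigr do rewrite mulr_sumr.
rewrite exchange_big /=; apply: eq_bigr => j _; rewrite mulr_sumr.
apply: eq_bigr => i _; rewrite mulrCA; congr (_ * (_ * _)); apply: eq_mform => a _.
by apply: sc; rewrite (perm_catCA [:: i] [:: j] a).
Qed.

Lemma mform_cons_cat c u us vs : symmetric_coef c ->
  mform c (u :: us ++ vs) = mform c (us ++ u :: vs).
Proof.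
elim: us c => [//|w us IH] c sc.
rewrite cat_cons mform_swap//; apply: eq_bigr => j _; congr (_ * _).
by apply: IH; exact: symmetric_coef_cons.
Qed.

(** Induction by Pascal's rule; symmetry moves a peeled v behind the copies of u. The tail [ws]
    makes the formula applicable to the first block of a longer argument list, as the multinomial
    induction requires. *)
Lemma mform_binomial c u v r ws : symmetric_coef c ->
  mform c (nseq r (fun j => u j + v j) ++ ws) =
  \sum_(i < r.+1) mform c (nseq i u ++ nseq (r - i) v ++ ws) *+ 'C(r, i).
Proof.
elim: r c => [|r IH] c sc; first by rewrite big_ord1 bin0 mulr1n.
rewrite /=; under eq_bigr => j _ do rewrite (IH _ (@symmetric_coef_cons c j sc)) mulrDl.
rewrite big_split/=.
under eq_bigr => j _ do rewrite mulr_sumr.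
under [X in _ + X]eq_bigr => j _ do rewrite mulr_sumr.
rewrite exchange_big/= [X in _ + X]exchange_big/=.
have E1 (i : 'I_r.+1) : \sum_j u j * (mform (fun a => c (j :: a))
      (nseq i u ++ nseq (r - i) v ++ ws) *+ 'C(r, i)) =
    mform c (nseq i.+1 u ++ nseq (r - i) v ++ ws) *+ 'C(r, i).
  by rewrite /= -sumrMnl; apply: eq_bigr => j _; rewrite mulrnAr.
have E2 (i : 'I_r.+1) : \sum_j v j * (mform (fun a => c (j :: a))
      (nseq i u ++ nseq (r - i) v ++ ws) *+ 'C(r, i)) =
    mform c (nseq i u ++ nseq (r.+1 - i) v ++ ws) *+ 'C(r, i).
  rewrite subSn ?leq_ord// -[nseq _.+1 _ ++ _]/(v :: _) -mform_cons_cat//= -sumrMnl.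
  by apply: eq_bigr => j _; rewrite mulrnAr.
under eq_bigr => i _ do rewrite E1.
under [X in _ + X]eq_bigr => i _ do rewrite E2.
rewrite [RHS]big_ord_recl /= bin0.
under [X in _ = _ + X]eq_bigr => i _ do rewrite /bump /= add1n binS mulrnDr subSS.
rewrite big_split /= addrA [RHS]addrC; congr (_ + _).
rewrite [in RHS]big_ord_recr/= bin_small ?ltnSn// mulr0n addr0.
by rewrite big_ord_recl /= bin0; congr (_ + _); apply: eq_bigr.
Qed.

End MultilinearForms.

Section Morphism.
Variables (A B : comNzRingType) (n : nat) (f : A -> B).
Hypotheses (f0 : f 0 = 0) (fD : {morph f : x y / x + y}) (fM : {morph f : x y / x * y}).

Let f_sum (I : Type) (r : seq I) (P : pred I) F :
  f (\sum_(i <- r | P i) F i) = \sum_(i <- r | P i) f (F i).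
Proof. exact: (big_morph f fD f0). Qed.

(** The morphism is a bare function with its laws, so that one lemma covers [polyC], evaluation of a
    polynomial at s and evaluation of a function at a point. *)
Lemma mform_morph (c : seq 'I_n -> A) vs :
  f (mform c vs) = mform (f \o c) [seq f \o v | v <- vs].
Proof.
elim: vs c => [//|v vs IH] c /=; rewrite f_sum; apply: eq_bigr => j _.
by rewrite fM IH.
Qed.

Lemma pform_morph K (C : nat -> seq 'I_n -> A) v :
  f (pform K C v) = pform K (fun m => f \o C m) (f \o v).
Proof.
by rewrite f_sum; apply: eq_bigr => m _; rewrite mform_morph map_nseq.
Qed.

End Morphism.

Section Step.
Variables (A : comNzRingType) (n K : nat).

(** The map b |-> B (x - C(b)), whose fixed points solve L b + C(b) = x when B inverts L. It is
    written over any commutative ring, to be run on numbers, on polynomials in s and on functions of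
    (t, s). *)
Definition step (B : 'I_n -> 'I_n -> A) (C : 'I_n -> nat -> seq 'I_n -> A)
    (x b : 'I_n -> A) : 'I_n -> A :=
  fun d => \sum_e B d e * (x e - pform K (C e) b).

End Step.

Section Filtration.
Variables (A : comNzRingType) (n : nat) (I : nat -> A -> Prop).

(** [I N a] reads: a has order at least N. The instances are divisibility by X^N ([poly_ord]),
    uniform bounds by |s|^N ([uniform_O]) and, with [I] constant in N, classes of functions stable
    under ring operations. *)
Record filtration : Prop := Filtration {
  filt0 : forall N, I N 0;
  filtD : forall N a b, I N a -> I N b -> I N (a + b);
  filtN : forall N a, I N a -> I N (- a);
  filtM : forall N M a b, I N a -> I M b -> I (N + M) (a * b);
  filtS : forall N a, I N.+1 a -> I N a }.

Hypothesis FI : filtration.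

Lemma filtB N a b : I N a -> I N b -> I N (a - b).
Proof. by move=> Ha Hb; apply: filtD => //; exact: filtN. Qed.

Lemma filt_le M N a : (M <= N)%N -> I N a -> I M a.
Proof.
by move=> /subnK <-; elim: (N - M)%N => [//|k IH] /(filtS FI); exact: IH.
Qed.

Lemma filt_sum (T : Type) (r : seq T) (P : pred T) (F : T -> A) N :
  (forall i, P i -> I N (F i)) -> I N (\sum_(i <- r | P i) F i).
Proof.
by move=> H; elim/big_ind: _ => //; [exact: filt0 | exact: filtD].
Qed.

Lemma filt_mform (c : seq 'I_n -> A) (v : 'I_n -> A) k m :
  (forall a, I 0 (c a)) -> (forall j, I k (v j)) ->
  I (k * m) (mform c (nseq m v)).
Proof.
move=> Hc Hv; elim: m c Hc => [|m IH] c Hc; first by rewrite muln0; exact: Hc.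
rewrite mulnS; apply: filt_sum => j _; apply: filtM => //.
by apply: IH => a; exact: Hc.
Qed.

Lemma filt_pform K (C : nat -> seq 'I_n -> A) (v : 'I_n -> A) :
  (forall m a, I 0 (C m a)) -> (forall j, I 0 (v j)) -> I 0 (pform K C v).
Proof.
by move=> HC Hv; apply: filt_sum => m _; rewrite -[0%N](mul0n m); exact: filt_mform.
Qed.

Lemma filt_pform_ord K d (C : nat -> seq 'I_n -> A) (v : 'I_n -> A) :
  (forall m a, I 0 (C m a)) -> (forall m a, (m < d)%N -> C m a = 0) ->
  (forall j, I 1 (v j)) -> I d (pform K C v).
Proof.
move=> HC Cd Hv; apply: filt_sum => m _; have [md|dm] := ltnP m d.
  rewrite (_ : mform _ _ = 0); first exact: filt0.
  by rewrite mform0// => a; exact: Cd.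
by apply: (filt_le dm); rewrite -[X in I X _]mul1n; exact: filt_mform.
Qed.

(** The arguments are exchanged one at a time: the changed one has order N and the other m - 1 have
    order k. For k = 1 and m >= 2 the order rises, which is the source of the contraction. *)
Lemma filt_mform_sub (c : seq 'I_n -> A) (v w : 'I_n -> A) k N m :
  (forall a, I 0 (c a)) -> (forall j, I k (v j)) -> (forall j, I k (w j)) ->
  (forall j, I N (v j - w j)) ->
  I (N + k * m.-1) (mform c (nseq m v) - mform c (nseq m w)).
Proof.
move=> Hc Hv Hw Hvw; elim: m c Hc => [|m IH] c Hc.
  by rewrite subrr; exact: filt0.
rewrite /= -sumrB; apply: filt_sum => j _.
set p := mform _ _; set q := mform _ _.
have -> : v j * p - w j * q = (v j - w j) * p + w j * (p - q) by ring.
apply: filtD => //; first by apply: filtM => //; apply: filt_mform => // a; exact: Hc.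
case: m IH @p @q => [|m] IH p q; first by rewrite subrr mulr0; exact: filt0.
rewrite mulnS addnCA; apply: filtM => //.
by apply: IH => a; exact: Hc.
Qed.

Lemma filt_pform_sub K (C : nat -> seq 'I_n -> A) (v w : 'I_n -> A) k N d :
  (forall m a, I 0 (C m a)) -> (forall j, I k (v j)) -> (forall j, I k (w j)) ->
  (forall m a, (m < d)%N -> C m a = 0) ->
  (forall j, I N (v j - w j)) -> I (N + k * d.-1) (pform K C v - pform K C w).
Proof.
move=> HC Hv Hw Cd Hvw; rewrite -sumrB; apply: filt_sum => m _.
have [md|dm] := ltnP m d.
  rewrite (_ : _ - _ = 0); first exact: filt0.
  by rewrite !mform0 ?subrr// => a; exact: Cd.
apply: (@filt_le _ (N + k * m.-1)); last exact: filt_mform_sub.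
by rewrite leq_add2l leq_mul2l -!subn1 leq_sub2r ?orbT.
Qed.

Lemma filt_pform_widen K K' (C : nat -> seq 'I_n -> A) (v : 'I_n -> A) :
  (forall m a, I 0 (C m a)) -> (forall j, I 1 (v j)) -> (K <= K')%N ->
  I K (pform K' C v - pform K C v).
Proof.
move=> HC Hv KK'; rewrite /pform.
rewrite -!(big_mkord xpredT (fun m => mform (C m) (nseq m v))).
rewrite (big_cat_nat _ KK')//= [X in X - _]addrC addrK big_nat_cond.
apply: filt_sum => m; rewrite andbT => /andP[Km _].
by apply: (filt_le Km); rewrite -[X in I X _]mul1n; exact: filt_mform.
Qed.

Section Iterates.
Variables (K : nat) (B : 'I_n -> 'I_n -> A) (C : 'I_n -> nat -> seq 'I_n -> A).
Hypotheses (HB : forall d e, I 0 (B d e)) (HC : forall e m a, I 0 (C e m a)).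

Lemma filt_step0 x b : (forall j, I 0 (x j)) -> (forall j, I 0 (b j)) ->
  forall d, I 0 (step K B C x b d).
Proof.
move=> Hx Hb d; apply: filt_sum => e _; rewrite -[0%N]addn0; apply: filtM => //.
by apply: filtB => //; exact: filt_pform.
Qed.

Lemma filt_iter0 x b N : (forall j, I 0 (x j)) -> (forall j, I 0 (b j)) ->
  forall d, I 0 (iter N (step K B C x) b d).
Proof. by move=> Hx Hb; elim: N => //= N IH d; exact: filt_step0. Qed.

Hypothesis C01 : forall e m a, (m < 2)%N -> C e m a = 0.

Lemma filt_step x b : (forall j, I 1 (x j)) -> (forall j, I 1 (b j)) ->
  forall d, I 1 (step K B C x b d).
Proof.
move=> Hx Hb d; apply: filt_sum => e _; rewrite -[1%N]add0n; apply: filtM => //.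
by apply: filtB => //; apply: filtS => //; apply: filt_pform_ord => //; exact: C01.
Qed.

Lemma filt_iter x N : (forall j, I 1 (x j)) ->
  forall d, I 1 (iter N (step K B C x) (fun=> 0) d).
Proof. by move=> Hx; elim: N => [d|N IH d] /=; [exact: filt0 | exact: filt_step]. Qed.

(* The terms of degree at least 2 make [step] a contraction of the filtration. *)
Lemma filt_step_sub x x' b b' N : (forall j, I 1 (b j)) -> (forall j, I 1 (b' j)) ->
  (forall j, I N.+1 (x j - x' j)) -> (forall j, I N (b j - b' j)) ->
  forall d, I N.+1 (step K B C x b d - step K B C x' b' d).
Proof.
move=> Hb Hb' Hx Hbb d; rewrite -sumrB; apply: filt_sum => e _.
rewrite -mulrBr -[N.+1]add0n; apply: filtM => //.
have -> : x e - pform K (C e) b - (x' e - pform K (C e) b') =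
  (x e - x' e) - (pform K (C e) b - pform K (C e) b') by ring.
apply: filtB => //; rewrite -addn1 -[X in (_ + X)%N]/(1 * (2.-1))%N.
by apply: filt_pform_sub => //; exact: C01.
Qed.

(** Each iteration gains one order until the accuracy [r.+1] of the data is exhausted, hence
    [minn N r]. The fixed point b and the iteration have separate data x' and x: in the main use b
    is the true displacement with exact adapted coordinates x', and x is their polynomial
    approximation. *)
Lemma filt_iter_fixpoint x x' b r : (forall j, I 1 (x j)) -> (forall j, I 1 (b j)) ->
  (forall j, I r.+1 (b j - step K B C x' b j)) ->
  (forall j, I r.+1 (x' j - x j)) ->
  forall N d, I (minn N r).+1 (b d - iter N (step K B C x) (fun=> 0) d).
Proof.
move=> Hx Hb Hfix Hxx; elim=> [|N IH] d.
  by rewrite min0n subr0.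
rewrite -(subrK (step K B C x' b d) (b d)) -addrA /=; apply: filtD => //.
  by apply: filt_le (Hfix d); rewrite ltnS geq_minr.
apply: filt_step_sub => //.
- exact: filt_iter.
- by move=> j; apply: filt_le (Hxx j); rewrite ltnS geq_minr.
- by move=> j; apply: filt_le (IH j); lia.
Qed.

Lemma filt_iterS x N : (forall j, I 1 (x j)) -> forall d, I N.+1
  (iter N.+1 (step K B C x) (fun=> 0) d - iter N (step K B C x) (fun=> 0) d).
Proof.
move=> Hx; elim: N => [|N IH] d; first by rewrite subr0; exact: (filt_iter 1 Hx).
apply: (@filt_step_sub x x (iter N.+1 (step K B C x) (fun=> 0))
  (iter N (step K B C x) (fun=> 0)) N.+1) => // j.
- exact: (filt_iter N.+1 Hx).
- exact: (filt_iter N Hx).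
- by rewrite subrr; exact: filt0.
Qed.

End Iterates.
End Filtration.

(** * The multinomial formula and multi-indices *)

Section Multinomial.
Variables (F : numFieldType) (n : nat).
Implicit Types (c : seq 'I_n -> {poly F}).

Lemma mform_cat_scale (A : comNzRingType) (k : A) us ws1 ws2 (c : seq 'I_n -> A) :
  (forall c' : seq 'I_n -> A, mform c' ws1 = k * mform c' ws2) ->
  mform c (us ++ ws1) = k * mform c (us ++ ws2).
Proof.
move=> H; elim: us c => [|u us IH] c //=.
by rewrite mulr_sumr; apply: eq_bigr => j _; rewrite IH mulrCA.
Qed.

Section Extend.
Variables (k N : nat).

Definition ffun_extend (al : {ffun 'I_k -> 'I_N}) (t : 'I_N) : {ffun 'I_k.+1 -> 'I_N} :=
  [ffun i => if unlift ord_max i is Some j then al j else t].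

Lemma ffun_extend_widen al t i : ffun_extend al t (widen_ord (leqnSn k) i) = al i.
Proof.
rewrite ffunE (_ : widen_ord _ _ = lift ord_max i) ?liftK//.
by apply: val_inj; rewrite /= /bump leqNgt ltn_ord.
Qed.

Lemma ffun_extend_max al t : ffun_extend al t ord_max = t.
Proof. by rewrite ffunE unlift_none. Qed.

Lemma sum_ffun_extend (V : nmodType) (G : {ffun 'I_k.+1 -> 'I_N} -> V)
    (P : pred {ffun 'I_k.+1 -> 'I_N}) :
  \sum_(al | P al) G al =
  \sum_(al : {ffun 'I_k -> 'I_N}) \sum_(t | P (ffun_extend al t)) G (ffun_extend al t).
Proof.
rewrite pair_big_dep /= (reindex (fun p : {ffun 'I_k -> 'I_N} * 'I_N =>
  ffun_extend p.1 p.2)) //=.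
exists (fun al => ([ffun i => al (widen_ord (leqnSn k) i)], al ord_max)) => [[al t] _|al _] /=.
  congr pair; last exact: ffun_extend_max.
  by apply/ffunP => i; rewrite ffunE ffun_extend_widen.
apply/ffunP => i; rewrite ffunE; case: unliftP => [j ->|->] //.
by rewrite ffunE; congr (al _); apply: val_inj; rewrite /= /bump leqNgt ltn_ord.
Qed.

End Extend.

(** Induction on the number k of vectors, splitting off the last one by the binomial formula. The
    bound N on the exponents does not depend on k or m, so the range of the multi-indices survives
    the induction. *)
Lemma mform_multinomial k m N c (x : 'I_k -> 'I_n -> {poly F}) ws :
  symmetric_coef c -> (m < N)%N ->
  m`!%:R^-1 *: mform c (nseq m (fun j => \sum_(i < k) x i j) ++ ws) =
  \sum_(al : {ffun 'I_k -> 'I_N} | (\sum_i al i)%N == m)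
    (\prod_i (al i)`!)%:R^-1 *:
    mform c (flatten [seq nseq (al i) (x i) | i <- enum 'I_k] ++ ws).
Proof.
move=> sc; elim: k m x ws => [|k IH] m x ws mN.
  case: m mN => [|m] mN.
    under eq_bigl do rewrite big_ord0 eqxx.
    have e0 : enum 'I_0 = [::] by apply: size0nil; rewrite size_enum_ord.
    under eq_bigr do rewrite big_ord0 e0.
    by rewrite /= sumr_const card_ffun !card_ord.
  rewrite [RHS]big_pred0; last by move=> al; rewrite big_ord0.
  by rewrite /= big1 ?scaler0// => j _; rewrite big_ord0 mul0r.
pose S j := \sum_(i < k) x (widen_ord (leqnSn k) i) j.
rewrite (_ : (fun j => _) = fun j => S j + x ord_max j); last first.
  by apply/funext => j; rewrite big_ord_recr.
rewrite mform_binomial// scaler_sumr sum_ffun_extend.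
pose G (al : {ffun 'I_k -> 'I_N}) t := (\prod_i (al i)`!)%:R^-1 *: (t`!%:R^-1 *:
  mform c (flatten [seq nseq (al i) (x (widen_ord (leqnSn k) i)) | i <- enum 'I_k]
    ++ (nseq t (x ord_max) ++ ws))).
(* Both sides are grouped by the multi-index [al] of the first k vectors; the exponent of the last
   one is then m minus the size of [al]. *)
transitivity (\sum_(al : {ffun 'I_k -> 'I_N} | (\sum_i al i <= m)%N)
    G al (m - \sum_i al i)%N).
  transitivity (\sum_(i < m.+1) \sum_(al : {ffun 'I_k -> 'I_N} | (\sum_j al j)%N == i)
      G al (m - i)%N).
    apply: eq_bigr => i _.
    have iN : (i < N)%N by apply: leq_trans mN; exact: ltn_ord.
    rewrite -scalerMnr scalerMnl -mulr_natr.
    have -> : m`!%:R^-1 * 'C(m, i)%:R = (m - i)`!%:R^-1 * i`!%:R^-1 :> F.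
      have fn0 p : p`!%:R != 0 :> F by rewrite pnatr_eq0 -lt0n fact_gt0.
      have <- : ('C(m, i) * (i`! * (m - i)`!))%:R = m`!%:R :> F.
        by rewrite bin_fact// leq_ord.
      rewrite !natrM; field; rewrite !fn0/= pnatr_eq0 -lt0n bin_gt0.
      exact: leq_ord.
    rewrite -scalerA (IH i) // scaler_sumr; apply: eq_bigr => al _.
    by rewrite /G !scalerA mulrC.
  rewrite (exchange_big_dep (fun al : {ffun 'I_k -> 'I_N} => (\sum_j al j <= m)%N)) /=; last first.
    by move=> i al _ /eqP->; rewrite leq_ord.
  apply: eq_bigr => al alm.
  rewrite (big_pred1 (inord (\sum_j al j)%N)); first by rewrite inordK ?ltnS.
  by move=> i /=; rewrite -val_eqE /= inordK ?ltnS// eq_sym.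
rewrite big_mkcond; apply: eq_bigr => al0 _.
suff: forall al : {ffun 'I_k -> 'I_N}, forall s : nat, s = (\sum_i al i)%N ->
    (if (s <= m)%N then G al (m - s)%N else 0) =
    \sum_(t : 'I_N | (s + t)%N == m) (\prod_i (ffun_extend al t i)`!)%:R^-1 *:
      mform c (flatten [seq nseq (ffun_extend al t i) (x i) | i <- enum 'I_k.+1] ++ ws).
  move=> /(_ al0 _ erefl) ->; apply: eq_bigl => t; congr (_ == _).
  rewrite big_ord_recr/= ffun_extend_max; congr (_ + _)%N.
  by apply: eq_bigr => i _; rewrite ffun_extend_widen.
move=> {}al0 s _; case: leqP => alm; last first.
  by rewrite big_pred0// => t; apply/negP => /eqP e; move: alm; rewrite -e; lia.
have tN : (m - s < N)%N by apply: leq_ltn_trans mN; exact: leq_subr.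
rewrite (big_pred1 (Ordinal tN)); last first.
  by move=> t /=; rewrite -val_eqE /=; apply/eqP/eqP => e; lia.
have E1 : (\prod_i (ffun_extend al0 (Ordinal tN) i)`!)%N =
    ((\prod_i (al0 i)`!) * (m - s)`!)%N.
  rewrite big_ord_recr/= ffun_extend_max; congr (_ * _)%N.
  by apply: eq_bigr => i _; rewrite ffun_extend_widen.
have E2 : [seq nseq (ffun_extend al0 (Ordinal tN) i) (x i)
      | i <- [seq widen_ord (leqnSn k) i | i <- enum 'I_k]] =
    [seq nseq (al0 i) (x (widen_ord (leqnSn k) i)) | i <- enum 'I_k].
  by rewrite -map_comp; apply: eq_map => i /=; rewrite ffun_extend_widen.
rewrite /G scalerA -invfM -natrM E1 enum_ordSr map_rcons flatten_rcons E2.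
by rewrite ffun_extend_max -catA.
Qed.

Definition polyc (c : seq 'I_n -> F) : seq 'I_n -> {poly F} := fun a => (c a)%:P.

Lemma mform_polyc (c : seq 'I_n -> F) vs :
  mform (polyc c) [seq (fun j => (v j)%:P) | v <- vs] = (mform c vs)%:P.
Proof.
rewrite (mform_morph (f := polyC)) ?rmorph0//; first exact: rmorphD.
exact: rmorphM.
Qed.

Lemma mform_flatten_scale (A : comNzRingType) (I : Type) (s : seq I) (al : I -> nat)
    (k : I -> A) (v : I -> 'I_n -> A) (c : seq 'I_n -> A) :
  mform c (flatten [seq nseq (al i) (fun j => k i * v i j) | i <- s]) =
  (\prod_(i <- s) k i ^+ al i) * mform c (flatten [seq nseq (al i) (v i) | i <- s]).
Proof.
elim: s c => [|i s IH] c; first by rewrite big_nil mul1r.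
by rewrite /= (@mform_cat_scale _ _ _ _ _ c IH) mform_scale_nseq big_cons mulrCA mulrA.
Qed.

Lemma weight_ge k (al : {ffun 'I_k -> 'I_k.+1}) : (\sum_i al i <= weight al)%N.
Proof. by apply: leq_sum => i _; rewrite mulSn leq_addr. Qed.

Lemma weight_eq0 k (al : {ffun 'I_k -> 'I_k.+1}) :
  (\sum_i al i == 0)%N -> weight al = 0%N.
Proof.
rewrite sum_nat_eq0 => /forallP H; rewrite /weight big1// => i _.
by have /eqP -> := implyP (H i) isT; rewrite muln0.
Qed.

Definition taylor_coef (c : seq 'I_n -> F) : nat -> seq 'I_n -> F :=
  fun m a => m`!%:R^-1 * c a.

(** There is no Phi^(0): the passage to adapted coordinates has no constant term. *)
Definition pos_part (C : nat -> seq 'I_n -> F) : nat -> seq 'I_n -> F :=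
  fun m a => if m is 0 then 0 else C m a.

(** On the curve with coefficients b_i, the multi-index [al] produces the power X^(weight al). The
    formula of [Psi] is therefore a coefficient of a polynomial map composed with the jet, which
    turns the combinatorics of weights into arithmetic of polynomials. *)
Lemma pform_multinomial k (c : seq 'I_n -> F) (b : 'I_k -> 'I_n -> F) (w : 'I_k) :
  symmetric_coef c ->
  (pform k.+1 (fun m => polyc (pos_part (taylor_coef c) m))
    (fun j => \sum_(i < k) 'X^(i.+1) * (b i j)%:P))`_w.+1 =
  \sum_(al : {ffun 'I_k -> 'I_k.+1} | weight al == w.+1)
    (\prod_i (al i)`!)%:R^-1 *
    mform c (flatten [seq nseq (al i) (b i) | i <- enum 'I_k]).
Proof.
move=> sc; pose T (al : {ffun 'I_k -> 'I_k.+1}) := (\prod_i (al i)`!)%:R^-1 *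
    mform c (flatten [seq nseq (al i) (b i) | i <- enum 'I_k]).
have E (m : 'I_k.+1) : (mform (polyc (pos_part (taylor_coef c) m))
    (nseq m (fun j => \sum_(i < k) 'X^(i.+1) * (b i j)%:P)))`_w.+1 =
    \sum_(al : {ffun 'I_k -> 'I_k.+1} | ((\sum_i al i)%N == m) && (weight al == w.+1)) T al.
  have [m0|m0] := eqVneq (m : nat) 0%N.
    rewrite m0 /= coefC /= big_pred0// => al; apply/negP => /andP[/weight_eq0->].
    by [].
  rewrite (eq_mform (c' := fun a => m`!%:R^-1%:P * polyc c a)); last first.
    by move=> a _; case: (m : nat) m0 => // m' _; rewrite /polyc /= polyCM.
  rewrite mformZ mul_polyC -[nseq _ _]cats0 (@mform_multinomial k m k.+1)//; last first.
    by move=> a a' aa'; rewrite /polyc (sc _ _ aa').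
  rewrite coef_sum big_mkcondr; apply: eq_bigr => al _.
  rewrite cats0 coefZ.
  rewrite (mform_flatten_scale _ (fun i => (al : {ffun 'I_k -> 'I_k.+1}) i)
    (fun i : 'I_k => 'X^(i.+1))).
  have -> : \prod_(i <- enum 'I_k) ('X^(i.+1) : {poly F}) ^+ al i = 'X^(weight al).
    by rewrite big_enum /= -prodrXr; apply: eq_bigr => i _; rewrite exprM.
  have -> : flatten [seq nseq (al i) (fun j => (b i j)%:P) | i <- enum 'I_k] =
      [seq (fun j => (v j)%:P) | v <- flatten [seq nseq (al i) (b i) | i <- enum 'I_k]].
    rewrite map_flatten; congr flatten; rewrite -[RHS]map_comp; apply: eq_map => i /=.
    by rewrite map_nseq.
  rewrite mform_polyc coefMC coefXn eq_sym; case: eqP => _; first by rewrite mul1r.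
  by rewrite mul0r mulr0.
rewrite coef_sum; under eq_bigr do rewrite E.
rewrite (exchange_big_dep (fun al : {ffun 'I_k -> 'I_k.+1} => weight al == w.+1)) /=; last first.
  by move=> m al _ /andP[].
apply: eq_bigr => al /eqP wal.
(* The size of a multi-index is at most its weight, here at most k, so cutting at degree k loses no
   term. *)
have lt : (\sum_i al i < k.+1)%N.
  by rewrite ltnS; apply: leq_trans (weight_ge al) _; rewrite wal ltn_ord.
rewrite (big_pred1 (Ordinal lt)); first by [].
by move=> m /=; rewrite wal eqxx andbT -val_eqE /= eq_sym.
Qed.

End Multinomial.

Section StepMorphism.
Variables (A B : comNzRingType) (n K : nat) (f : A -> B).
Hypotheses (f0 : f 0 = 0) (fD : {morph f : x y / x + y}).
Hypotheses (fN : {morph f : x / - x}) (fM : {morph f : x y / x * y}).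

Lemma step_morph (M : 'I_n -> 'I_n -> A) C x b d :
  f (step K M C x b d) =
  step K (fun d e => f (M d e)) (fun e m => f \o C e m) (f \o x) (f \o b) d.
Proof.
rewrite (big_morph f fD f0); apply: eq_bigr => e _.
by rewrite fM fD fN (pform_morph f0 fD fM).
Qed.

Lemma iter_step_morph (M : 'I_n -> 'I_n -> A) C x N d :
  f (iter N (step K M C x) (fun=> 0) d) =
  iter N (step K (fun d e => f (M d e)) (fun e m => f \o C e m) (f \o x)) (fun=> 0) d.
Proof.
elim: N d => [//|N IH] d; rewrite !iterS step_morph; congr step.
by apply/funext => j; exact: IH.
Qed.

End StepMorphism.

Section PolyFiltration.
Variable F : fieldType.

Definition poly_ord (N : nat) (p : {poly F}) : Prop := forall m, (m < N)%N -> p`_m = 0.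

Lemma poly_filtration : filtration poly_ord.
Proof.
split=> [N m _|N p q Hp Hq m mN|N p Hp m mN|N M p q Hp Hq m mNM|N p Hp m mN].
- exact: coef0.
- by rewrite coefD Hp// Hq// addr0.
- by rewrite coefN Hp// oppr0.
- rewrite coefM big1// => i _; have [iN|Ni] := ltnP i N; first by rewrite Hp// mul0r.
  by rewrite Hq ?mulr0//; have := ltn_ord i; lia.
- by apply: Hp; exact: leq_trans mN _.
Qed.

Lemma poly_ord_sub N p q : poly_ord N (p - q) -> forall m, (m < N)%N -> p`_m = q`_m.
Proof. by move=> H m mN; apply/eqP; rewrite -subr_eq0 -coefB H. Qed.

Lemma poly_ordXn N M p : (N <= M)%N -> poly_ord N ('X^M * p).
Proof. by move=> NM m mN; rewrite coefXnM (leq_trans mN NM). Qed.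

End PolyFiltration.

(** * The fields in adapted coordinates *)

Section AdaptedFields.
Variables (R : realType) (n l : nat).

(* phi e a are the components of the forms Phi^(m), xi i e a those of the
   iterated derivatives of X_i, and M is the inverse matrix of Phi^(1). *)
Variables (phi : 'I_n -> seq 'I_n -> R) (M : 'I_n -> 'I_n -> R).
Variables (xi : 'I_l -> 'I_n -> seq 'I_n -> R).

Definition high_part (c : seq 'I_n -> R) (m : nat) : seq 'I_n -> R :=
  fun a => if (m < 2)%N then 0 else taylor_coef c m a.

Definition jet_poly k (x : 'M[R]_(k, n)) : 'I_n -> {poly R} :=
  fun e => \sum_(m < k) 'X^(m.+1) * (x m e)%:P.

Definition unadapt_step k (x : 'M[R]_(k, n)) :=
  step k.+1 (fun d e => (M d e)%:P) (fun e m => polyc (high_part (phi e) m)) (jet_poly x).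

(* The jet b with Psi b = x, obtained by iterating b := M (x - Q b), where Q
   collects the terms of degree at least 2. *)
Definition unadapt k (x : 'M[R]_(k, n)) : 'I_n -> {poly R} :=
  iter k (unadapt_step x) (fun=> 0).

(** The polynomial DF_t(b)[X_i(q(t) + b)] of the overview. The j-th partial derivative of component
    e of F_t has Taylor coefficients [phi e (j :: a)], by symmetry of the forms, and [xi i j] holds
    those of component j of X_i. *)
Definition field_poly k (b : 'I_n -> {poly R}) (i : 'I_l) (e : 'I_n) : {poly R} :=
  \sum_j pform k (fun m => polyc (taylor_coef (fun a => phi e (j :: a)) m)) b *
         pform k (fun m => polyc (taylor_coef (xi i j) m)) b.

(** Row m is the velocity of q^(m+1) but the coefficient of s^m: the missing power of s is the
    factor in s du_i. *)
Definition adapted_field k (i : 'I_l) (x : 'M[R]_(k, n)) : 'M[R]_(k, n) :=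
  \matrix_(m < k, e < n) (field_poly k (unadapt x) i e)`_m.

Let FX := poly_filtration R.

Lemma poly_ord0 (p : {poly R}) : poly_ord 0 p. Proof. by []. Qed.

Lemma jet_poly_ord k (x : 'M[R]_(k, n)) e : poly_ord 1 (jet_poly x e).
Proof. by apply: filt_sum FX _ _ _ _ _ _ => m _; exact: poly_ordXn. Qed.

Lemma coef_jet_poly k (x : 'M[R]_(k, n)) e (m : 'I_k) : (jet_poly x e)`_m.+1 = x m e.
Proof.
rewrite coef_sum (bigD1 m)//= big1 ?addr0.
  by rewrite coefXnM ltnn subnn coefC.
move=> i im; rewrite coefXnM coefC ltnS; case: ltnP => // h.
rewrite subn_eq0 ltnS; case: leqP => // h'.
by case/eqP: im; apply: val_inj; apply/eqP; rewrite eqn_leq h h'.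
Qed.

Lemma high_part0 e m a : (m < 2)%N -> polyc (high_part (phi e) m) a = 0 :> {poly R}.
Proof. by move=> m2; rewrite /polyc /high_part m2. Qed.

Lemma unadapt_ord k (x : 'M[R]_(k, n)) d : poly_ord 1 (unadapt x d).
Proof.
by apply: (filt_iter FX) => // [e m a|]; [exact: high_part0|exact: jet_poly_ord].
Qed.

Lemma unadapt_fixpoint k (x : 'M[R]_(k, n)) d :
  poly_ord k.+1 (unadapt x d - unadapt_step x (unadapt x) d).
Proof.
rewrite -opprB; apply: (filtN FX).
apply: (filt_iterS FX) => //; last exact: jet_poly_ord.
by move=> f m a; exact: high_part0.
Qed.

Lemma pform_pos_part (A : comNzRingType) (f : R -> A) k (c : seq 'I_n -> R) v :
  f 0 = 0 ->
  pform k.+2 (fun m => f \o pos_part (taylor_coef c) m) v =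
  \sum_j v j * f (c [:: j]) + pform k.+2 (fun m => f \o high_part c m) v.
Proof.
move=> f0; rewrite /pform 2!big_ord_recl [in RHS]big_ord_recl [in RHS]big_ord_recl.
rewrite /= f0 !add0r; congr (_ + _).
  by apply: eq_bigr => j _; rewrite /taylor_coef /= invr1 mul1r.
by rewrite [X in _ = X + _]big1 ?add0r// => j _; rewrite mulr0.
Qed.

Hypothesis HM : forall j d, \sum_e phi j [:: e] * M e d = (j == d)%:R.

(** In the linear part, b is replaced by its next iterate M (x - Q b), which [HM] turns into x - Q
    b; the nonlinear part then cancels Q b. The error is the linear image of b minus its iterate, of
    order k + 2. *)
Lemma adapt_unadapt k (x : 'M[R]_(k.+1, n)) e : poly_ord k.+2
  (pform k.+2 (fun m => polyc (pos_part (taylor_coef (phi e)) m)) (unadapt x)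
   - jet_poly x e).
Proof.
set b := unadapt x; set S := unadapt_step x.
have Hb d : poly_ord k.+2 (b d - S b d) by exact: unadapt_fixpoint.
rewrite (@pform_pos_part _ polyC)//.
have -> : \sum_j b j * (phi e [:: j])%:P =
    \sum_j (b j - S b j) * (phi e [:: j])%:P + \sum_j S b j * (phi e [:: j])%:P.
  by rewrite -big_split/=; apply: eq_bigr => j _; rewrite -mulrDl subrK.
have -> : \sum_j S b j * (phi e [:: j])%:P =
    jet_poly x e - pform k.+2 (fun m => polyc (high_part (phi e) m)) b.
  under eq_bigr => j _ do rewrite /S /step mulr_suml.
  rewrite exchange_big /=.
  under eq_bigr => d _.
    under eq_bigr => j _ do rewrite mulrAC -polyCM [M j d * _]mulrC.
    rewrite -mulr_suml -rmorph_sum HM.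
    over.
  rewrite (bigD1 e)//= eqxx mul1r big1 ?addr0// => d de.
  by rewrite eq_sym (negbTE de) mul0r.
rewrite (_ : _ + _ + _ - _ = \sum_j (b j - S b j) * (phi e [:: j])%:P); last first.
  by rewrite /polyc; ring.
by apply: (filt_sum FX) => j _; rewrite -[k.+2]addn0; exact: (filtM FX).
Qed.

Lemma field_poly_sub k N b b' i e :
  (forall d, poly_ord N (b d - b' d)) ->
  poly_ord N (field_poly k b i e - field_poly k b' i e).
Proof.
move=> H; rewrite -sumrB; apply: (filt_sum FX) => j _.
set p := pform _ _ _; set q := pform _ _ _; set p' := pform _ _ _; set q' := pform _ _ _.
have -> : p * q - p' * q' = (p - p') * q + p' * (q - q') by ring.
have E C : poly_ord N (pform k C b - pform k C b').
  rewrite -[N]addn0 -[X in (_ + X)%N](mul0n (0.-1)).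
  by apply: (filt_pform_sub FX).
by apply: (filtD FX); [rewrite -[N]addn0|rewrite -[N]add0n]; apply: (filtM FX) => //; exact: E.
Qed.

(** For the truncated point y, [unadapt x] is still a fixed point modulo X^(k+1): the jet
    polynomials of x and y differ by the top power, and the additional degree in the forms has order
    k + 1. By contraction it agrees with [unadapt y], and the coefficients below X^k of the fields
    agree. *)
Lemma adapted_field_proj k i (x : 'M[R]_(k.+1, n)) :
  row' ord_max (adapted_field i x) = adapted_field i (row' ord_max x).
Proof.
set y := row' ord_max x.
have Hxy d : poly_ord k.+1 (jet_poly x d - jet_poly y d).
  rewrite /jet_poly big_ord_recr/= (_ : \sum_(i0 < k) _ = \sum_(m < k) 'X^(m.+1) * (y m d)%:P).
    by rewrite addrAC subrr add0r; exact: poly_ordXn.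
  apply: eq_bigr => m _; rewrite /y mxE; congr (_ * (x _ d)%:P); apply: val_inj.
  by rewrite /= /bump leqNgt ltn_ord.
have Hb d : poly_ord k.+1 (unadapt x d - unadapt y d).
  rewrite -[X in poly_ord X.+1](minnn k).
  apply: (@filt_iter_fixpoint _ _ _ FX _ _ _ _ _ _ _ (jet_poly x)) => //.
  - by move=> e m a; exact: high_part0.
  - by move=> j; exact: jet_poly_ord.
  - by move=> j; exact: unadapt_ord.
  move=> j; set b := unadapt x.
  rewrite -(subrK (unadapt_step x b j) (b j)) -addrA.
  apply: (filtD FX).
    by apply: (filt_le FX (leqnSn k.+1)); exact: unadapt_fixpoint.
  rewrite /unadapt_step /step -sumrB; apply: (filt_sum FX) => e _.
  rewrite -mulrBr opprB addrC addrA subrK -opprB mulrN.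
  apply: (filtN FX); rewrite -[k.+1]add0n; apply: (filtM FX) => //.
  by apply: (filt_pform_widen FX) => // d'; exact: unadapt_ord.
apply/matrixP => m e; rewrite !mxE.
have -> : lift ord_max m = m :> nat by rewrite /= /bump leqNgt ltn_ord.
apply: (poly_ord_sub (N := k)); last exact: ltn_ord.
rewrite -(subrK (field_poly k (unadapt x) i e) (field_poly k.+1 _ _ _)) -addrA.
apply: (filtD FX); last first.
  by apply: field_poly_sub => d; exact: (filt_le FX (leqnSn k)).
rewrite -sumrB; apply: (filt_sum FX) => j _.
set p := pform _ _ _; set q := pform _ _ _; set p' := pform _ _ _; set q' := pform _ _ _.
have -> : p * q - p' * q' = (p - p') * q + p' * (q - q') by ring.
have E C : poly_ord k (pform k.+1 C (unadapt x) - pform k C (unadapt x)).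
  by apply: (filt_pform_widen FX) => // d'; exact: unadapt_ord.
by apply: (filtD FX); [rewrite -[k]addn0|rewrite -[k]add0n]; apply: (filtM FX) => //; exact: E.
Qed.

(** Triangularity: the velocity of q^(m+1) involves only q^(1), ..., q^(m). This is what allows the
    system to be solved by successive quadratures. *)
Lemma adapted_field_rows k i (x y : 'M[R]_(k, n)) (r : nat) :
  (forall (m : 'I_k) e, (m < r)%N -> x m e = y m e) ->
  forall (m : 'I_k) e, (m <= r)%N -> adapted_field i x m e = adapted_field i y m e.
Proof.
move=> xy m e mr; rewrite !mxE; apply: (poly_ord_sub (N := r.+1)) => //.
apply: field_poly_sub => d {m mr e}.
have Hx e : poly_ord r.+1 (jet_poly x e - jet_poly y e).
  rewrite -sumrB; apply: (filt_sum FX) => m _; rewrite -mulrBr -polyCB.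
  have [mr|rm] := ltnP m r; first by rewrite xy// subrr mulr0; exact: (filt0 FX).
  exact: poly_ordXn.
suff H N e : poly_ord r.+1
    (iter N (unadapt_step x) (fun=> 0) e - iter N (unadapt_step y) (fun=> 0) e) by exact: H.
elim: N e => [|N IH] e; first by rewrite subrr; exact: (filt0 FX).
apply: (filt_step_sub FX) => //.
- by move=> f m a; exact: high_part0.
- by move=> j; apply: (filt_iter FX) => // [f m a|]; [exact: high_part0|exact: jet_poly_ord].
- by move=> j; apply: (filt_iter FX) => // [f m a|]; [exact: high_part0|exact: jet_poly_ord].
- by move=> j; apply: (filt_le FX (leqnSn r)); exact: IH.
Qed.

End AdaptedFields.

(** * Weighted polynomials: smoothness and homogeneity *)

Section WeightedPolynomials.
Variables (R : realType) (k n : nat).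
Local Notation V := 'M[R]_(k, n).

(** Weighted-homogeneous polynomial functions, generated by operations instead of monomials, so that
    facts about them go by induction on the construction. Zero has every weight. *)
Inductive wpoly : nat -> (V -> R) -> Prop :=
| wpoly0 w : wpoly w (fun=> 0)
| wpoly_cst c : wpoly 0 (fun=> c)
| wpoly_coord (m : 'I_k) (e : 'I_n) : wpoly m.+1 (fun x => x m e)
| wpolyD w f g : wpoly w f -> wpoly w g -> wpoly w (fun x => f x + g x)
| wpolyM w v f g : wpoly w f -> wpoly v g -> wpoly (w + v) (fun x => f x * g x).

(** Derivatives along a fixed direction do not respect the weight, since they send a coordinate to a
    constant; smoothness is therefore proved in this ungraded class. *)
Inductive polyfun : (V -> R) -> Prop :=
| polyfun_cst c : polyfun (fun=> c)
| polyfun_coord (m : 'I_k) (e : 'I_n) : polyfun (fun x => x m e)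
| polyfunD f g : polyfun f -> polyfun g -> polyfun (fun x => f x + g x)
| polyfunM f g : polyfun f -> polyfun g -> polyfun (fun x => f x * g x).

Lemma wpoly_polyfun w f : wpoly w f -> polyfun f.
Proof.
elim=> *; [exact: polyfun_cst|exact: polyfun_cst|exact: polyfun_coord|
  exact: polyfunD|exact: polyfunM].
Qed.

Lemma wpoly_sum w (I : Type) (r : seq I) (P : pred I) (f : I -> V -> R) :
  (forall i, P i -> wpoly w (f i)) -> wpoly w (fun x => \sum_(i <- r | P i) f i x).
Proof.
move=> H; elim: r => [|i r IH].
  by under eq_fun do rewrite big_nil; exact: wpoly0.
under eq_fun do rewrite big_cons.
have [Pi|nPi] := boolP (P i); last exact: IH.
exact: wpolyD (H _ Pi) IH.
Qed.

Lemma is_derive_coord (m : 'I_k) (e : 'I_n) (x v : V) :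
  is_derive x v (fun y : V => y m e) (v m e).
Proof.
have := (@derivable_mxP R V k n id x v).1 (@derivable_id R V x v) m e => d.
split=> //; have := @derive_mx R V k n id x v (@derivable_id R V x v).
by rewrite derive_id => /matrixP/(_ m e); rewrite mxE.
Qed.

Lemma polyfun_differentiable f x : polyfun f -> differentiable f x.
Proof.
move=> pf; elim: pf x => [c|m e|{}f g _ Hf _ Hg|{}f g _ Hf _ Hg] x.
- exact: differentiable_cst.
- exact: differentiable_coord.
- exact: differentiableD.
- exact: differentiableM.
Qed.

Lemma polyfun_derive f v : polyfun f ->
  exists2 g, polyfun g & forall x, is_derive x v f (g x).
Proof.
elim=> [c|m e|{}f g pf [f' pf' Hf] pg [g' pg' Hg]|{}f g pf [f' pf' Hf] pg [g' pg' Hg]].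
- by exists (fun=> 0); [exact: polyfun_cst|move=> x; exact: is_derive_cst].
- exists (fun=> v m e); [exact: polyfun_cst|move=> x; exact: is_derive_coord].
- by exists (fun x => f' x + g' x); [exact: polyfunD|move=> x; exact: is_deriveD].
- exists (fun x => f x * g' x + g x * f' x); last by move=> x; exact: is_deriveM.
  by apply: polyfunD; exact: polyfunM.
Qed.

(** Euler's identity for the weighted dilation field, by the product rule. *)
Lemma wpoly_euler w f (x : V) : wpoly w f ->
  is_derive x (\matrix_(m, e) (m.+1%:R * x m e)) f (w%:R * f x).
Proof.
elim=> {w f} [w|c|m e|w f g _ Hf _ Hg|w v f g _ Hf _ Hg].
- by rewrite mulr0; exact: is_derive_cst.
- by rewrite mul0r; exact: is_derive_cst.
- have := is_derive_coord m e x (\matrix_(m, e) (m.+1%:R * x m e)).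
  by rewrite mxE.
- by rewrite mulrDr; exact: is_deriveD.
- have := is_deriveM Hf Hg; congr is_derive.
  by rewrite natrD /GRing.scale/=; ring.
Qed.

End WeightedPolynomials.

Section PolynomialFields.
Variables (R : realType) (k n : nat).
Local Notation V := 'M[R]_(k, n).

Lemma is_derive_scalel (U W : normedModType R) (f : U -> R) (df : R) (w : W) x v :
  is_derive x v f df -> is_derive x v (fun y => f y *: w) (df *: w).
Proof.
move=> [fd fv].
have : (fun h : R => h^-1 *: ((f \o shift x) (h *: v) - f x)) @ 0^' --> df.
  by rewrite -fv; exact: fd.
move=> Hf.
have L : (fun h : R => h^-1 *: (((fun y => f y *: w) \o shift x) (h *: v) - f x *: w)) @ 0^'
    --> df *: w.
  under eq_fun do rewrite /= -scalerBl scalerA.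
  by apply: cvgZ; [exact: Hf|exact: cvg_cst].
by split; [apply/cvg_ex; exists (df *: w)|apply: cvg_lim L].
Qed.

Lemma is_derive_comb (U W : normedModType R) (I : Type) (r : seq I) (f : I -> U -> R)
    (df : I -> R) (w : I -> W) x v : (forall i, is_derive x v (f i) (df i)) ->
  is_derive x v (fun y => \sum_(i <- r) f i y *: w i) (\sum_(i <- r) df i *: w i).
Proof.
move=> H; elim: r => [|i r IH].
  rewrite big_nil; under [X in is_derive _ _ X]eq_fun do rewrite big_nil.
  exact: is_derive_cst.
rewrite big_cons; under [X in is_derive _ _ X]eq_fun do rewrite big_cons.
by apply: is_deriveD; exact: is_derive_scalel.
Qed.

Lemma smooth_comb (W : normedModType R) (I : choiceType) (r : seq I) (f : I -> V -> R)
    (w : I -> W) : (forall i, polyfun (f i)) ->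
  smooth_on setT (fun y => \sum_(i <- r) f i y *: w i).
Proof.
move=> pf vs x _.
suff [g pg ->] : exists2 g : I -> V -> R, forall i, polyfun (g i) &
    Defs.iterD (fun y => \sum_(i <- r) f i y *: w i) vs = fun y => \sum_(i <- r) g i y *: w i.
  elim: r => [|i r IH].
    by under eq_fun do rewrite big_nil; exact: differentiable_cst.
  under eq_fun do rewrite big_cons; apply: differentiableD => //.
  exact: differentiableZl (polyfun_differentiable _ (pg i)).
elim: vs => [|v vs [g pg /= ->]]; first by exists f.
have H i : exists h, polyfun h /\ forall x, is_derive x v (g i) (h x).
  by have [h] := polyfun_derive v (pg i); exists h.
have [h Hh] := choice H.
exists (fun i => h i); first by move=> i; case: (Hh i).
apply/funext => y; have D i : is_derive y v (g i) (h i y) by case: (Hh i).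
exact: (@derive_val _ _ _ _ _ _ _ (is_derive_comb r w D)).
Qed.

(** The direction (0, v) keeps t fixed, so the derivative makes sense although Y has no regularity
    in t. *)
Lemma derive_pair_slice (W : normedModType R) (Y : gspace R n k -> W) (t : R) (q v : V) :
  'D_((0, v) : gspace R n k) Y (t, q) = 'D_v (fun q => Y (t, q)) q.
Proof.
rewrite /derive.
suff -> : (fun h : R => h^-1 *: ((Y \o shift (t, q)) (h *: ((0, v) : gspace R n k)) - Y (t, q)))
  = (fun h => h^-1 *: (((fun q => Y (t, q)) \o shift q) (h *: v) - Y (t, q))) by [].
apply/funext => h /=; congr (_ *: (Y _ - _)).
by congr pair; rewrite /= scaler0 add0r.
Qed.

Definition mx_field (G : R -> V -> V) (p : gspace R n k) : gspace R n k := (0, G p.1 p.2).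

Lemma mx_field_comb (G : R -> V -> V) t : (fun q => mx_field G (t, q)) =
  fun q => \sum_(ij : 'I_k * 'I_n) (G t q ij.1 ij.2) *: ((0, delta_mx ij.1 ij.2) : gspace R n k).
Proof.
apply/funext => q; apply/esym; rewrite -(pair_bigA _ (fun i j =>
  G t q i j *: ((0, delta_mx i j) : gspace R n k))) /=.
rewrite /mx_field /= [X in _ = (_, X)]matrix_sum_delta.
have E1 (I : finType) (F : I -> V) :
    \sum_i ((0, F i) : gspace R n k) = (0, \sum_i F i).
  by elim/big_rec2: _ => // i a b _ ->; congr pair; rewrite addr0.
rewrite -E1; apply: eq_bigr => i _; rewrite -E1; apply: eq_bigr => j _.
by congr pair; rewrite scaler0.
Qed.

(* Row m is the component along q^(m+1), a coordinate of weight m + 1: it has weight m,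
   hence the degree -1. *)
Lemma homogeneous_mx_field (G : R -> V -> V) :
  (forall t (m : 'I_k) e, wpoly m (fun q => G t q m e)) -> homogeneous (-1) (mx_field G).
Proof.
move=> HG; split=> [t|[t q]].
  by rewrite mx_field_comb; apply: smooth_comb => -[i j]; exact: wpoly_polyfun (HG t i j).
rewrite /lie_bracket /euler /mx_field /= !derive_pair_slice.
have -> : (fun q0 : V => ((0, \matrix_(m, a) (m.+1%:R * (t, q0).2 m a)) : gspace R n k)) =
    (fun q0 => mx_field (fun _ q1 => \matrix_(m, a) (m.+1%:R * q1 m a)) (t, q0)) by [].
rewrite -/(mx_field G) !mx_field_comb.
set E : V := \matrix_(m, a) _.
have D1 (ij : 'I_k * 'I_n) : is_derive q E (fun q => G t q ij.1 ij.2)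
    ((ij.1 : nat)%:R * G t q ij.1 ij.2) by exact: wpoly_euler (HG t ij.1 ij.2).
have D2 (ij : 'I_k * 'I_n) : is_derive q (G t q)
    (fun q => (\matrix_(m, a) (m.+1%:R * q m a) : V) ij.1 ij.2)
    (ij.1.+1%:R * G t q ij.1 ij.2).
  under eq_fun do rewrite mxE.
  exact: (@is_deriveZ _ _ _ _ ij.1.+1%:R _ _ _ (is_derive_coord ij.1 ij.2 q (G t q))).
rewrite (@derive_val _ _ _ _ _ _ _ (is_derive_comb (index_enum _)
  (fun ij : 'I_k * 'I_n => ((0, delta_mx ij.1 ij.2) : gspace R n k)) D1)).
rewrite (@derive_val _ _ _ _ _ _ _ (is_derive_comb (index_enum _)
  (fun ij : 'I_k * 'I_n => ((0, delta_mx ij.1 ij.2) : gspace R n k)) D2)).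
rewrite -sumrB [RHS](_ : _ = (-1) *: mx_field G (t, q)); last first.
  by rewrite mulrN1z.
rewrite (congr1 (fun f => f q) (mx_field_comb G t)) scaler_sumr.
apply: eq_bigr => ij _; rewrite -scalerBl scalerA; congr (_ *: _).
by rewrite -natr1; ring.
Qed.

Lemma gproj_is_linear : linear (@gproj R n k).
Proof.
move=> a p q; rewrite /gproj; congr pair => /=.
by apply/matrixP => i j; rewrite !mxE.
Qed.

End PolynomialFields.

HB.instance Definition _ (R : realType) (k n : nat) :=
  GRing.isLinear.Build R (gspace R n k.+1) (gspace R n k) _ (@gproj R n k)
    (@gproj_is_linear R k n).

Lemma diff_gproj (R : realType) (k n : nat) (p : gspace R n k.+1) :
  'd (@gproj R n k) p = @gproj R n k :> (_ -> _).
Proof.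
apply: diff_lin; apply/linear_bounded_continuous/linear_boundedP.
near=> r => q.
have r1 : 1 <= r by near: r; exact: nbhs_pinfty_ge.
apply: (@le_trans _ _ `|q|); last by rewrite ler_peMl.
rewrite /gproj prod_normE/= ge_max; case: q => t x /=.
rewrite prod_normE/= le_max lexx /= le_max; apply/orP; right.
by apply: mx_norm_le => // i j; rewrite mxE mx_norm_coord.
Unshelve. all: by end_near. Qed.

Lemma projects_mx_field (R : realType) (k n : nat)
    (G : R -> 'M[R]_(k.+1, n) -> 'M[R]_(k.+1, n)) (H : R -> 'M[R]_(k, n) -> 'M[R]_(k, n)) :
  (forall t q, row' ord_max (G t q) = H t (row' ord_max q)) ->
  projects_to (@gproj R n k) (mx_field G) (mx_field H).
Proof. by move=> GH [t q]; rewrite diff_gproj /gproj /mx_field /= GH. Qed.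

Section ClosedClass.
Variables (R : realType) (n l k : nat) (T : pointedType).
Variables (phi : T -> 'I_n -> seq 'I_n -> R) (M : T -> 'I_n -> 'I_n -> R).
Variables (xi : T -> 'I_l -> 'I_n -> seq 'I_n -> R) (x : T -> 'M[R]_(k, n)).
Variable S : (T -> {poly R}) -> Prop.
Hypothesis FS : filtration (fun _ => S).
Hypothesis Sphi : forall e (s : seq 'I_n) c, S (fun t => (c * phi t e s)%:P).
Hypothesis SM : forall d e, S (fun t => (M t d e)%:P).
Hypothesis Sxi : forall i e (s : seq 'I_n) c, S (fun t => (c * xi t i e s)%:P).
Hypothesis Sx : forall e, S (fun t => jet_poly (x t) e).

Let evalt (A : comNzRingType) (t : T) (p : T -> A) := p t.

(** The iteration uses ring operations only. It is carried out in the ring of functions from T to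
    polynomials, where membership in S is preserved, and then evaluated at t. S will be the
    condition that the coefficient of X^m has weight m, and later that coefficients are continuous
    in time. *)
Lemma unadapt_closed e : S (fun t => unadapt (phi t) (M t) (x t) e).
Proof.
have SH e' m a : S (fun t => polyc (high_part (phi t e') m) a).
  rewrite /polyc /high_part; case: (m < 2)%N; last exact: Sphi.
  exact: (filt0 FS 0).
have := @filt_iter0 _ _ _ FS k.+1 (fun d e t => (M t d e)%:P)
  (fun e m a => fun t => polyc (high_part (phi t e) m) a) SM SH
  (fun e t => jet_poly (x t) e) (fun=> 0) k Sx (fun=> filt0 FS 0) e.
congr S; apply/funext => t.
exact: (@iter_step_morph _ _ n k.+1 (@evalt {poly R} t)).
Qed.

Lemma field_poly_closed i e :
  S (fun t => field_poly (phi t) (xi t) k (unadapt (phi t) (M t) (x t)) i e).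
Proof.
have E (c : T -> seq 'I_n -> R) : (forall s r, S (fun t => (r * c t s)%:P)) -> S (fun t =>
    pform k (fun m => polyc (taylor_coef (c t) m)) (unadapt (phi t) (M t) (x t))).
  move=> Sc; have := @filt_pform _ n _ FS k (fun m a => fun t => polyc (taylor_coef (c t) m) a)
    (fun e t => unadapt (phi t) (M t) (x t) e) (fun m a => Sc _ _) unadapt_closed.
  congr S; apply/funext => t.
  exact: (@pform_morph _ _ n (@evalt {poly R} t)).
have := @filt_sum _ _ FS 'I_n (index_enum _) xpredT (fun j t =>
  pform k (fun m => polyc (taylor_coef (fun a => phi t e (j :: a)) m)) (unadapt (phi t) (M t) (x t)) *
  pform k (fun m => polyc (taylor_coef (xi t i j) m)) (unadapt (phi t) (M t) (x t))) 0
  (fun j _ => filtM FS (N := 0) (M := 0) (E _ (fun s r => Sphi _ _ _)) (E _ (fun s r => Sxi _ _ _ _))).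
by congr S; apply/funext => t; rewrite fct_sumE.
Qed.

End ClosedClass.

Section AdaptedFieldWeight.
Variables (R : realType) (n l k : nat).
Variables (phi : 'I_n -> seq 'I_n -> R) (M : 'I_n -> 'I_n -> R).
Variables (xi : 'I_l -> 'I_n -> seq 'I_n -> R).
Local Notation V := 'M[R]_(k, n).

Let graded (p : V -> {poly R}) : Prop := forall m, wpoly m (fun x => (p x)`_m).

Let graded_filtration : filtration (fun _ => graded).
Proof.
split=> [_ m|_ p q Hp Hq m|_ p Hp m|_ _ p q Hp Hq m|//].
- by under eq_fun do rewrite coef0; exact: wpoly0.
- by under eq_fun do rewrite coefD; exact: wpolyD.
- under eq_fun do rewrite coefN -mulN1r; rewrite -[m]add0n.
  by apply: wpolyM => //; exact: wpoly_cst.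
- under eq_fun do rewrite coefM; apply: wpoly_sum => i _.
  by rewrite -[X in wpoly X](subnKC (leq_ord i)); exact: wpolyM.
Qed.

Let graded_cst (c : R) : graded (fun=> c%:P).
Proof.
move=> m; under eq_fun do rewrite coefC; case: m => [|m] /=; first exact: wpoly_cst.
exact: wpoly0.
Qed.

Let graded_jet e : graded (fun x => jet_poly x e).
Proof.
move=> m; rewrite /jet_poly; under eq_fun do rewrite coef_sum.
apply: wpoly_sum => i _; under eq_fun do rewrite coefXnM.
case: ltnP => im; first exact: wpoly0.
under eq_fun do rewrite coefC; case: eqP => [e0|_]; last exact: wpoly0.
have -> : m = i.+1 by apply/eqP; rewrite eqn_leq im -subn_eq0 e0.
exact: wpoly_coord.
Qed.

Lemma adapted_field_wpoly i (m : 'I_k) e :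
  wpoly m (fun x => adapted_field phi M xi i x m e).
Proof.
under eq_fun do rewrite mxE.
exact: (@field_poly_closed R n l k V (fun=> phi) (fun=> M) (fun=> xi) id graded graded_filtration
  (fun _ _ _ => graded_cst _) (fun _ _ => graded_cst _) (fun _ _ _ _ => graded_cst _) graded_jet i e m).
Qed.

End AdaptedFieldWeight.

(** * Taylor expansion along a curve *)

Section IteratedDerivatives.
Variables (R : realType) (n : nat).
Local Notation V := 'rV[R]_n.
Local Notation iterD := Defs.iterD.

Definition basis_seq (a : seq 'I_n) : seq V := [seq delta_mx ord0 j | j <- a].

Definition coords (v : V) : 'I_n -> R := fun j => v ord0 j.

Definition jet_coef (f : V -> V) (y : V) (e : 'I_n) (a : seq 'I_n) : R :=
  iterD f (basis_seq a) y ord0 e.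

Lemma is_derive_mform (U : normedModType R) (c : U -> seq 'I_n -> R) (dc : seq 'I_n -> R)
    vs y v : (forall a, size a = size vs -> is_derive y v (c ^~ a) (dc a)) ->
  is_derive y v (fun z => mform (c z) vs) (mform dc vs).
Proof.
elim: vs c dc => [|w vs IH] c dc H /=; first exact: H.
rewrite (_ : (fun z => _) = fun z => \sum_j mform (fun a => c z (j :: a)) vs *: w j).
  under eq_bigr => j _ do rewrite mulrC.
  apply: (@is_derive_comb R U R^o _ (index_enum _)
    (fun j z => mform (fun a => c z (j :: a)) vs) _ w) => j.
  by apply: IH => a sa; apply: H; rewrite /= sa.
by apply/funext => z; apply: eq_bigr => j _; rewrite mulrC.
Qed.

Lemma derive_coords (W : normedModType R) (f : V -> W) y b : differentiable f y ->
  'D_b f y = \sum_j b ord0 j *: 'D_(delta_mx ord0 j) f y.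
Proof.
move=> df; rewrite deriveE// {1}(row_sum_delta b) linear_sum; apply: eq_bigr => j _.
by rewrite linearZ deriveE.
Qed.

Lemma smooth_differentiable (U : set V) (f : V -> V) vs y : smooth_on U f -> U y ->
  differentiable (iterD f vs) y.
Proof. by move=> sf Uy; exact: sf. Qed.

Lemma is_derive_coord_fun (W : normedModType R) m p (f : W -> 'M[R]_(m, p)) y v i e :
  derivable f y v -> is_derive y v (fun z => f z i e) ('D_v f y i e).
Proof.
move=> df; split; first exact: (derivable_mxP f y v).1 df i e.
by rewrite derive_mx// mxE.
Qed.

(** Induction on r: the inner derivative agrees with the form on a whole neighbourhood of y, since U
    is open, so both have the same derivative along basis vectors; the outermost direction is then
    expanded by linearity. *)
Lemma iterD_nseq (U : set V) (f : V -> V) r b y e : open U -> smooth_on U f -> U y ->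
  iterD f (nseq r b) y ord0 e = mform (jet_coef f y e) (nseq r (coords b)).
Proof.
move=> oU sf; elim: r y => [//|r IH] y Uy.
rewrite -[nseq r.+1 b]/(b :: nseq r b) -[nseq r.+1 _]/(coords b :: nseq r (coords b)).
set vs := nseq r b in IH *; set ws := nseq r _ in IH *.
have dy : differentiable (iterD f vs) y by exact: sf.
rewrite /= derive_coords// summxE; apply: eq_bigr => j _; rewrite mxE; congr (_ * _).
have D1 : is_derive y (delta_mx ord0 j) (fun z => iterD f vs z ord0 e)
    ('D_(delta_mx ord0 j) (iterD f vs) y ord0 e).
  by apply: is_derive_coord_fun; exact: diff_derivable.
have D2 : is_derive y (delta_mx ord0 j) (fun z => mform (jet_coef f z e) ws)
    (mform (fun a => jet_coef f y e (j :: a)) ws).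
  apply: is_derive_mform => a _; rewrite /jet_coef /=.
  by apply: is_derive_coord_fun; apply: diff_derivable; exact: sf.
have N : {near y, (fun z => iterD f vs z ord0 e) =1 (fun z => mform (jet_coef f z e) ws)}.
  by near=> z; apply: IH; near: z; exact: open_nbhs_nbhs.
rewrite -(@derive_val _ _ _ _ _ _ _ D1) -(@derive_val _ _ _ _ _ _ _ D2).
exact: (near_eq_derive _ N).
Unshelve. all: by end_near. Qed.

Lemma mform_le (c : seq 'I_n -> R) C (v : V) r : 0 <= C ->
  (forall a, size a = r -> `|c a| <= C) ->
  `|mform c (nseq r (coords v))| <= C * (n%:R * `|v|) ^+ r.
Proof.
move=> C0; elim: r c => [|r IH] c Hc /=; first by rewrite mulr1; exact: Hc.
apply: (le_trans (ler_norm_sum _ _ _)).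
apply: (@le_trans _ _ (\sum_(j < n) `|v| * (C * (n%:R * `|v|) ^+ r))).
  apply: ler_sum => j _; rewrite normrM ler_pM// ?mx_norm_coord//.
  by apply: IH => a sa; apply: Hc; rewrite /= sa.
by rewrite sumr_const card_ord -mulr_natl exprS le_eqVlt; apply/orP; left; apply/eqP; ring.
Qed.

End IteratedDerivatives.

Section TaylorOneVariable.
Variable R : realType.

(** The derivative of the remainder is the remainder of the derivative, bounded by induction; the
    mean value theorem on [0, s] concludes. The factor 1/N! is given up. *)
Lemma taylor_unit_interval (g : nat -> R -> R) N (C : R) :
  (forall r (s : R), 0 <= s <= 1 -> is_derive s (1 : R) (g r) (g r.+1 s)) ->
  (forall s : R, 0 <= s <= 1 -> `|g N s| <= C) ->
  `|g 0%N 1 - \sum_(r < N) r`!%:R^-1 * g r 0| <= C.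
Proof.
move=> Hg HN.
suff H (s : R) : 0 <= s <= 1 -> `|g 0%N s - (\poly_(r < N) (r`!%:R^-1 * g r 0)).[s]| <= C.
  have := H 1; rewrite horner_poly; under eq_bigr do rewrite expr1n mulr1.
  by apply; rewrite ler01 lexx.
elim: N g Hg HN s => [|N IH] g Hg HN s s01.
  by rewrite horner_poly big_ord0 subr0; exact: HN.
have {}IH := IH (fun r => g r.+1) (fun r => Hg r.+1) HN.
set P := \poly_(_ < _) _; case/andP: (s01) => s0 s1.
have dP : P^`() = \poly_(r < N) (r`!%:R^-1 * g r.+1 0).
  apply/polyP => r; rewrite coef_deriv !coef_poly ltnS; case: ltnP => _; last by rewrite mul0rn.
  by rewrite factS natrM invfM -[LHS]mulr_natl !mulrA divff ?mul1r// pnatr_eq0.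
have D (t : R) : 0 <= t <= 1 -> is_derive t (1 : R) (fun t => g 0%N t - P.[t])
    (g 1%N t - (\poly_(r < N) (r`!%:R^-1 * g r.+1 0)).[t]).
  by move=> t01; apply: is_deriveB; [exact: Hg|rewrite -dP; exact: is_derive_poly].
move: s0; rewrite le_eqVlt => /predU1P[<-|s0].
  rewrite horner_poly big_ord_recl /= expr0 mulr1 fact0 invr1 mul1r.
  rewrite big1 ?addr0 ?subrr ?normr0; last by move=> i _; rewrite expr0n mulr0.
  by apply: le_trans (HN 0 _); rewrite ?lexx ?ler01.
have [||c c01 E] := @MVT R (fun t => g 0%N t - P.[t]) (fun t =>
    g 1%N t - (\poly_(r < N) (r`!%:R^-1 * g r.+1 0)).[t]) _ _ s0.
- move=> t; rewrite in_itv/= => /andP[t0 ts]; apply: D.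
  by rewrite (ltW t0) (le_trans (ltW ts)).
- apply/subspace_continuousP => t /=; rewrite in_itv/= => /andP[t0 ts].
  apply: cvg_within_filter; apply: differentiable_continuous.
  apply/derivable1_diffP; apply: ex_derive; apply: D.
  by rewrite t0 (le_trans ts).
have P0 : g 0%N 0 - P.[0] = 0.
  rewrite horner_poly big_ord_recl /= expr0 mulr1 fact0 invr1 mul1r.
  by rewrite big1 ?addr0 ?subrr// => i _; rewrite expr0n mulr0.
rewrite P0 !subr0 in E; rewrite E normrM (ger0_norm (ltW s0)).
have c01' : 0 <= c <= 1.
  by move: c01; rewrite in_itv/= => /andP[c0 cs]; rewrite (ltW c0) (le_trans (ltW cs)).
apply: (le_trans _ (IH c c01')); rewrite ler_piMr//.
Qed.

End TaylorOneVariable.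

Section Tube.
Variables (R : realType) (n : nat).
Local Notation V := 'rV[R]_n.

Lemma continuous_itv_near (W : normedModType R) (a b : R) (q : R -> W) (t e : R) :
  {within `[a, b], continuous q} -> a <= t <= b -> 0 < e ->
  exists2 d : R, 0 < d & forall s : R, a <= s <= b -> `|s - t| < d -> `|q s - q t| < e.
Proof.
move=> cq tab e0.
have /subspace_continuousP/(_ t) := cq.
rewrite /= in_itv/= => /(_ tab)/cvgrPdist_lt/(_ _ e0).
rewrite near_withinE => /nbhs_normP[d /= d0 Hd]; exists d => // s sab sd.
by rewrite distrC; apply: Hd; rewrite /= ?in_itv//= distrC.
Qed.

(** Continuity at q t gives a ball and a bound valid for nearby times; [cousin] pastes them, taking
    the smaller radius and the sum of the bounds. *)
Lemma tube_bound (U : set V) (q : R -> V) (a b : R) (I : finType) (g : I -> V -> R) :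
  a <= b -> {within `[a, b], continuous q} -> open U ->
  (forall t, a <= t <= b -> U (q t)) ->
  (forall i y, U y -> {for y, continuous (g i)}) ->
  exists r : R, [/\ 0 < r, r <= 1 & exists C : R, 0 < C /\ forall (t : R) v, a <= t <= b -> `|v| <= r ->
    U (q t + v) /\ forall i, `|g i (q t + v)| <= C].
Proof.
move=> ab cq oU qU cg.
apply: (@cousin R (fun x y => exists r : R, [/\ 0 < r, r <= 1 & exists C : R, 0 < C /\
  forall (t : R) v, x <= t <= y -> `|v| <= r -> U (q t + v) /\ forall i, `|g i (q t + v)| <= C]) a b) => //.
  move=> x y z _ xy yz _ [r1 [r10 r11 [C1 [C10 H1]]]] [r2 [r20 r21 [C2 [C20 H2]]]].
  exists (Num.min r1 r2); split; [by rewrite lt_min r10|by rewrite ge_min r11|].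
  exists (C1 + C2); split; first exact: addr_gt0.
  move=> t v /andP[xt tz]; rewrite le_min => /andP[v1 v2].
  have [ty|/ltW yt] := leP t y.
    have [|u1 u2] := H1 t v _ v1; first by rewrite xt.
    by split => // i; apply: (le_trans (u2 i)); rewrite lerDl ltW.
  have [|u1 u2] := H2 t v _ v2; first by rewrite yt.
  by split => // i; apply: (le_trans (u2 i)); rewrite lerDr ltW.
move=> t tab; have Ut := qU t tab.
pose C := 1 + \sum_i (`|g i (q t)| + 1).
have C0 : 0 < C by rewrite ltr_wpDr// sumr_ge0.
have : \forall y \near q t, U y /\ forall i, `|g i y| <= C.
  have HU : \forall y \near q t, U y by exact: open_nbhs_nbhs.
  have Hg : \forall y \near q t, forall i, `|g i y| <= C.
    apply: (@filter_forall _ _ (fun i y => `|g i y| <= C) (nbhs (q t))) => i.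
    have := cg i _ Ut => /cvgrPdist_lt/(_ _ ltr01); apply: filterS => y Hy.
    apply: (@le_trans _ _ (`|g i (q t)| + 1)).
      have := ler_normB (g i (q t)) (g i (q t) - g i y); rewrite opprB addrC subrK.
      by move=> /le_trans; apply; rewrite lerD2l ltW.
    by rewrite /C (bigD1 i)//= addrCA lerDl addr_ge0// sumr_ge0// => j _; rewrite addr_ge0.
  by apply: filterS2 HU Hg.
move/nbhs_normP => [r /= r0 Hr].
have r2 : 0 < r / 2 by rewrite divr_gt0.
have [d d0 Hd] := continuous_itv_near cq tab r2.
exists d => // x y ax xt ty yb tx yt.
exists (Num.min (r / 4) 1); split; first by rewrite lt_min divr_gt0//= ltr01.
  by rewrite ge_min lexx orbT.
exists C; split => // s v /andP[xs sy]; rewrite le_min => /andP[vr _].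
apply: Hr => /=.
have : `|q s - q t| < r / 2.
  apply: Hd; first by rewrite (le_trans ax xs) (le_trans sy yb).
  by rewrite ltr_norml; apply/andP; split; lra.
rewrite distrC opprD addrA => h; apply: (le_lt_trans (ler_normB _ _)).
by apply: (@lt_le_trans _ _ (r / 2 + r / 4)); [exact: ltr_leD|lra].
Qed.

Local Notation iterD := Defs.iterD.

(** Taylor's formula along the segment from q t to q t + v, with the derivatives of order N bounded
    on a tube by compactness; hence radius and constant do not depend on t. *)
Lemma taylor_tube (U : set V) (f : V -> V) (q : R -> V) (a b : R) N :
  a <= b -> {within `[a, b], continuous q} -> open U -> smooth_on U f ->
  (forall t, a <= t <= b -> U (q t)) ->
  exists r : R, [/\ 0 < r, r <= 1 & exists C : R, 0 < C /\ forall (t : R) v, a <= t <= b -> `|v| <= r ->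
    U (q t + v) /\ forall e,
    `|f (q t + v) ord0 e - pform N (taylor_coef (jet_coef f (q t) e)) (coords v)|
       <= C * `|v| ^+ N].
Proof.
move=> ab cq oU sf qU.
pose I := (N.-tuple 'I_n * 'I_n)%type.
have [|r [r0 r1 [C [C0 HC]]]] := @tube_bound U q a b I
    (fun i y => jet_coef f y i.2 (tval i.1)) ab cq oU qU.
  move=> [s e] y Uy; rewrite /jet_coef /=.
  have /differentiable_continuous := sf (basis_seq R s) y Uy.
  move=> H; apply: (@continuous_comp _ _ _ (iterD f (basis_seq R s)) (fun M : V => M ord0 e)) => //.
  exact: coord_continuous.
exists r; split => //; exists (C * n%:R ^+ N + 1); split.
  by rewrite ltr_wpDl// mulr_ge0 ?exprn_ge0// ltW.
move=> t v tab vr; split; first by have [] := HC t v tab vr.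
move=> e.
have Us (s : R) : 0 <= s <= 1 -> `|s *: v| <= r.
  move=> /andP[s0 s1]; rewrite normrZ ger0_norm//.
  by apply: le_trans vr; rewrite ler_piMl.
pose g (k : nat) (s : R) := iterD f (nseq k v) (q t + s *: v) ord0 e.
have Hg k (s : R) : 0 <= s <= 1 -> is_derive s (1 : R) (g k) (g k.+1 s).
  move=> s01; have Uy : U (q t + s *: v) by have [] := HC t _ tab (Us _ s01).
  have D := sf (nseq k v) _ Uy.
  have L : is_derive s (1 : R) (fun s : R => iterD f (nseq k v) (q t + s *: v))
      ('D_v (iterD f (nseq k v)) (q t + s *: v)).
    have E : (fun h : R => h^-1 *: (((fun s : R => iterD f (nseq k v) (q t + s *: v)) \o shift s)
        (h *: (1 : R)) - iterD f (nseq k v) (q t + s *: v))) =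
        (fun h : R => h^-1 *: ((iterD f (nseq k v) \o shift (q t + s *: v)) (h *: v)
         - iterD f (nseq k v) (q t + s *: v))).
      apply/funext => h /=; congr (_ *: (_ - _)); congr (iterD _ _ _).
      by rewrite [h%:A]mulr1 scalerDl addrCA.
    split; last by rewrite /derive E.
    by rewrite /derivable E; exact: diff_derivable.
  have [L1 L2] := L; have := is_derive_coord_fun ord0 e L1.
  by rewrite L2.
have HN (s : R) : 0 <= s <= 1 -> `|g N s| <= (C * n%:R ^+ N + 1) * `|v| ^+ N.
  move=> s01; have [Uy HI] := HC t _ tab (Us _ s01).
  rewrite /g (iterD_nseq N v e oU sf Uy).
  apply: (le_trans (@mform_le R n _ C v N (ltW C0) _)).
    by move=> s' /eqP ss; exact: (HI (Tuple ss, e)).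
  by rewrite exprMn mulrA ler_wpM2r ?exprn_ge0// lerDl.
have := taylor_unit_interval Hg HN.
rewrite /g scale1r; congr (`| _ - _ | <= _).
apply: eq_bigr => k _; rewrite scale0r addr0 (iterD_nseq k v e oU sf (qU _ tab)).
by rewrite -mformZ.
Qed.

End Tube.

(** * Uniform estimates in the parameter *)

Section UniformOrder.
Variable R : realType.
Implicit Types (D : set R) (f g : R * R -> R).

(** One constant serves all t in D. The condition [d <= 1] makes |s|^N decreasing in N, which
    [filtS] requires. *)
Definition uniform_O D (N : nat) f : Prop := exists C d : R, [/\ 0 <= C, 0 < d, d <= 1 &
  forall t s, D t -> `|s| <= d -> `|f (t, s)| <= C * `|s| ^+ N].

Lemma uniform_O_filtration D : filtration (uniform_O D).
Proof.
split.
- move=> N; exists 0, 1; split => // t s _ _.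
  by rewrite mul0r normr0.
- move=> N f g [C [d [C0 d0 d1 Hf]]] [C' [d' [C'0 d'0 d'1 Hg]]].
  exists (C + C'), (Num.min d d'); split; [exact: addr_ge0|by rewrite lt_min d0|
    by rewrite ge_min d1|].
  move=> t s Dt; rewrite le_min => /andP[sd sd'].
  by rewrite mulrDl (le_trans (ler_normD _ _))// lerD ?Hf ?Hg.
- move=> N f [C [d [C0 d0 d1 Hf]]]; exists C, d; split => // t s Dt sd.
  by rewrite normrN; exact: Hf.
- move=> N N' f g [C [d [C0 d0 d1 Hf]]] [C' [d' [C'0 d'0 d'1 Hg]]].
  exists (C * C'), (Num.min d d'); split; [exact: mulr_ge0|by rewrite lt_min d0|
    by rewrite ge_min d1|].
  move=> t s Dt; rewrite le_min => /andP[sd sd'].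
  by rewrite normrM exprD mulrACA ler_pM ?Hf ?Hg.
- move=> N f [C [d [C0 d0 d1 Hf]]]; exists C, d; split => // t s Dt sd.
  apply: (le_trans (Hf t s Dt sd)); rewrite ler_wpM2l//.
  by rewrite exprS ler_piMl ?exprn_ge0// (le_trans sd).
Qed.

Lemma uniform_O_bounded D (c : R -> R) : (exists C, forall t, D t -> `|c t| <= C) ->
  uniform_O D 0 (fun p => c p.1).
Proof.
move=> [C HC]; exists `|C|, 1; split => // t s Dt _ /=.
by rewrite mulr1 (le_trans (HC t Dt))// ler_norm.
Qed.

Lemma uniform_O_s D : uniform_O D 1 (fun p => p.2).
Proof. by exists 1, 1; split => // t s _ _ /=; rewrite mul1r. Qed.

Lemma uniform_O_sX D N : uniform_O D N (fun p => p.2 ^+ N).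
Proof. by exists 1, 1; split => // t s _ _ /=; rewrite mul1r normrX. Qed.

Lemma uniform_O_eq D N f g : (forall t s, D t -> f (t, s) = g (t, s)) ->
  uniform_O D N f -> uniform_O D N g.
Proof.
move=> fg [C [d [C0 d0 d1 H]]]; exists C, d; split => // t s Dt sd.
by rewrite -fg//; exact: H.
Qed.

End UniformOrder.

Section Gronwall.
Variable R : realType.
Implicit Types (a b : R).

Lemma expR_lipschitz (B x y : R) : x <= B -> y <= B ->
  `|expR x - expR y| <= expR B * `|x - y|.
Proof.
move=> xB yB.
wlog xy : x y xB yB / x <= y => [H|].
  have [/H|/ltW/H] := leP x y; first exact.
  by rewrite distrC [X in _ -> _ <= _ * X]distrC; exact.
move: xy; rewrite le_eqVlt => /predU1P[->|xy].
  by rewrite !subrr normr0 mulr0.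
have [|c cxy E] := @MVT R expR expR x y xy.
  by apply: continuous_subspaceT; exact: continuous_expR.
rewrite distrC E normrM distrC (ger0_norm (expR_ge0 _)) ler_wpM2r// ler_expR.
by move: cxy; rewrite in_itv/= => /andP[_ /ltW cy]; exact: le_trans yB.
Qed.

Lemma car_expR a b (W w : R -> R) : caratheodory a b W w ->
  caratheodory a b (fun t => expR (W t)) (fun t => w t * expR (W t)).
Proof.
move=> [acW H]; have [B B0 HB] := continuous_itv_bounded (ac_continuous acW).
split.
  apply: (@ac_lip _ _ _ a b (expR B)) acW => s t as_ st tb.
  apply: expR_lipschitz.
    by rewrite (le_trans (ler_norm _))// HB// (le_trans as_ st).
  by rewrite (le_trans (ler_norm _))// HB// as_ (le_trans st).
apply: filterS H => t H tab; have Ht := H tab.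
by have := is_derive1_comp (is_derive_expR (W t)) Ht; rewrite mulrC.
Qed.

(** Integrating factor: N exp(-W) has a.e. nonpositive derivative and is absolutely continuous,
    hence does not increase. *)
Lemma gronwall a b (N dN W w : R -> R) : a <= b ->
  caratheodory a b N dN -> caratheodory a b W w ->
  {ae lebesgue_measure, forall t, a < t < b -> dN t <= w t * N t} ->
  N b <= N a * expR (W b - W a).
Proof.
move=> ab HN HW Hle.
have HW' := carB (car_cst a b 0) HW.
have HP := carM HN (car_expR HW').
have : N b * expR (0 - W b) - N a * expR (0 - W a) <= 0 - 0.
  apply: (car_le ab HP (car_cst a b 0)); apply: filterS Hle => t Hle tab.
  have -> : dN t * expR (0 - W t) + N t * ((0 - w t) * expR (0 - W t)) =
      (dN t - w t * N t) * expR (0 - W t) by ring.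
  by rewrite mulr_le0_ge0 ?expR_ge0// subr_le0; exact: Hle.
rewrite subrr !sub0r subr_le0 => H.
rewrite -(ler_pM2r (expR_gt0 (- W b))) -mulrA -expRD.
by rewrite (_ : W b - W a - W b = - W a)//; ring.
Qed.

End Gronwall.

(** * Polarization: from the diagonal equations of the forms to their coefficients *)

Section Polarization.
Variables (F : numFieldType) (n : nat).

(** After multinomial expansion, the signed sum over subsets kills every multi-index with a zero
    entry. Among those of size m only (1, ..., 1) survives. *)
Lemma polarization (c : seq 'I_n -> F) m (x : 'I_m -> 'I_n -> F) : symmetric_coef c ->
  \sum_(f : {ffun 'I_m -> bool}) (\prod_i (-1) ^+ (~~ f i)) *
    (m`!%:R^-1 * mform c (nseq m (fun j => \sum_i (f i)%:R * x i j))) =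
  mform c [seq x i | i <- enum 'I_m].
Proof.
move=> sc.
have E (f : {ffun 'I_m -> bool}) :
    m`!%:R^-1 * mform c (nseq m (fun j => \sum_i (f i)%:R * x i j)) =
    \sum_(al : {ffun 'I_m -> 'I_m.+1} | (\sum_i al i)%N == m)
      (\prod_i (al i)`!)%:R^-1 * ((\prod_i (f i)%:R ^+ al i) *
      mform c (flatten [seq nseq (al i) (x i) | i <- enum 'I_m])).
  apply: polyC_inj; rewrite polyCM -mform_polyc map_nseq mul_polyC.
  have -> : (fun j => (\sum_i (f i)%:R * x i j)%:P) =
      fun j => \sum_(i < m) (f i)%:R%:P * (x i j)%:P :> {poly F}.
    apply/funext => j; rewrite rmorph_sum; apply: eq_bigr => i _; exact: polyCM.
  rewrite -[nseq _ _]cats0 (@mform_multinomial F n m m m.+1)//; last first.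
    by move=> a a' aa'; rewrite /polyc (sc _ _ aa').
  rewrite [RHS]rmorph_sum; apply: eq_bigr => al _.
  rewrite cats0 rmorphM /= mul_polyC; congr (_ *: _).
  rewrite (mform_flatten_scale _ (fun i => (al : {ffun 'I_m -> 'I_m.+1}) i)
    (fun i : 'I_m => (f i)%:R%:P)) big_enum rmorphM rmorph_prod /=.
  congr (_ * _); first by apply: eq_bigr => i _; rewrite rmorphXn.
  rewrite -mform_polyc; congr mform.
  rewrite map_flatten; congr flatten; rewrite -[RHS]map_comp; apply: eq_map => i /=.
  by rewrite map_nseq.
under eq_bigr => f _ do rewrite E mulr_sumr.
rewrite exchange_big /=.
have S (al : {ffun 'I_m -> 'I_m.+1}) :
    \sum_(f : {ffun 'I_m -> bool}) (\prod_i (-1) ^+ (~~ f i)) *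
      (\prod_i (f i)%:R ^+ al i) = (\prod_i (0 < al i)%N%:R : F).
  rewrite (eq_bigr (fun f : {ffun 'I_m -> bool} =>
    \prod_i ((-1) ^+ (~~ f i) * (f i)%:R ^+ al i))); last by move=> f _; rewrite big_split.
  rewrite -(bigA_distr_bigA (fun i (b : bool) => (-1) ^+ (~~ b) * b%:R ^+ al i)).
  apply: eq_bigr => i _; rewrite big_bool /= expr0 mul1r expr1n expr1 expr0n.
  by rewrite lt0n; case: (_ == _); rewrite /= ?mulN1r ?subrr ?oppr0 ?addr0.
pose al1 : {ffun 'I_m -> 'I_m.+1} := [ffun i : 'I_m => inord 1].
have m1 (i : 'I_m) : (1 < m.+1)%N by have := ltn_ord i; lia.
have al1E (i : 'I_m) : al1 i = 1%N :> nat by rewrite ffunE inordK// (m1 i).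
rewrite (bigD1 al1) /=; last first.
  rewrite (eq_bigr (fun=> 1%N)) ?sum1_card ?card_ord// => i _; exact: al1E.
rewrite [X in _ + X]big1 ?addr0; last first.
  move=> al /andP[/eqP sal nal].
  under eq_bigr => f _ do rewrite mulrCA [X in _ * X]mulrA.
  rewrite -mulr_sumr -mulr_suml S.
  suff [i ai0] : exists i, al i = 0%N :> nat.
    have -> : \prod_i (0 < al i)%N%:R = 0 :> F by rewrite (bigD1 i)//= ai0 mul0r.
    by rewrite mul0r mulr0.
  have : [exists i, al i == 0%N :> nat].
    apply: contraNT nal; rewrite negb_exists => /forallP Hal.
    have al_ge i : (1 <= al i)%N by rewrite lt0n.
    apply/eqP/ffunP => i; apply: val_inj; rewrite /= al1E.
    have : (\sum_i (al i - 1) = 0)%N.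
      have : (\sum_i al i = \sum_i ((al i - 1) + 1))%N.
        by apply: eq_bigr => j _; rewrite subnK.
      rewrite big_split /= sal sum1_card card_ord => h.
      by apply/eqP; rewrite -(eqn_add2r m) add0n -h.
    move/eqP; rewrite sum_nat_eq0 => /forallP/(_ i)/= h.
    by have := al_ge i; lia.
  by move=> /existsP[i /eqP]; exists i.
under eq_bigr => f _ do rewrite mulrCA [X in _ * X]mulrA.
rewrite -mulr_sumr -mulr_suml S.
have -> : \prod_i (0 < al1 i)%N%:R = 1 :> F by rewrite big1// => i _; rewrite al1E.
have -> : (\prod_i (al1 i)`!)%N = 1%N by rewrite big1// => i _; rewrite al1E.
rewrite invr1 !mul1r.
congr mform; elim: (enum 'I_m) => //= i s ->; by rewrite al1E.
Qed.

End Polarization.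

Section DiagonalDerivative.
Variables (R : realType) (n : nat).
Local Notation V := 'rV[R]_n.

Lemma polyfun_sum k p (I : Type) (r : seq I) (P : pred I) (f : I -> 'M[R]_(k, p) -> R) :
  (forall i, P i -> polyfun (f i)) -> polyfun (fun x => \sum_(i <- r | P i) f i x).
Proof.
move=> H; elim: r => [|i r IH].
  by under eq_fun do rewrite big_nil; exact: polyfun_cst.
under eq_fun do rewrite big_cons.
have [Pi|nPi] := boolP (P i); last exact: IH.
exact: polyfunD (H _ Pi) IH.
Qed.

Lemma polyfun_mform (c : seq 'I_n -> R) m :
  polyfun (fun v : V => mform c (nseq m (coords v))).
Proof.
elim: m c => [|m IH] c /=; first exact: polyfun_cst.
by apply: polyfun_sum => j _; apply: polyfunM; [exact: polyfun_coord|exact: IH].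
Qed.

(** Continuity and density of the rational vectors; it turns countably many a.e. identities into one
    for all vectors. *)
Lemma polyfun_eq0 (f : V -> R) : polyfun f ->
  (forall r : 'rV[rat]_n, f (map_mx ratr r) = 0) -> forall v, f v = 0.
Proof.
move=> pf fr v; apply/eqP; rewrite -normr_le0; apply/ler_addgt0Pr => e e0; rewrite add0r.
have /differentiable_continuous/cvgrPdist_lt/(_ _ e0) := polyfun_differentiable v pf.
move/nbhs_normP => [d /= d0 Hd].
have H j : exists r : rat, `|v ord0 j - ratr r| < d / 2.
  have [|r] := @rat_in_itvoo R (v ord0 j - d / 2) (v ord0 j + d / 2).
    by rewrite ltrBlDr -addrA ltrDl addr_gt0 ?divr_gt0.
  by rewrite in_itv/= => rv; exists r; rewrite ltr_distlC.
have [r Hr] := choice H.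
have := Hd (map_mx ratr (\row_j r j)); rewrite fr subr0 => K; apply/ltW/K => /=.
apply: (@le_lt_trans _ _ (d / 2)); last by rewrite ltr_pdivrMr// ltr_pMr// ltr1n.
apply: mx_norm_le; first by rewrite divr_ge0// ltW.
by move=> i j; rewrite !mxE ord1; exact: ltW.
Qed.

Lemma car_eqf (W : normedModType R) a b (f g h : R -> W) :
  (forall t, a <= t <= b -> f t = g t) -> caratheodory a b f h -> caratheodory a b g h.
Proof.
move=> fg [acf H]; split.
  move=> e e0; have [d d0 Hd] := acf e e0; exists d => // N lo hi hlh dj sd.
  have := Hd N lo hi hlh dj sd; congr (_ < _); apply: eq_bigr => j _.
  have [h1 h2 h3] := hlh j; rewrite -!fg//.
    by rewrite h1 (le_trans h2).
  by rewrite (le_trans h1 h2).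
apply: filterS H => t H tab; have {}H := H tab.
apply: (near_eq_is_derive _ H).
move: tab; rewrite in_itv/= => /andP[ta tb].
near=> s; apply: fg; apply/andP; split.
  by apply: ltW; near: s; exact: lt_nbhsr.
by apply: ltW; near: s; exact: lt_nbhsl.
Unshelve. all: by end_near. Qed.

Lemma mform_basis (A : comNzRingType) (c : seq 'I_n -> A) s :
  mform c [seq (fun j => (j == i)%:R) | i <- s] = c s.
Proof.
elim: s c => [//|i s IH] c /=; rewrite (bigD1 i)//= eqxx mul1r IH big1 ?addr0//.
by move=> j /negbTE->; rewrite mul0r.
Qed.

Section Polarize.
Variables (m : nat) (a b : R) (phi : R -> seq 'I_n -> R) (rhs : R -> V -> R).
Hypothesis sphi : forall t, a <= t <= b -> symmetric_coef (phi t).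
Hypothesis Hphi : forall v : V,
  caratheodory a b (fun t => mform (phi t) (nseq m (coords v))) (rhs ^~ v).

(** The polarization formula with the right-hand side in place of the form, at subset sums of the
    basis vectors listed in s. It gives the derivative of each coefficient, although the equation is
    prescribed on the diagonal only. For [size s = m] the default of [nth] is not reached. *)
Definition polarize (t : R) (s : seq 'I_n) : R :=
  \sum_(f : {ffun 'I_m -> bool}) (\prod_i (-1) ^+ (~~ f i)) *
    (m`!%:R^-1 * rhs t (\sum_(i < m) \sum_(k < n)
       ((f i)%:R * (k == nth k s i)%:R) *: delta_mx ord0 k)).

Lemma car_polarize s : size s = m -> caratheodory a b (phi ^~ s) (polarize ^~ s).
Proof.
move=> sm; pose x (i : 'I_m) (k : 'I_n) : R := (k == nth k s i)%:R.
have cx (f : {ffun 'I_m -> bool}) : coords (\sum_(i < m) \sum_(k < n)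
    ((f i)%:R * (k == nth k s i)%:R) *: delta_mx ord0 k : V) =
    fun k => \sum_i (f i)%:R * x i k.
  apply/funext => k; rewrite /coords summxE; apply: eq_bigr => i _.
  rewrite summxE (bigD1 k)//= !mxE !eqxx mulr1 big1 ?addr0// => k' k'k.
  by rewrite !mxE eqxx /= [k == k']eq_sym (negbTE k'k) mulr0.
apply: (@car_eqf _ _ _ (fun t => \sum_(f : {ffun 'I_m -> bool}) (\prod_i (-1) ^+ (~~ f i)) *
    (m`!%:R^-1 * mform (phi t) (nseq m (fun k => \sum_i (f i)%:R * x i k))))).
  move=> t tab; rewrite polarization; last exact: sphi.
  rewrite -[RHS](mform_basis (phi t) s); congr mform.
  have sE : size [seq x i | i <- enum 'I_m] = m by rewrite size_map size_enum_ord.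
  apply: (@eq_from_nth _ (fun=> 0)); first by rewrite sE size_map sm.
  rewrite sE => i im; apply/funext => k.
  rewrite (nth_map (Ordinal im)) ?size_enum_ord// (nth_map k) ?sm//.
  by rewrite /x nth_enum_ord.
apply: car_sum => f _; apply: (@carZr R R^o); apply: (@carZr R R^o).
by rewrite -cx; exact: Hphi.
Qed.

(** The null set of the diagonal equation depends on v. Outside the union over rational v, both
    sides are polynomials in v that agree at rational points, hence everywhere. *)
Lemma polarize_diag : (forall t, a < t < b -> polyfun (rhs t)) ->
  {ae lebesgue_measure, forall t, a < t < b -> forall v : V,
    mform (polarize t) (nseq m (coords v)) = rhs t v}.
Proof.
move=> prhs.
have H1 : {ae lebesgue_measure, forall t, forall s : m.-tuple 'I_n, t \in `]a, b[ ->
    is_derive t (1 : R) (phi ^~ s) (polarize t s)}.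
  apply: ae_forall_fin => s.
  by have [_] := car_polarize (eqP (valP s)); apply: filterS => t.
(* Rational vectors are enumerated by [unpickle], to use countable additivity. *)
have H2 : {ae lebesgue_measure, forall t, forall k : nat, t \in `]a, b[ ->
    forall r : 'rV[rat]_n, unpickle k = Some r ->
    is_derive t (1 : R) (fun t => mform (phi t) (nseq m (coords (map_mx ratr r : V))))
      (rhs t (map_mx ratr r))}.
  apply: ae_foralln => k; case: (unpickle k) => [r|]; last exact: aeW.
  have [_] := Hphi (map_mx ratr r); apply: filterS => t H tab r' [<-]; exact: H.
apply: filterS2 H1 H2 => t H1 H2 tab v; have tab' : t \in `]a, b[ by rewrite in_itv.
apply/eqP; rewrite -subr_eq0; apply/eqP.
have pf : polyfun (fun v : V => mform (polarize t) (nseq m (coords v)) - rhs t v).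
  have := polyfunD (polyfun_mform (polarize t) m) (polyfunM (@polyfun_cst _ _ _ (-1)) (prhs t tab)).
  by under eq_fun do rewrite mulN1r.
apply: (polyfun_eq0 pf) => r; apply/eqP; rewrite subr_eq0; apply/eqP.
have D1 : is_derive t (1 : R) (fun t => mform (phi t) (nseq m (coords (map_mx ratr r : V))))
    (mform (polarize t) (nseq m (coords (map_mx ratr r : V)))).
  apply: is_derive_mform => s; rewrite size_nseq => /eqP sm.
  exact: (H1 (Tuple sm) tab').
have D2 := H2 (pickle r) tab' r (pickleK r).
by rewrite -(@derive_val _ _ _ _ _ _ _ D1) -(@derive_val _ _ _ _ _ _ _ D2).
Qed.

End Polarize.
End DiagonalDerivative.

Section ProductRule.
Variables (R : realType) (n : nat).

(** The derivative of c(v, ..., v) along w, in the recursive form in which the product rule delivers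
    it; symmetry then collects the equal terms. *)
Fixpoint dmform (c : seq 'I_n -> R) (m : nat) (v w : 'I_n -> R) : R :=
  if m is m'.+1 then
    \sum_j (w j * mform (fun a => c (j :: a)) (nseq m' v) +
            v j * dmform (fun a => c (j :: a)) m' v w)
  else 0.

Lemma dmform_symmetric c m v w : symmetric_coef c ->
  dmform c m.+1 v w = m.+1%:R * \sum_j w j * mform (fun a => c (j :: a)) (nseq m v).
Proof.
elim: m c => [|m IH] c sc.
  by rewrite mul1r; apply: eq_bigr => j _; rewrite /= mulr0 addr0.
set S := \sum_j w j * mform (fun a => c (j :: a)) (nseq m.+1 v).
transitivity (S + m.+1%:R * S); last by rewrite -[m.+2%:R]natr1; ring.
rewrite -[dmform _ _ _ _]/(\sum_j (w j * mform (fun a => c (j :: a)) (nseq m.+1 v) +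
            v j * dmform (fun a => c (j :: a)) m.+1 v w)).
rewrite big_split; congr (_ + _).
under eq_bigr => j _ do rewrite (IH _ (@symmetric_coef_cons _ _ c j sc)) mulrCA mulr_sumr.
rewrite -mulr_sumr exchange_big; congr (_ * _); apply: eq_bigr => i _.
rewrite -[mform _ (nseq m.+1 v)]/(\sum_j v j * mform (fun a => c [:: i, j & a]) (nseq m v)).
rewrite mulr_sumr; apply: eq_bigr => j _.
rewrite mulrCA; congr (_ * (_ * _)); apply: eq_mform => a _; apply: sc.
by rewrite (perm_catCA [:: j] [:: i] a).
Qed.

Lemma car_mform a b (c dc : R -> seq 'I_n -> R) (v dv : R -> 'I_n -> R) m :
  (forall s, size s = m -> caratheodory a b (c ^~ s) (dc ^~ s)) ->
  (forall j, caratheodory a b (v ^~ j) (dv ^~ j)) ->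
  caratheodory a b (fun t => mform (c t) (nseq m (v t)))
    (fun t => mform (dc t) (nseq m (v t)) + dmform (c t) m (v t) (dv t)).
Proof.
move=> Hc Hv; elim: m c dc Hc => [|m IH] c dc Hc.
  have := Hc [::] erefl; apply: car_eq => t _ /=; by rewrite addr0.
have H j := carM (Hv j) (IH (fun t s => c t (j :: s)) (fun t s => dc t (j :: s))
  (fun s sm => Hc (j :: s) (congr1 S sm))).
have := car_sum (index_enum _) (P := xpredT) (fun j _ => H j).
apply: car_eq => t _ /=; rewrite -big_split /=; apply: eq_bigr => j _; ring.
Qed.

End ProductRule.

Section TriangularSum.
Variables (A : comNzRingType) (I : nat -> A -> Prop).
Hypothesis FI : filtration I.

Lemma triangular_sum (x d : nat -> A) k :
  \sum_(m < k) \sum_(r < m.+1) x r.+1 * d (m - r)%N =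
  \sum_(r < k) x r.+1 * \sum_(p < k - r) d p.
Proof.
have -> : \sum_(m < k) \sum_(r < m.+1) x r.+1 * d (m - r)%N =
    \sum_(m < k) \sum_(r < k | (r <= m)%N) x r.+1 * d (m - r)%N.
  apply: eq_bigr => m _.
  by rewrite (big_ord_widen k (fun r => x r.+1 * d (m - r)%N)) ?ltn_ord.
rewrite (exchange_big_dep xpredT) //=; apply: eq_bigr => r _; rewrite mulr_sumr.
rewrite -(big_mkord (fun m => (r <= m)%N) (fun m => x r.+1 * d (m - r)%N)).
rewrite -(big_mkord xpredT (fun p => x r.+1 * d p)).
have rk : (r <= k)%N by rewrite ltnW// ltn_ord.
rewrite (big_cat_nat _ rk)//= big_nat_cond big1 ?add0r; last first.
  by move=> i /andP[/andP[_ ir] ri]; move: ir; rewrite ltnNge ri.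
rewrite -{1}[r : nat]add0n big_addn big_nat_cond [RHS]big_nat_cond.
by apply: eq_big => [i|i _]; rewrite ?leq_addl ?andbT// addnK.
Qed.

(** The products x_(r+1) d_p absent from the triangular sum have p >= k - r, hence order at least k
    + 1. It shows that the u-part cancels up to the order of truncation. *)
Lemma filt_product_triangular (x d : nat -> A) k :
  (forall r, I r (x r)) -> (forall p, I p (d p)) ->
  I k.+1 ((\sum_(r < k) x r.+1) * (\sum_(p < k) d p) -
     \sum_(m < k) \sum_(r < m.+1) x r.+1 * d (m - r)%N).
Proof.
move=> Hx Hd; rewrite triangular_sum mulr_suml -sumrB; apply: (filt_sum FI) => r _.
rewrite -mulrBr.
rewrite -!(big_mkord xpredT (fun p => d p)) (big_cat_nat _ (leq_subr r k))//=.
rewrite [X in X - _]addrC addrK.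
have rk : (r <= k)%N by rewrite ltnW// ltn_ord.
rewrite (_ : k.+1 = r.+1 + (k - r))%N; last by rewrite addSn subnKC.
apply: (filtM FI) => //; rewrite big_nat_cond; apply: (filt_sum FI) => p.
by rewrite andbT => /andP[rp _]; apply: (filt_le FI rp).
Qed.

End TriangularSum.

(** * Polynomials with coefficients continuous in time, and the triangular system *)

Section ContinuousCoefficients.
Variables (R : realType) (a b : R).
Definition ccont (f : R -> R) : Prop := {within `[a, b], continuous f}.

Lemma ccont_eq (f g : R -> R) : (forall t, f t = g t) -> ccont f -> ccont g.
Proof. by move=> /funext->. Qed.

Lemma ccont_cst (c : R) : ccont (fun=> c).
Proof. by move=> x; exact: cvg_cst. Qed.

Lemma ccontD (f g : R -> R) : ccont f -> ccont g -> ccont (fun t => f t + g t).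
Proof. by move=> cf cg x; apply: cvgD; [exact: cf|exact: cg]. Qed.

Lemma ccontM (f g : R -> R) : ccont f -> ccont g -> ccont (fun t => f t * g t).
Proof. by move=> cf cg x; apply: cvgM; [exact: cf|exact: cg]. Qed.

Lemma ccont_sum (I : Type) (r : seq I) (P : pred I) (f : I -> R -> R) :
  (forall i, P i -> ccont (f i)) -> ccont (fun t => \sum_(i <- r | P i) f i t).
Proof.
move=> H; elim: r => [|i r IH].
  by apply: (@ccont_eq (fun=> 0)); [move=> t; rewrite big_nil|exact: ccont_cst].
have [Pi|nPi] := boolP (P i); last first.
  by apply: ccont_eq IH => t; rewrite big_cons (negbTE nPi).
by apply: ccont_eq (ccontD (H _ Pi) IH) => t; rewrite big_cons Pi.
Qed.

Lemma ccont_prod (I : Type) (r : seq I) (P : pred I) (f : I -> R -> R) :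
  (forall i, P i -> ccont (f i)) -> ccont (fun t => \prod_(i <- r | P i) f i t).
Proof.
move=> H; elim: r => [|i r IH].
  by apply: (@ccont_eq (fun=> 1)); [move=> t; rewrite big_nil|exact: ccont_cst].
have [Pi|nPi] := boolP (P i); last first.
  by apply: ccont_eq IH => t; rewrite big_cons (negbTE nPi).
by apply: ccont_eq (ccontM (H _ Pi) IH) => t; rewrite big_cons Pi.
Qed.

(** The degree bound, uniform in t, makes the remainder of a truncation a finite sum of bounded
    terms. *)
Definition cpoly (p : R -> {poly R}) : Prop :=
  (exists N, forall t, (size (p t) <= N)%N) /\ forall m, ccont (fun t => (p t)`_m).

Lemma cpoly_filtration : filtration (fun _ => cpoly).
Proof.
split=> [_|_ p q [[N HN] Hp] [[N' HN'] Hq]|_ p [[N HN] Hp]|_ _ p q [[N HN] Hp] [[N' HN'] Hq]|//].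
- split; first by exists 0%N => t; rewrite size_poly0.
  by move=> m; apply: (ccont_eq _ (@ccont_cst 0)) => t; rewrite coef0.
- split; first by exists (maxn N N') => t; rewrite (leq_trans (size_polyD _ _))// geq_max
    !leq_max HN HN' orbT.
  by move=> m; apply: (ccont_eq _ (ccontD (Hp m) (Hq m))) => t; rewrite coefD.
- split; first by exists N => t; rewrite size_polyN.
  by move=> m; apply: (ccont_eq _ (ccontM (@ccont_cst (-1)) (Hp m))) => t; rewrite coefN mulN1r.
- split.
    exists (N + N')%N => t; rewrite (leq_trans (size_polyMleq _ _))//.
    by rewrite (leq_trans (leq_pred _))// leq_add.
  move=> m; apply: (ccont_eq (f := fun t => \sum_(i < m.+1) (p t)`_i * (q t)`_(m - i))).
    by move=> t; rewrite coefM.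
  by apply: ccont_sum => i _; exact: ccontM.
Qed.

Lemma cpoly_cst (c : R -> R) : ccont c -> cpoly (fun t => (c t)%:P).
Proof.
move=> cc; split; first by exists 1%N => t; exact: size_polyC_leq1.
move=> m; apply: (ccont_eq (f := fun t => if m == 0%N then c t else 0)).
  by move=> t; rewrite coefC.
by case: (m == 0)%N => //; exact: ccont_cst.
Qed.

Lemma cpoly_Xn m (c : R -> R) : ccont c -> cpoly (fun t => 'X^m * (c t)%:P).
Proof.
move=> cc; split.
  exists (m.+1 + 1)%N => t; rewrite (leq_trans (size_polyMleq _ _))// size_polyXn.
  by rewrite (leq_trans (leq_pred _))// leq_add2l size_polyC_leq1.
move=> i; apply: (ccont_eq (f := fun t => if (i < m)%N then 0 else
    if (i - m == 0)%N then c t else 0)); first by move=> t; rewrite coefXnM coefC.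
by case: (i < m)%N; [exact: ccont_cst|case: (_ == _)%N => //; exact: ccont_cst].
Qed.

Lemma cpoly_truncate p k : cpoly p ->
  uniform_O [set t | a <= t <= b] k (fun z => (p z.1).[z.2] - \sum_(m < k) (p z.1)`_m * z.2 ^+ m).
Proof.
move=> [[N HN] Hp]; set D := [set t | _].
have FO := uniform_O_filtration D.
have E t s : (p t).[s] - \sum_(m < k) (p t)`_m * s ^+ m =
    \sum_(k <= m < maxn N k) (p t)`_m * s ^+ m.
  have -> : (p t).[s] = \sum_(0 <= m < maxn N k) (p t)`_m * s ^+ m.
    rewrite (horner_coef_wide _ (leq_trans (HN t) (leq_maxl N k))).
    by rewrite big_mkord.
  rewrite -(big_mkord xpredT (fun m => (p t)`_m * s ^+ m)).
  by rewrite (big_cat_nat _ (leq_maxr N k))//= [X in X - _]addrC addrK.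
apply: (@uniform_O_eq _ _ _ (\sum_(k <= m < maxn N k) (fun z : R * R => (p z.1)`_m * z.2 ^+ m))).
  by move=> t s _; rewrite E fct_sumE.
rewrite big_nat_cond; apply: (filt_sum FO) => m; rewrite andbT => /andP[km _].
apply: (filt_le FO km); rewrite -[m]add0n; apply: (filtM FO (a := fun z : R * R => (p z.1)`_(0 + m))
  (b := fun z : R * R => z.2 ^+ m)); last exact: uniform_O_sX.
apply: (@uniform_O_bounded _ D (fun t => (p t)`_(0 + m))).
have [M M0 HM] := continuous_itv_bounded (Hp (0 + m)%N).
by exists M => t Dt; exact: HM.
Qed.

End ContinuousCoefficients.

Section Piece.
Variables (R : realType) (n l k : nat) (a b : R).
Hypothesis ab : a <= b.
Variables (phi : R -> 'I_n -> seq 'I_n -> R) (M : R -> 'I_n -> 'I_n -> R).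
Variables (xi : R -> 'I_l -> 'I_n -> seq 'I_n -> R).
Hypothesis cphi : forall e s, ccont a b (fun t => phi t e s).
Hypothesis cM : forall d e, ccont a b (fun t => M t d e).
Hypothesis cxi : forall i e s, ccont a b (fun t => xi t i e s).

Section Continuity.
Variable x : R -> 'M[R]_(k, n).
Hypothesis cx : forall m e, ccont a b (fun t => x t m e).

Lemma jet_poly_cpoly e : cpoly a b (fun t => jet_poly (x t) e).
Proof.
have := @filt_sum _ _ (cpoly_filtration a b) 'I_k (index_enum _) xpredT
  (fun m t => 'X^(m.+1) * (x t m e)%:P) 0 (fun m _ => cpoly_Xn m.+1 (@cx m e)).
by congr cpoly; apply/funext => t; rewrite fct_sumE.
Qed.

Let cpoly_cstM (c : R) f : ccont a b f -> cpoly a b (fun t => (c * f t)%:P).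
Proof. by move=> cf; apply: cpoly_cst; apply: ccontM => //; exact: ccont_cst. Qed.

Lemma unadapt_cpoly e : cpoly a b (fun t => unadapt (phi t) (M t) (x t) e).
Proof.
apply: (unadapt_closed (cpoly_filtration a b)) => [e' s c|d e'|e'].
- exact: cpoly_cstM.
- exact: cpoly_cst.
- exact: jet_poly_cpoly.
Qed.

Lemma field_poly_cpoly i e :
  cpoly a b (fun t => field_poly (phi t) (xi t) k (unadapt (phi t) (M t) (x t)) i e).
Proof.
apply: (field_poly_closed (cpoly_filtration a b)) => [e' s c|d e'|i' e' s c|e'].
- exact: cpoly_cstM.
- exact: cpoly_cst.
- exact: cpoly_cstM.
- exact: jet_poly_cpoly.
Qed.

Lemma adapted_field_ccont i m e :
  ccont a b (fun t => adapted_field (phi t) (M t) (xi t) i (x t) m e).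
Proof.
by apply: ccont_eq (proj2 (field_poly_cpoly i e) m) => t; rewrite mxE.
Qed.

End Continuity.

(** By triangularity, once the rows before r are known, the velocity of row r is a sum of summable
    controls times continuous functions, so the row is a primitive. This gives a solution on all of
    [a, b]. *)
Lemma adapted_solution (du : R -> 'I_l -> R) (x0 : 'M[R]_(k, n)) :
  (forall i, summable_on a b (fun t => du t i)) ->
  exists x : R -> 'M[R]_(k, n), x a = x0 /\
    forall m e, caratheodory a b (fun t => x t m e)
      (fun t => \sum_i du t i * adapted_field (phi t) (M t) (xi t) i (x t) m e).
Proof.
move=> sdu.
(* Rows from r on are placeholders; they are kept continuous so that the continuity of the field
   applies to the whole matrix. *)
suff H r : (r <= k)%N -> exists x : R -> 'M[R]_(k, n),
    (forall m e, ccont a b (fun t => x t m e)) /\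
    forall (m : 'I_k) e, (m < r)%N -> x a m e = x0 m e /\
      caratheodory a b (fun t => x t m e)
      (fun t => \sum_i du t i * adapted_field (phi t) (M t) (xi t) i (x t) m e).
  have [x [_ Hx]] := H k (leqnn k); exists x; split.
    by apply/matrixP => m e; exact: (Hx m e (ltn_ord m)).1.
  by move=> m e; exact: (Hx m e (ltn_ord m)).2.
elim: r => [|r IH] rk.
  exists (fun=> 0); split=> // m e; exact: ccont_cst.
have [x [cx Hx]] := IH (ltnW rk).
have SE e : summable_on a b (fun t => \sum_i du t i *
    adapted_field (phi t) (M t) (xi t) i (x t) (Ordinal rk) e).
  apply: summable_sum => i _.
  have := summableM (@adapted_field_ccont x cx i (Ordinal rk) e) (sdu i).
  by apply: summable_eq; apply: aeW => t _; rewrite mulrC.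
pose F e := projT1 (cid (summable_primitive (SE e))).
have HF e : caratheodory a b (F e) _ := projT2 (cid (summable_primitive (SE e))).
pose y t := \matrix_(m < k, e < n)
  if m == r :> nat then x0 m e + (F e t - F e a) else x t m e.
have xy t (m : 'I_k) e : (m < r)%N -> x t m e = y t m e.
  by move=> mr; rewrite mxE (ltn_eqF mr).
have Hy (m : 'I_k) e : (m < r.+1)%N -> y a m e = x0 m e /\
      caratheodory a b (fun t => y t m e)
      (fun t => \sum_i du t i * adapted_field (phi t) (M t) (xi t) i (y t) m e).
  rewrite ltnS => mr.
  have D t : \sum_i du t i * adapted_field (phi t) (M t) (xi t) i (y t) m e =
      \sum_i du t i * adapted_field (phi t) (M t) (xi t) i (x t) m e.
    apply: eq_bigr => i _; congr (_ * _).
    by apply: esym; apply: (@adapted_field_rows _ _ _ _ _ _ k i _ _ r) => // m' e'; exact: xy.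
  have [mEr|mnr] := eqVneq (m : nat) r; last first.
    have {}mr : (m < r)%N by rewrite ltn_neqAle mnr.
    have [xa Cx] := Hx m e mr; split; first by rewrite -xy.
    apply: car_eqf (car_eq _ Cx) => t _; first exact: xy.
    by rewrite D.
  split; first by rewrite mxE mEr eqxx subrr addr0.
  have mE : m = Ordinal rk by apply/val_inj.
  have C1 := carD (car_cst a b (x0 m e - F e a)) (HF e).
  apply: car_eqf (car_eq _ C1) => t _; first by rewrite mxE mEr eqxx; ring.
  by rewrite D add0r mE.
exists y; split=> // m e.
have [mr|mr] := boolP (m < r.+1)%N; first exact: ac_continuous (proj1 (Hy m e mr).2).
apply: (ccont_eq _ (cx m e)) => t; rewrite mxE; case: eqP => // mEr.
by rewrite mEr ltnSn in mr.
Qed.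

End Piece.

Lemma filtMr (A : comNzRingType) (I : nat -> A -> Prop) N a b :
  filtration I -> I N a -> I 0 b -> I N (a * b).
Proof. by move=> FI Ia Ib; rewrite -[N]addn0; exact: (filtM FI). Qed.

Section Integrate.
Variables (R : realType) (a b : R).
Local Notation D := [set t : R | a <= t <= b].

Lemma car_ae_eq (V : normedModType R) (f g h : R -> V) :
  {ae lebesgue_measure, forall t, a < t < b -> g t = h t} ->
  caratheodory a b f g -> caratheodory a b f h.
Proof.
move=> H [acf df]; split => //; apply: filterS2 H df => t gh dt tab.
by rewrite -gh ?dt//; move: tab; rewrite in_itv.
Qed.

Lemma uniform_O_ccont (c : R -> R) : ccont a b c -> uniform_O D 0 (fun z => c z.1).
Proof.
move=> cc; apply: uniform_O_bounded; have [B _ HB] := continuous_itv_bounded cc.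
by exists B => t Dt; exact: HB.
Qed.

Lemma uniform_O_norm N (f : R * R -> R) : uniform_O D N f -> uniform_O D N (fun z => `|f z|).
Proof.
move=> [C [d [C0 d0 d1 H]]]; exists C, d; split => // t s Dt sd.
by rewrite normr_id; exact: H.
Qed.

(** The right-hand side is at most C1 |s|^N w, the derivative of C1 |s|^N W, so comparing increments
    bounds g although the controls may be unbounded. *)
Lemma uniform_O_integrate (I : finType) (W w : R -> R) (u : R -> I -> R)
    (E : I -> R * R -> R) (g : R * R -> R) N : a <= b ->
  caratheodory a b W w ->
  (forall t, 0 <= w t) -> (forall t i, `|u t i| <= w t) ->
  (forall i, uniform_O D N (E i)) ->
  (exists2 d : R, 0 < d & forall s, `|s| <= d ->
     caratheodory a b (fun t => g (t, s)) (fun t => \sum_i u t i * E i (t, s))) ->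
  uniform_O D N (fun z => g (a, z.2)) -> uniform_O D N g.
Proof.
move=> ab CW w0 uw HE [d d0 Hg] [C0 [d' [C00 d'0 d'1 Ha]]].
have := @filt_sum _ _ (uniform_O_filtration D) I (index_enum _) xpredT
  (fun i z => `|E i z|) N (fun i _ => uniform_O_norm (HE i)).
move=> [C1 [d'' [C10 d''0 d''1 HS]]].
have [B B0 HB] := continuous_itv_bounded (ac_continuous CW.1).
exists (C0 + C1 * (B + B)), (Num.min d (Num.min d' d'')).
have C2 : 0 <= C0 + C1 * (B + B) by rewrite addr_ge0// mulr_ge0// addr_ge0// ltW.
split=> //; [by rewrite !lt_min d0 d'0|by rewrite !ge_min d'1 !orbT|].
move=> t s /= Dt; rewrite !le_min => /and3P[sd sd' sd''].
have Daa : D a by rewrite /= lexx.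
have /= Has := Ha a s Daa sd'.
have /andP[at_ tb] := Dt.
suff H : `|g (t, s) - g (a, s)| <= C1 * `|s| ^+ N * W t - C1 * `|s| ^+ N * W a.
  rewrite -[g (t, s)](subrK (g (a, s))) (le_trans (ler_normD _ _))// addrC mulrDl.
  rewrite lerD// (le_trans H)// -mulrBr mulrAC ler_wpM2r ?exprn_ge0//.
  rewrite ler_wpM2l// (le_trans (ler_norm _))// (le_trans (ler_normB _ _))//.
  by rewrite lerD ?HB ?lexx.
apply: (@car_norm_le _ a t (fun t => g (t, s)) (fun t => C1 * `|s| ^+ N * W t)
   (fun t => \sum_i u t i * E i (t, s)) (fun t => C1 * `|s| ^+ N * w t)) => //.
- exact: car_sub (Hg s sd).
- exact: car_sub (carZr _ CW).
apply: aeW => y /andP[ay yt].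
have Dy : D y by rewrite /= (ltW ay) (le_trans (ltW yt)).
have := HS y s Dy sd''; rewrite fct_sumE ger0_norm ?sumr_ge0// => HSy.
rewrite (le_trans (ler_norm_sum _ _ _))//.
rewrite (@le_trans _ _ (w y * \sum_i `|E i (y, s)|))//.
  by rewrite mulr_sumr ler_sum// => i _; rewrite normrM ler_wpM2r.
by rewrite mulrC ler_wpM2r.
Qed.

End Integrate.

Section Evaluation.
Variables (R : realType) (n : nat).
Implicit Types (z : R * R).

Let ev z (f : R * R -> R) := f z.

(** The estimates are obtained in the ring of functions of (t, s); these lemmas read them
    pointwise. *)
Lemma mform_eval (c : seq 'I_n -> R * R -> R) m (v : 'I_n -> R * R -> R) z :
  mform c (nseq m v) z = mform (fun a => c a z) (nseq m (fun j => v j z)).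
Proof. by have := @mform_morph _ _ n (ev z) erefl _ _ c (nseq m v); rewrite map_nseq; exact. Qed.

Lemma pform_eval K (C : nat -> seq 'I_n -> R * R -> R) (v : 'I_n -> R * R -> R) z :
  pform K C v z = pform K (fun m a => C m a z) (fun j => v j z).
Proof. exact: (@pform_morph _ _ n (ev z) erefl). Qed.

Lemma step_eval K (M : 'I_n -> 'I_n -> R * R -> R) C x b d z :
  step K M C x b d z = step K (fun d e => M d e z) (fun e m a => C e m a z)
    (fun e => x e z) (fun e => b e z) d.
Proof. exact: (@step_morph _ _ n K (ev z) erefl). Qed.

Lemma iter_step_eval K (M : 'I_n -> 'I_n -> R * R -> R) C x N d z :
  iter N (step K M C x) (fun=> 0) d z =
  iter N (step K (fun d e => M d e z) (fun e m a => C e m a z) (fun e => x e z)) (fun=> 0) d.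
Proof. exact: (@iter_step_morph _ _ n K (ev z) erefl). Qed.

Lemma pform_horner K (C : nat -> seq 'I_n -> R) (v : 'I_n -> {poly R}) s :
  (pform K (fun m => polyc (C m)) v).[s] = pform K C (fun j => (v j).[s]).
Proof.
have := @pform_morph _ _ n (horner_eval s) (raddf0 _) (raddfD _) (rmorphM _) K
   (fun m => polyc (C m)) v.
rewrite /horner_eval => ->; apply: eq_bigr => m _; apply: eq_mform => a _.
by rewrite /= hornerC.
Qed.

(** Evaluation at s commutes with the iteration, so the polynomial solution becomes an iterate of
    the same numerical [step] of which the displacement is a fixed point. *)
Lemma unadapt_horner k (phi : 'I_n -> seq 'I_n -> R) M (x : 'M[R]_(k, n)) s d :
  (unadapt phi M x d).[s] =
  iter k (step k.+1 M (fun e => high_part (phi e)) (fun e => (jet_poly x e).[s])) (fun=> 0) d.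
Proof.
have := @iter_step_morph _ _ n k.+1 (horner_eval s) (raddf0 _) (raddfD _) (raddfN _) (rmorphM _)
  (fun d e => (M d e)%:P) (fun e m => polyc (high_part (phi e) m)) (jet_poly x) k d.
rewrite /horner_eval => ->; congr (iter _ (step _ _ _ _) _ _).
  by apply/funext => d'; apply/funext => e; rewrite hornerC.
by apply/funext => e; apply/funext => m; apply/funext => t; rewrite /= hornerC.
Qed.

End Evaluation.

(** * The expansion in adapted coordinates *)

Section Bootstrap.
Variables (R : realType) (n l k : nat) (a b : R).
Hypothesis ab : a <= b.
Local Notation D := [set t : R | a <= t <= b].
Let FO := uniform_O_filtration D.
Variables (phi dphi : R -> 'I_n -> seq 'I_n -> R) (M : R -> 'I_n -> 'I_n -> R).
Variables (xi : R -> 'I_l -> 'I_n -> seq 'I_n -> R).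
Variables (u du : R -> 'I_l -> R) (W w : R -> R).
Variables (beta : R * R -> 'I_n -> R) (Y : 'I_l -> R * R -> 'I_n -> R).
Hypothesis cphi : forall e s, ccont a b (fun t => phi t e s).
Hypothesis cM : forall d e, ccont a b (fun t => M t d e).
Hypothesis cxi : forall i e s, ccont a b (fun t => xi t i e s).
Hypothesis HY : forall i j, uniform_O D k.+2
  (fun z => Y i z j - pform k.+2 (taylor_coef (xi z.1 i j)) (beta z)).
Hypothesis beta1 : forall j, uniform_O D 1 (fun z => beta z j).
Hypothesis Hbeta : exists2 d : R, 0 < d & forall s, `|s| <= d -> forall j,
  caratheodory a b (fun t => beta (t, s) j)
    (fun t => \sum_i ((u t i + s * du t i) * Y i (t, s) j - u t i * xi t i j [::])).
Hypothesis Hphi : forall e s, caratheodory a b (fun t => phi t e s) (fun t => dphi t e s).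
Hypothesis sphi : forall t e, a <= t <= b -> symmetric_coef (phi t e).
Hypothesis ode : {ae lebesgue_measure, forall t, a < t < b -> forall e (m : 'I_k.+1) v,
  mform (dphi t e) (nseq m.+1 v) = - \sum_i u t i * \sum_(r < m.+1) 'C(m.+1, r.+1)%:R *
    mform (phi t e) ((fun j => mform (xi t i j) (nseq r.+1 v)) :: nseq (m - r) v)}.
Hypothesis HM : forall t, a <= t <= b ->
  forall d j, \sum_e M t d e * phi t e [:: j] = (d == j)%:R.
Hypothesis CW : caratheodory a b W w.
Hypothesis w0 : forall t, 0 <= w t.
Hypothesis uw : forall t i, `|u t i| <= w t.
Hypothesis duw : forall t i, `|du t i| <= w t.

Let dterm e j p z := mform (taylor_coef (fun c => phi z.1 e (j :: c)) p) (nseq p (beta z)).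
Let xterm i j p z := mform (taylor_coef (xi z.1 i j) p) (nseq p (beta z)).

Definition adapted_pos e z :=
  pform k.+2 (pos_part (taylor_coef (phi z.1 e))) (beta z).

(** The coefficient of u_i in the time derivative of F_t(b): the first term comes from the velocity
    of b, the triangular sum from the equations of the forms. *)
Definition drift_error e i z :=
  \sum_j ((Y i z j - xi z.1 i j [::]) * (\sum_(p < k.+1) dterm e j p z)
   - \sum_(m < k.+1) \sum_(r < m.+1) xterm i j r.+1 z * dterm e j (m - r) z).

Definition control_part e i z := \sum_j Y i z j * \sum_(p < k.+1) dterm e j p z.

Lemma taylor_binomial m (r : 'I_m.+1) : 'C(m.+1, r.+1)%:R / (m.+1)`!%:R =
  (r.+1)`!%:R^-1 * ((m - r)`!)%:R^-1 :> R.
Proof.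
have rm : (r.+1 <= m.+1)%N by exact: ltn_ord.
have E (c p q : nat) : (0 < c)%N ->
    c%:R / (c * (p * q))%:R = p%:R^-1 * q%:R^-1 :> R.
  by move=> c0; rewrite !natrM !invfM mulVKf// pnatr_eq0 -lt0n.
by rewrite -(bin_fact rm) subSS E ?bin_gt0.
Qed.

(** Product rule for F_t(b). The binomials in the equations of the forms merge with 1/(m+1)! into
    the Taylor factors of X_i and of DF_t, which produces the triangular sum of [drift_error]. *)
Lemma car_adapted_pos s e : (exists2 d : R, `|s| <= d & forall s, `|s| <= d -> forall j,
  caratheodory a b (fun t => beta (t, s) j)
    (fun t => \sum_i ((u t i + s * du t i) * Y i (t, s) j - u t i * xi t i j [::]))) ->
  caratheodory a b (fun t => adapted_pos e (t, s))
    (fun t => \sum_i (u t i * drift_error e i (t, s) + du t i * (s * control_part e i (t, s)))).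
Proof.
move=> [d sd Hd]; have Cb := Hd s sd.
pose db t j := \sum_i ((u t i + s * du t i) * Y i (t, s) j - u t i * xi t i j [::]).
have C1 (m : 'I_k.+2) := @car_mform _ n a b
  (fun t => pos_part (taylor_coef (phi t e)) m) (fun t => pos_part (taylor_coef (dphi t e)) m)
  (fun t => beta (t, s)) db m.
have {C1} C2 := car_sum (index_enum _) (P := xpredT) (fun (m : 'I_k.+2) _ => C1 m _ Cb).
have Ct (m : 'I_k.+2) r : size r = m ->
    caratheodory a b (fun t => pos_part (taylor_coef (phi t e)) m r)
      (fun t => pos_part (taylor_coef (dphi t e)) m r).
  by move=> _; case: m => -[|m] mk /=; [exact: car_cst|exact: carZr].
have {C2} C3 := C2 Ct.
apply: car_ae_eq (C3); apply: filterS ode => t Ht tab.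
have Dt : a <= t <= b by case/andP: tab => ? ?; rewrite !ltW.
rewrite big_ord_recl -[RHS]add0r; congr (_ + _); first by rewrite /= addr0.
have E1 (m : 'I_k.+1) : dmform (taylor_coef (phi t e) m.+1) m.+1 (beta (t, s)) (db t) =
   \sum_j db t j * dterm e j m (t, s).
  rewrite dmform_symmetric; last by move=> c c' /(sphi e Dt) E; rewrite /taylor_coef E.
  rewrite mulr_sumr; apply: eq_bigr => j _; rewrite mulrCA; congr (_ * _).
  rewrite /dterm /taylor_coef !mformZ mulrA; congr (_ * _).
  by rewrite factS natrM invfM mulrA divff ?mul1r// pnatr_eq0.
have E2 (m : 'I_k.+1) : mform (taylor_coef (dphi t e) m.+1) (nseq m.+1 (beta (t, s))) =
   \sum_i u t i * (-1 * \sum_j \sum_(r < m.+1) xterm i j r.+1 (t, s) * dterm e j (m - r) (t, s)).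
  rewrite /taylor_coef mformZ (Ht tab e m) mulrN -mulNr mulr_sumr.
  apply: eq_bigr => i _; rewrite mulrCA; congr (_ * _).
  rewrite !mulNr mul1r; congr (- _).
  rewrite mulr_sumr exchange_big /=; apply: eq_bigr => r _.
  rewrite mulrA [_^-1 * _]mulrC taylor_binomial mulr_sumr; apply: eq_bigr => j _.
  rewrite /xterm /dterm /taylor_coef !mformZ /=; ring.
under eq_bigr => m _ do rewrite [X in X + _](E2 m) [X in _ + X](E1 m).
rewrite big_split /= exchange_big [X in _ + X]exchange_big /=.
under [X in _ + X]eq_bigr => j _ do rewrite -mulr_sumr mulr_suml.
rewrite [X in _ + X]exchange_big -big_split /=; apply: eq_bigr => i _.
rewrite -!mulr_sumr exchange_big /= /drift_error /control_part !mulr_sumr.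
rewrite -!big_split; apply: eq_bigr => j _ /=; ring.
Qed.

Let bt j z := beta z j.

Let cc (c : R -> seq 'I_n -> R) := forall s, ccont a b (fun t => c t s).

Lemma uniform_O_taylor (c : R -> seq 'I_n -> R) m s : cc c ->
  uniform_O D 0 (fun z => taylor_coef (c z.1) m s).
Proof.
move=> Hc; apply: (uniform_O_ccont (c := fun t => taylor_coef (c t) m s)).
exact: ccontM (@ccont_cst _ _ _ _) (Hc s).
Qed.

Lemma uniform_O_mform (c : R -> seq 'I_n -> R) m : cc c ->
  uniform_O D m (fun z => mform (taylor_coef (c z.1) m) (nseq m (beta z))).
Proof.
move=> Hc; have := @filt_mform _ n _ FO (fun s z => taylor_coef (c z.1) m s) bt 1 m
  (fun s => uniform_O_taylor m s Hc) beta1.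
by rewrite mul1n; apply: uniform_O_eq => t s _; rewrite mform_eval.
Qed.

Lemma uniform_O_pform_sub (c : R -> seq 'I_n -> R) K (v : 'I_n -> R * R -> R) N : cc c ->
  (forall j, uniform_O D 1 (v j)) -> (forall j, uniform_O D N (fun z => beta z j - v j z)) ->
  uniform_O D N (fun z => pform K (taylor_coef (c z.1)) (beta z)
    - pform K (taylor_coef (c z.1)) (fun j => v j z)).
Proof.
move=> Hc Hv Hd.
have := @filt_pform_sub _ n _ FO K (fun m s z => taylor_coef (c z.1) m s) bt v 1 N 0
  (fun m s => uniform_O_taylor m s Hc) beta1 Hv (fun m s => ltac:(by [])) Hd.
by rewrite addn0; apply: uniform_O_eq => t s _; congr (_ - _); exact: pform_eval.
Qed.

Lemma uniform_O_dterm e j p : uniform_O D p (fun z => dterm e j p z).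
Proof. exact: (@uniform_O_mform (fun t c => phi t e (j :: c)) p (fun s => @cphi e (j :: s))). Qed.

Lemma uniform_O_xterm i j p : uniform_O D p (fun z => xterm i j p z).
Proof. exact: (@uniform_O_mform (fun t => xi t i j) p (fun s => @cxi i j s)). Qed.

Lemma uniform_O_dsum e j : uniform_O D 0 (fun z => \sum_(p < k.+1) dterm e j p z).
Proof.
have := @filt_sum _ _ FO 'I_k.+1 (index_enum _) xpredT (fun p z => dterm e j p z) 0
  (fun p _ => filt_le FO (leq0n p) (uniform_O_dterm e j p)).
by apply: uniform_O_eq => t s _; rewrite fct_sumE.
Qed.

(** Up to order k + 2, Y is its Taylor polynomial; what is left is a full product of two sums minus
    its triangular part. *)
Lemma uniform_O_drift e i : uniform_O D k.+2 (drift_error e i).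
Proof.
have H j := filtD FO
  (filtMr FO (HY i j) (uniform_O_dsum e j))
  (filt_product_triangular FO k.+1 (uniform_O_xterm i j) (uniform_O_dterm e j)).
have := filt_sum FO (index_enum _) (P := xpredT) (fun j _ => H j).
apply: uniform_O_eq => t s _; rewrite fct_sumE; apply: eq_bigr => j _.
have EP : pform k.+2 (taylor_coef (xi t i j)) (beta (t, s)) =
    xi t i j [::] + \sum_(r < k.+1) xterm i j r.+1 (t, s).
  by rewrite /pform big_ord_recl; congr (_ + _); rewrite /= /taylor_coef invr1 mul1r.
transitivity ((Y i (t, s) j - (xi t i j [::] + \sum_(r < k.+1) xterm i j r.+1 (t, s)))
   * (\sum_(p < k.+1) dterm e j p (t, s)) +
  ((\sum_(r < k.+1) xterm i j r.+1 (t, s)) * (\sum_(p < k.+1) dterm e j p (t, s)) -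
   \sum_(m < k.+1) \sum_(r < m.+1) xterm i j r.+1 (t, s) * dterm e j (m - r) (t, s))); last ring.
rewrite -EP; congr (_ * _ + (_ * _ - _)); rewrite fct_sumE//.
by apply: eq_bigr => m _; rewrite fct_sumE.
Qed.

Variable x : R -> 'M[R]_(k.+1, n).
Hypothesis Hx : forall m e, caratheodory a b (fun t => x t m e)
  (fun t => \sum_i du t i * adapted_field (phi t) (M t) (xi t) i (x t) m e).

Let cx m e : ccont a b (fun t => x t m e).
Proof. exact: ac_continuous (Hx m e).1. Qed.

Definition jet_fun e z := (jet_poly (x z.1) e).[z.2].
Definition unadapt_fun d z := (unadapt (phi z.1) (M z.1) (x z.1) d).[z.2].

Lemma uniform_O_cpoly p : cpoly a b p -> (forall t, (p t)`_0 = 0) ->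
  uniform_O D 1 (fun z => (p z.1).[z.2]).
Proof.
move=> cp p0; have := cpoly_truncate 1 cp.
by apply: uniform_O_eq => t s _; rewrite big_ord1 p0 mul0r subr0.
Qed.

Lemma uniform_O_jet e : uniform_O D 1 (jet_fun e).
Proof.
apply: (uniform_O_cpoly (p := fun t => jet_poly (x t) e)) => [|t].
  exact: jet_poly_cpoly.
exact: jet_poly_ord.
Qed.

Lemma uniform_O_unadapt d : uniform_O D 1 (unadapt_fun d).
Proof.
apply: (uniform_O_cpoly (p := fun t => unadapt (phi t) (M t) (x t) d)) => [|t].
  by apply: unadapt_cpoly => //; exact: cx.
exact: unadapt_ord.
Qed.

Let Mz d e (z : R * R) := M z.1 d e.
Let hz e m s (z : R * R) := high_part (phi z.1 e) m s.

Let uniform_O_M d e : uniform_O D 0 (Mz d e).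
Proof. exact: (uniform_O_ccont (@cM d e)). Qed.

Let uniform_O_high e m s : uniform_O D 0 (hz e m s).
Proof.
rewrite /hz /high_part; case: (m < 2)%N; first exact: (filt0 FO 0).
exact: (@uniform_O_taylor (fun t => phi t e) m s (@cphi e)).
Qed.

(** Removing the part of degree at least 2 from F_t(b) leaves Phi^(1) b, which M inverts: the
    displacement is an exact fixed point for its exact adapted coordinates. *)
Lemma beta_fixpoint t s d : a <= t <= b ->
  beta (t, s) d = step k.+2 Mz hz adapted_pos bt d (t, s).
Proof.
move=> tab; rewrite step_eval /step.
under eq_bigr => e _ do
  rewrite /adapted_pos (@pform_pos_part _ _ _ idfun) // addrK mulr_sumr.
rewrite exchange_big /=.
have E j : \sum_e Mz d e (t, s) * (beta (t, s) j * phi t e [:: j]) = beta (t, s) j * (d == j)%:R.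
  by rewrite -(HM tab) mulr_sumr; apply: eq_bigr => e _; rewrite mulrCA.
under eq_bigr => j _ do rewrite E.
by rewrite (bigD1 d)//= eqxx mulr1 big1 ?addr0// => j /negbTE; rewrite eq_sym => ->; rewrite mulr0.
Qed.

(** An exact fixed point is compared with iterates for data that agree to order r + 1; k + 1
    iterations suffice since r <= k + 1. *)
Lemma beta_unadapt r : (r <= k.+1)%N ->
  (forall e, uniform_O D r.+1 (fun z => adapted_pos e z - jet_fun e z)) ->
  forall d, uniform_O D r.+1 (fun z => beta z d - unadapt_fun d z).
Proof.
move=> rk H d.
have HC01 e m s : (m < 2)%N -> hz e m s = 0 by rewrite /hz /high_part => ->.
have Hfix j : uniform_O D r.+1 (bt j - step k.+2 Mz hz adapted_pos bt j).
  apply: uniform_O_eq (filt0 FO r.+1) => t s tab.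
  by apply/esym/eqP; rewrite subr_eq0; apply/eqP/beta_fixpoint.
have := filt_iter_fixpoint FO uniform_O_M uniform_O_high HC01 uniform_O_jet beta1 Hfix H k.+1 d.
rewrite (minn_idPr rk); apply: uniform_O_eq => t s _; congr (_ - _).
rewrite iter_step_eval /unadapt_fun unadapt_horner; congr (iter _ (step _ _ _ _) _ _).
Qed.

Lemma uniform_O_control r : (r <= k)%N ->
  (forall d, uniform_O D r.+1 (fun z => beta z d - unadapt_fun d z)) ->
  forall e i, uniform_O D r.+1 (fun z => control_part e i z -
    \sum_(m < k.+1) (field_poly (phi z.1) (xi z.1) k.+1
       (unadapt (phi z.1) (M z.1) (x z.1)) i e)`_m * z.2 ^+ m).
Proof.
move=> rk H e i.
have Hp j := uniform_O_pform_sub k.+1 (c := fun t c => phi t e (j :: c)) (fun s => @cphi e (j :: s))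
  uniform_O_unadapt H.
have HX j := uniform_O_pform_sub k.+1 (c := fun t => xi t i j) (fun s => @cxi i j s)
  uniform_O_unadapt H.
have rk1 : (r.+1 <= k.+1)%N by [].
have rk2 : (r.+1 <= k.+2)%N by exact: ltnW.
pose P j z := pform k.+1 (taylor_coef (xi z.1 i j)) (fun d => unadapt_fun d z).
pose Q j z := pform k.+1 (taylor_coef (fun c => phi z.1 e (j :: c))) (fun d => unadapt_fun d z).
have HP j : uniform_O D 0 (P j).
  have := @filt_pform _ n _ FO k.+1 (fun m s z => taylor_coef (xi z.1 i j) m s) unadapt_fun
    (fun m s => uniform_O_taylor m s (fun s => @cxi i j s)) (fun d => filtS FO (uniform_O_unadapt d)).
  by apply: uniform_O_eq => t s _; rewrite pform_eval.
have HYP j : uniform_O D r.+1 (fun z => Y i z j - P j z).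
  have Hw := @filt_pform_widen _ n _ FO k.+1 k.+2 (fun m s z => taylor_coef (xi z.1 i j) m s) bt
    (fun m s => uniform_O_taylor m s (fun s => @cxi i j s)) beta1 (leqnSn _).
  have := filtD FO (filt_le FO rk2 (HY i j)) (filtD FO (filt_le FO rk1 Hw) (HX j)).
  apply: uniform_O_eq => t s _.
  rewrite -[RHS](subrKA (pform k.+2 (taylor_coef (xi t i j)) (beta (t, s)))).
  congr (_ + _); rewrite -[RHS](subrKA (pform k.+1 (taylor_coef (xi t i j)) (beta (t, s)))).
  by congr (_ - _ + _); exact: pform_eval.
have Hd j := filtD FO (filtMr FO (HYP j) (uniform_O_dsum e j)) (filtM FO (HP j) (Hp j)).
have Hs := filt_sum FO (index_enum _) (P := xpredT) (fun j _ => Hd j).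
have Ht := cpoly_truncate k.+1 (field_poly_cpoly cphi cM cxi cx i e).
have := filtD FO Hs (filt_le FO rk1 Ht).
apply: uniform_O_eq => t s _; rewrite -[RHS](subrKA (\sum_j P j (t, s) * Q j (t, s))).
congr (_ + _).
  rewrite fct_sumE /control_part -sumrB; apply: eq_bigr => j _.
  transitivity ((Y i (t, s) j - P j (t, s)) * (\sum_(p < k.+1) dterm e j p (t, s)) +
    P j (t, s) * ((\sum_(p < k.+1) dterm e j p (t, s)) - Q j (t, s))); last ring.
  by [].
congr (_ - _); rewrite /field_poly horner_sum; apply: eq_bigr => j _.
by rewrite hornerM !pform_horner mulrC.
Qed.

Lemma car_jet_fun s e : caratheodory a b (fun t => jet_fun e (t, s))
  (fun t => \sum_i du t i * (s * \sum_(m < k.+1) (field_poly (phi t) (xi t) k.+1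
       (unadapt (phi t) (M t) (x t)) i e)`_m * s ^+ m)).
Proof.
have H := car_sum (index_enum _) (P := xpredT) (fun (m : 'I_k.+1) _ => carZr (s ^+ m.+1) (Hx m e)).
apply: car_eqf (car_eq _ H) => t _.
  rewrite /jet_fun /jet_poly horner_sum; apply: eq_bigr => m _.
  by rewrite hornerM hornerXn hornerC.
under eq_bigr => m _ do rewrite /GRing.scale /= mulr_sumr.
rewrite exchange_big; apply: eq_bigr => i _; rewrite !mulr_sumr; apply: eq_bigr => m _.
by rewrite mxE exprS; ring.
Qed.

Hypothesis init : forall e, uniform_O D k.+2 (fun z => adapted_pos e (a, z.2) - jet_fun e (a, z.2)).

(** Induction on r. Both terms are O(s) at the start; in the step, the factor s in front of the
    control part provides the gained order, and the drift is already of order k + 2. *)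
Lemma adapted_expansion r e : (r <= k.+1)%N ->
  uniform_O D r.+1 (fun z => adapted_pos e z - jet_fun e z).
Proof.
elim: r e => [|r IH] e rk.
  apply: (filtB FO) (uniform_O_jet e).
  have HC m c : uniform_O D 0 (fun z => pos_part (taylor_coef (phi z.1 e)) m c).
    by case: m => [|m]; [exact: (filt0 FO)|exact: (uniform_O_taylor _ _ (@cphi e))].
  have H0 m c : (m < 1)%N -> (fun z : R * R => pos_part (taylor_coef (phi z.1 e)) m c) = 0.
    by case: m.
  have := @filt_pform_ord _ n _ FO k.+2 1 (fun m c z => pos_part (taylor_coef (phi z.1 e)) m c) bt
    HC H0 beta1.
  by apply: uniform_O_eq => t s _; rewrite pform_eval.
have {}IH := beta_unadapt (ltnW rk) (fun e => IH e (ltnW rk)).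
have HG i := filtM FO (uniform_O_s D) (uniform_O_control rk IH e i).
(* Drift terms are driven by u and control terms by du; the disjoint union presents them as one
   family with the common majorant w. *)
pose E' (ii : 'I_l + 'I_l) : R * R -> R := match ii with
  | inl i => drift_error e i
  | inr i => fun z => z.2 * (control_part e i z -
    \sum_(m < k.+1) (field_poly (phi z.1) (xi z.1) k.+1
       (unadapt (phi z.1) (M z.1) (x z.1)) i e)`_m * z.2 ^+ m) end.
apply: (@uniform_O_integrate _ a b _ W w
  (fun t ii => match ii with inl i => u t i | inr i => du t i end) E') => //.
- by move=> t [i|i].
- move=> [i|i]; last exact: HG.
  exact (filt_le FO (rk : (r.+2 <= k.+2)%N) (uniform_O_drift e i)).
- have [d d0 Hd] := Hbeta; exists d => // s sd.
  have C1 := @car_adapted_pos s e (ex_intro2 _ _ d sd Hd).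
  have := carB C1 (car_jet_fun s e); apply: car_eq => t _.
  rewrite big_sumType /= -big_split -sumrB; apply: eq_bigr => i _ /=; ring.
- exact (filt_le FO (rk : (r.+2 <= k.+2)%N) (init e)).
Qed.

Lemma unadapt_expansion d : uniform_O D k.+2 (fun z => beta z d - unadapt_fun d z).
Proof. by apply: beta_unadapt => // e; exact: adapted_expansion. Qed.

End Bootstrap.

(** * Adapted coordinates and jets *)

Section MultilinearMaps.
Variables (R : realType) (n : nat).
Local Notation V := 'rV[R]_n.
Local Notation iterD := Defs.iterD.

Lemma multilinear_slot m (F : ('I_m -> V) -> V) us w ws : multilinear F ->
  size (us ++ w :: ws) = m ->
  F (args (us ++ w :: ws)) = \sum_j w ord0 j *: F (args (us ++ delta_mx ord0 j :: ws)).
Proof.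
move=> lF sm.
have us_m : (size us < m)%N by rewrite -sm size_cat /= -addSnnS leq_addr.
pose i0 := Ordinal us_m.
pose put (x : V) := fun i : 'I_m => if i == i0 then x else args (us ++ 0 :: ws) i.
have E x : args (us ++ x :: ws) = put x.
  apply/funext => i; rewrite /put /args; case: eqP => [->|ne].
    by rewrite nth_cat ltnn subnn.
  rewrite !nth_cat; case: ltnP => // ui.
  have : (i : nat) != size us by apply: contra_not_neq ne => ei; exact/val_inj.
  by rewrite neq_ltn ltnNge ui /= -subn_gt0; case: (i - size us)%N.
have lin c x y : F (put (c *: x + y)) = c *: F (put x) + F (put y).
  exact: (lF (args (us ++ 0 :: ws)) i0 c x y).
have F0 : F (put 0) = 0.
  have := lin (-1) 0 0; rewrite scaler0 addr0 scaleN1r addNr; exact.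
rewrite E [X in put X](row_sum_delta w).
rewrite (_ : \sum_j w ord0 j *: F _ = \sum_j w ord0 j *: F (put (delta_mx ord0 j))); last first.
  by apply: eq_bigr => j _; rewrite E.
elim: (index_enum _) => [|j r IH]; first by rewrite !big_nil.
by rewrite !big_cons lin IH.
Qed.

Lemma multilinear_mform m (F : ('I_m -> V) -> V) us ws e : multilinear F ->
  size (us ++ ws) = m ->
  F (args (us ++ ws)) ord0 e =
  mform (fun a => F (args (us ++ basis_seq R a)) ord0 e) [seq coords w | w <- ws].
Proof.
move=> lF; elim: ws us => [|w ws IH] us sm //=.
rewrite multilinear_slot// summxE; apply: eq_bigr => j _.
have sr : size (rcons us (delta_mx ord0 j) ++ ws) = m by rewrite cat_rcons -sm !size_cat.
rewrite mxE -cat_rcons (IH _ sr); congr (_ * _); apply: eq_mform => a _.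
by rewrite cat_rcons.
Qed.

(** All degrees in one function: the length of s selects Phi^(m). The empty sequence gets 0, in
    place of a form of degree 0. *)
Definition coef_fun (Phi : coefs R n) (t : R) (e : 'I_n) (s : seq 'I_n) : R :=
  if s is [::] then 0 else Phi (size s) t (args (basis_seq R s)) ord0 e.

Lemma coef_fun_mform (Phi : coefs R n) t e m vs : size vs = m -> (0 < m)%N ->
  multilinear (Phi m t) ->
  Phi m t (args vs) ord0 e = mform (coef_fun Phi t e) [seq coords v | v <- vs].
Proof.
move=> sm m0 lF; rewrite (multilinear_mform (us := [::]) e lF)//.
apply: eq_mform => a; rewrite size_map sm; case: a => [m0'|j a <-//].
by rewrite -m0' in m0.
Qed.

(** Translates invariance under permutations of the slots into invariance under [perm_eq] of index
    sequences. *)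
Lemma coef_fun_symmetric (Phi : coefs R n) t e :
  (forall m, (0 < m)%N -> symmetric_map (Phi m t)) -> symmetric_coef (coef_fun Phi t e).
Proof.
move=> sF a a' aa; have sa := perm_size aa.
case: a aa sa => [|j a] aa sa; first by case: a' sa {aa}.
case: a' aa sa => // j' a' aa sa; rewrite /coef_fun sa.
move: (j :: a) (j' :: a') sa aa (isT : (0 < size (j' :: a'))%N) => {j a j' a'} a a' sa aa a'0.
have /tuple_permP[p Ep] : perm_eq (tcast sa (in_tuple a)) (in_tuple a').
  by rewrite val_tcast.
rewrite -(sF _ a'0 p (args (basis_seq R a'))); congr (Phi _ t _ ord0 e).
have {}Ep : a = [seq tnth (in_tuple a') (p i) | i <- enum 'I_(size a')].
  by rewrite -[LHS](val_tcast sa (in_tuple a)) Ep.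
apply/funext => i; rewrite /args /= [in LHS]Ep /basis_seq -map_comp.
rewrite (nth_map i) ?size_enum_ord// nth_ord_enum /=.
rewrite (nth_map (tnth (in_tuple a') i)) ?ltn_ord//; congr delta_mx.
exact: tnth_nth.
Qed.

(** Identifies [Psi] with the polynomial F_t evaluated on the jet, so that the filtered algebra
    applies to it. *)
Lemma Psi_coef_fun k (Phi : coefs R n) t (b : 'M[R]_(k, n)) (m : 'I_k) e :
  (forall m, (0 < m)%N -> multilinear (Phi m t) /\ symmetric_map (Phi m t)) ->
  Psi Phi t b m e =
  (pform k.+1 (fun m => polyc (pos_part (taylor_coef (coef_fun Phi t e)) m))
    (jet_poly b))`_m.+1.
Proof.
move=> HF.
rewrite (@pform_multinomial _ _ _ (coef_fun Phi t e) (fun i j => b i j)); last first.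
  by apply: coef_fun_symmetric => m' m'0; exact: (HF _ m'0).2.
rewrite mxE summxE; apply: eq_bigr => al /eqP al_m; rewrite mxE natr_prod; congr (_^-1 * _).
set vs := flatten _.
have sv : size vs = (\sum_i al i)%N.
  rewrite /vs size_flatten /shape -map_comp sumnE big_map big_enum /=.
  by apply: eq_bigr => i _; rewrite size_nseq.
have v0 : (0 < size vs)%N.
  by rewrite sv lt0n; apply/negP => /weight_eq0; rewrite al_m.
rewrite -sv coef_fun_mform//; last exact: (HF _ v0).1.
rewrite /vs map_flatten -map_comp; congr (mform _ (flatten _)); apply: eq_map => i /=.
by rewrite map_nseq; congr nseq; apply/funext => j; rewrite /coords mxE.
Qed.

Lemma adapted_rhs_mform (U : set V) (Phi : coefs R n) m t (F : V -> V) y b e :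
  open U -> smooth_on U F -> U y ->
  (forall m, (0 < m)%N -> multilinear (Phi m t)) ->
  adapted_rhs Phi m t F y b ord0 e =
  \sum_(r < m) 'C(m, r.+1)%:R * mform (coef_fun Phi t e)
    ((fun j => mform (jet_coef F y j) (nseq r.+1 (coords b))) :: nseq (m - r.+1) (coords b)).
Proof.
move=> oU sF Uy lF; rewrite /adapted_rhs summxE big_add1 /= big_mkord.
apply: eq_bigr => r _; rewrite mxE; congr (_ * _).
set vs := _ :: _; have sv : size vs = (m - r.+1).+1 by rewrite /= size_nseq.
rewrite (coef_fun_mform e sv)//; last exact: lF.
have -> : [seq coords v | v <- vs] =
    (fun j => mform (jet_coef F y j) (nseq r.+1 (coords b))) :: nseq (m - r.+1) (coords b).
  rewrite map_cons map_nseq; congr (_ :: _); apply/funext => j.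
  exact: (iterD_nseq r.+1 b j oU sF Uy).
by [].
Qed.

Lemma adapted_rhs_polyfun (U : set V) (Phi : coefs R n) m t (F : V -> V) y e :
  open U -> smooth_on U F -> U y ->
  (forall m, (0 < m)%N -> multilinear (Phi m t)) ->
  polyfun (fun b : V => adapted_rhs Phi m t F y b ord0 e).
Proof.
move=> oU sF Uy lF; under eq_fun => b do rewrite (adapted_rhs_mform m b e oU sF Uy lF).
apply: polyfun_sum => r _; apply: polyfunM; first exact: polyfun_cst.
apply: polyfun_sum => j _; apply: polyfunM; exact: polyfun_mform.
Qed.

End MultilinearMaps.

Section CoefficientEquation.
Variables (R : realType) (n l : nat) (a b : R).
Local Notation V := 'rV[R]_n.
Variables (U : set V) (X : 'I_l -> V -> V) (y : R -> V) (u : R -> 'rV[R]_l) (Phi : coefs R n).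
Hypothesis oU : open U.
Hypothesis sX : forall i, smooth_on U (X i).
Hypothesis yU : forall t, a <= t <= b -> U (y t).
Hypothesis HF : forall m t, (0 < m)%N -> a <= t <= b ->
  multilinear (@Phi m t) /\ symmetric_map (@Phi m t).
Hypothesis CF : forall m, (0 < m)%N -> forall v : V, caratheodory a b
  (fun t => @Phi m t (fun=> v))
  (fun t => - \sum_(i < l) u t ord0 i *: adapted_rhs Phi m t (X i) (y t) v).

Let rhs m e t v := (- \sum_(i < l) u t ord0 i *: adapted_rhs Phi m t (X i) (y t) v) ord0 e.

Let lF t : a <= t <= b -> forall m, (0 < m)%N -> multilinear (@Phi m t).
Proof. by move=> tab m m0; exact: (HF m0 tab).1. Qed.

Let rhsE m e t v : a <= t <= b -> rhs m e t v =
  - \sum_i u t ord0 i * \sum_(r < m) 'C(m, r.+1)%:R * mform (coef_fun Phi t e)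
    ((fun j => mform (jet_coef (X i) (y t) j) (nseq r.+1 (coords v))) :: nseq (m - r.+1) (coords v)).
Proof.
move=> tab; rewrite /rhs mxE summxE; congr (- _); apply: eq_bigr => i _; rewrite mxE; congr (_ * _).
exact: (adapted_rhs_mform m v e oU (sX i) (yU tab) (lF tab)).
Qed.

Lemma coef_fun_symmetric_itv t e : a <= t <= b -> symmetric_coef (coef_fun Phi t e).
Proof. by move=> tab; apply: coef_fun_symmetric => m m0; exact: (HF m0 tab).2. Qed.

Lemma car_coef_fun_diag m e v : (0 < m)%N ->
  caratheodory a b (fun t => mform (coef_fun Phi t e) (nseq m (coords v))) (rhs m e ^~ v).
Proof.
move=> m0; have /car_mxP/(_ ord0 e) := CF m0 v; apply: car_eqf => t tab.
rewrite (_ : (fun=> v) = args (nseq m v) :> ('I_m -> V)); last first.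
  by apply/funext => i; rewrite /args nth_nseq ltn_ord.
by rewrite (coef_fun_mform e (size_nseq m v) m0 (lF tab m0)) map_nseq.
Qed.

Definition coef_deriv t e (s : seq 'I_n) : R :=
  if s is [::] then 0 else polarize (size s) (rhs (size s) e) t s.

Lemma car_coef_fun e s :
  caratheodory a b (fun t => coef_fun Phi t e s) (fun t => coef_deriv t e s).
Proof.
case: s => [|j s]; first exact: car_cst.
apply: (@car_polarize _ _ (size (j :: s)) a b (fun t => coef_fun Phi t e)) => //.
- by move=> t tab; exact: coef_fun_symmetric_itv.
- by move=> v; exact: car_coef_fun_diag.
Qed.

(** One null set serves all v, all components and the finitely many degrees in play, so v may later
    depend on t and s. *)
Lemma coef_fun_ode k : {ae lebesgue_measure, forall t, a < t < b -> forall e (m : 'I_k) v,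
  mform (coef_deriv t e) (nseq m.+1 v) = - \sum_i u t ord0 i * \sum_(r < m.+1) 'C(m.+1, r.+1)%:R *
    mform (coef_fun Phi t e)
      ((fun j => mform (jet_coef (X i) (y t) j) (nseq r.+1 v)) :: nseq (m - r) v)}.
Proof.
suff H (em : 'I_n * 'I_k) : {ae lebesgue_measure, forall t, a < t < b -> forall v : V,
    mform (polarize em.2.+1 (rhs em.2.+1 em.1) t) (nseq em.2.+1 (coords v)) = rhs em.2.+1 em.1 t v}.
  apply: filterS (ae_forall_fin H) => t Ht tab e m v.
  have Dt : a <= t <= b by case/andP: tab => ? ?; rewrite !ltW.
  have -> : v = coords (\row_j v j) by apply/funext => j; rewrite /coords mxE.
  have := Ht (e, m) tab (\row_j v j); rewrite rhsE// => <-.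
  by apply: eq_mform => -[//|j s]; rewrite size_nseq /= => -[<-].
apply: (@polarize_diag _ _ em.2.+1 a b (fun t => coef_fun Phi t em.1)).
- by move=> t tab; exact: coef_fun_symmetric_itv.
- by move=> v; exact: car_coef_fun_diag.
- move=> t /andP[ta tb]; have Dt : a <= t <= b by rewrite !ltW.
  rewrite (_ : rhs _ _ t = fun v => \sum_i (- u t ord0 i) * adapted_rhs Phi em.2.+1 t (X i) (y t) v ord0 em.1).
    apply: polyfun_sum => i _; apply: polyfunM; first exact: polyfun_cst.
    exact: (adapted_rhs_polyfun _ _ oU (sX i) (yU Dt) (lF Dt)).
  apply/funext => v; rewrite /rhs mxE summxE -sumrN; apply: eq_bigr => i _.
  by rewrite mxE mulNr.
Qed.

End CoefficientEquation.

(** * Expansions in s at a fixed time, and jets of curves *)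

Section Expansions.
Variables (R : realType) (n : nat).
Local Notation V := 'rV[R]_n.
Local Notation D0 := [set t : R | 0 <= t <= 0].
Let FO := uniform_O_filtration D0.

(** At a fixed time, estimates are kept in the same formalism over the one-point set [D0], the first
    variable being a dummy. *)
Lemma uniform_O_slice (D : set R) N (f : R * R -> R) t : D t -> uniform_O D N f ->
  uniform_O D0 N (fun z => f (t, z.2)).
Proof. by move=> Dt [C [d [C0 d0 d1 H]]]; exists C, d; split => // t0 s _; exact: H. Qed.

Lemma uniform_O_cst (c : R) : uniform_O D0 0 (fun=> c).
Proof. by apply: (@uniform_O_bounded _ _ (fun=> c)); exists `|c|. Qed.

(** The remainder is O(s^(K+1)) instead of the o(s^K) of a jet: it fits the filtration and is kept
    by composition with smooth maps. *)
Definition expands K (f : R -> V) (b : 'M[R]_(K, n)) : Prop :=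
  forall e, uniform_O D0 K.+1 (fun z => f z.2 ord0 e - (jet_poly b e).[z.2]).

Lemma poly_truncate (p : {poly R}) N :
  uniform_O D0 N (fun z => p.[z.2] - \sum_(m < N) p`_m * z.2 ^+ m).
Proof.
apply: (@cpoly_truncate _ 0 0 (fun=> p)); split; first by exists (size p).
by move=> m; exact: ccont_cst.
Qed.

Lemma poly_uniform_O (p : {poly R}) N : poly_ord N p -> uniform_O D0 N (fun z => p.[z.2]).
Proof.
move=> pN; apply: uniform_O_eq (poly_truncate p N) => t s _.
by rewrite big1 ?subr0// => m _; rewrite pN ?mul0r.
Qed.

Lemma horner_jet_poly K (b : 'M[R]_(K, n)) e s :
  (jet_poly b e).[s] = \sum_(m < K) b m e * s ^+ m.+1.
Proof.
rewrite /jet_poly horner_sum; apply: eq_bigr => m _.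
by rewrite hornerM hornerXn hornerC mulrC.
Qed.

Definition poly_jet K (p : 'I_n -> {poly R}) : 'M[R]_(K, n) := \matrix_(m, e) (p e)`_m.+1.

Lemma expands_poly K (f : R -> V) (p : 'I_n -> {poly R}) : (forall e, (p e)`_0 = 0) ->
  (forall e, uniform_O D0 K.+1 (fun z => f z.2 ord0 e - (p e).[z.2])) ->
  expands f (poly_jet K p).
Proof.
move=> p0 H e; have := filtD FO (H e) (poly_truncate (p e) K.+1).
apply: uniform_O_eq => t s _; rewrite -[RHS](subrKA (p e).[s]); congr (_ + (_ - _)).
rewrite horner_jet_poly big_ord_recl p0 mul0r add0r.
by apply: eq_bigr => m _; rewrite mxE.
Qed.

Lemma poly_jet_ord K (p : 'I_n -> {poly R}) e : (p e)`_0 = 0 ->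
  poly_ord K.+1 (p e - jet_poly (poly_jet K p) e).
Proof.
move=> p0 [|m] mK; rewrite coefB; last first.
  by have := coef_jet_poly (poly_jet K p) e (Ordinal (mK : (m < K)%N)); rewrite mxE => ->; rewrite subrr.
by rewrite p0 (@jet_poly_ord _ _ _ _ _ 0)// subrr.
Qed.

Section Expansion.
Variables (K : nat) (f : R -> V) (b : 'M[R]_(K, n)).
Hypothesis Hf : expands f b.

Let fO1 e : uniform_O D0 1 (fun z => f z.2 ord0 e).
Proof.
have := filtD FO (filt_le FO (ltn0Sn K) (Hf e)) (poly_uniform_O (@jet_poly_ord _ _ _ b e)).
by apply: uniform_O_eq => t s _; exact: subrK.
Qed.

Lemma expands_norm : exists C d : R, [/\ 0 <= C, 0 < d, d <= 1 &
  forall s, `|s| <= d -> `|f s| <= C * `|s|].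
Proof.
have [C [d [C0 d0 d1 H]]] := @filt_sum _ _ FO 'I_n (index_enum _) xpredT
  (fun e z => `|f z.2 ord0 e|) 1 (fun e _ => uniform_O_norm (fO1 e)).
exists C, d; split => // s sd; apply: mx_norm_le; first by rewrite mulr_ge0.
move=> i e; rewrite ord1; have := H 0 s _ sd; rewrite /= lexx fct_sumE ger0_norm ?sumr_ge0//.
by move=> /(_ isT); apply: le_trans; rewrite (bigD1 e)//= lerDl sumr_ge0.
Qed.

Lemma expands_pform N (C : nat -> seq 'I_n -> R) : uniform_O D0 K.+1 (fun z =>
  pform N C (coords (f z.2)) - (pform N (fun m => polyc (C m)) (jet_poly b)).[z.2]).
Proof.
have := @filt_pform_sub _ n _ FO N (fun m s z => C m s) (fun j z => f z.2 ord0 j)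
  (fun j z => (jet_poly b j).[z.2]) 1 K.+1 0 (fun m s => uniform_O_cst _) fO1
  (fun j => poly_uniform_O (@jet_poly_ord _ _ _ b j)) (fun m s => ltac:(by [])) Hf.
rewrite addn0; apply: uniform_O_eq => t s _; rewrite pform_horner.
by congr (_ - _); exact: pform_eval.
Qed.

Lemma pform_poly0 N (C : nat -> seq 'I_n -> R) (p : 'I_n -> {poly R}) :
  (forall e, (p e)`_0 = 0) -> (pform N.+1 (fun m => polyc (C m)) p)`_0 = C 0%N [::].
Proof.
move=> p0; rewrite -horner_coef0 pform_horner /pform big_ord_recl /= big1 ?addr0// => m _.
by rewrite big1// => j _; rewrite horner_coef0 p0 mul0r.
Qed.

(** The Taylor polynomial of F at y is composed with the expansion of f; the tube estimate is used
    on a constant curve. *)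
Lemma expands_smooth (U : set V) (F : V -> V) y : open U -> smooth_on U F -> U y ->
  exists b', expands (K := K) (fun s => F (y + f s) - F y) b'.
Proof.
move=> oU sF Uy.
have [r [r0 r1 [C [C0 H]]]] := @taylor_tube _ _ U F (fun=> y) 0 0 K.+1 (lexx 0)
  (fun x => cvg_cst _) oU sF (fun _ _ => Uy).
have [C' [d [C'0 d0 d1 Hd]]] := expands_norm.
pose p e := pform K.+1 (fun m => polyc (taylor_coef (jet_coef F y e) m)) (jet_poly b)
  - (F y ord0 e)%:P.
have j0 e : (jet_poly b e)`_0 = 0 by rewrite (@jet_poly_ord _ _ _ _ _ 0).
exists (poly_jet K p); apply: expands_poly => e.
  by rewrite coefB coefC pform_poly0// /taylor_coef invr1 mul1r subrr.
have HT : uniform_O D0 K.+1 (fun z => F (y + f z.2) ord0 e -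
    pform K.+1 (taylor_coef (jet_coef F y e)) (coords (f z.2))).
  (* The radius r / (C' + 1) keeps |f s| <= C' |s| within the range r of the Taylor estimate. *)
  exists (C * C' ^+ K.+1), (Num.min d (r / (C' + 1))).
  have C'1 : 0 < C' + 1 by rewrite ltr_wpDl.
  split => //; first by rewrite mulr_ge0 ?exprn_ge0// ltW.
  - by rewrite lt_min d0 divr_gt0.
  - by rewrite ge_min d1.
  move=> t s _; rewrite le_min => /andP[sd sr].
  have fs := Hd s sd.
  have fr : `|f s| <= r.
    rewrite (le_trans fs)// -[leRHS](divfK (lt0r_neq0 C'1)) mulrC.
    by rewrite ler_pM// lerDl.
  have z0 : 0 <= (0 : R) <= 0 by rewrite lexx.
  have [_ /(_ e) Hs] := H 0 (f s) z0 fr; rewrite (le_trans Hs)//.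
  by rewrite -mulrA ler_wpM2l ?(ltW C0)// -exprMn ler_pXn2r// nnegrE// mulr_ge0.
have := filtD FO HT (expands_pform K.+1 (taylor_coef (jet_coef F y e))).
apply: uniform_O_eq => t s _; rewrite !mxE /p hornerD hornerN hornerC.
rewrite -[RHS](subrKA (pform K.+1 (taylor_coef (jet_coef F y e)) (coords (f s)))).
rewrite /=; transitivity ((F (y + f s) ord0 e - pform K.+1 (taylor_coef (jet_coef F y e)) (coords (f s))) +
  (pform K.+1 (taylor_coef (jet_coef F y e)) (coords (f s)) -
  (pform K.+1 (fun m => polyc (taylor_coef (jet_coef F y e) m)) (jet_poly b)).[s])) => //; ring.
Qed.

End Expansion.

Section Adapted.
Variables (K : nat) (Phi : coefs R n) (t : R).
Hypothesis HF : forall m, (0 < m)%N -> multilinear (@Phi m t) /\ symmetric_map (@Phi m t).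

Lemma expands_Psi (f : R -> V) (b : 'M[R]_(K, n)) e : expands f b ->
  uniform_O D0 K.+1 (fun z =>
    pform K.+1 (pos_part (taylor_coef (coef_fun Phi t e))) (coords (f z.2)) -
    (jet_poly (Psi Phi t b) e).[z.2]).
Proof.
move=> Hf.
pose C := pos_part (taylor_coef (coef_fun Phi t e)).
pose p := pform K.+1 (fun m => polyc (C m)) (jet_poly b).
have j0 e' : (jet_poly b e')`_0 = 0 by rewrite (@jet_poly_ord _ _ _ _ _ 0).
have p0 : p`_0 = 0 by rewrite pform_poly0.
have := filtD FO (expands_pform Hf K.+1 C) (poly_truncate p K.+1).
apply: uniform_O_eq => t' s _; rewrite -[RHS](subrKA p.[s]); congr (_ + (_ - _)).
rewrite horner_jet_poly big_ord_recl p0 mul0r add0r.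
by apply: eq_bigr => m _; rewrite (Psi_coef_fun b m e HF).
Qed.

Variable M : 'I_n -> 'I_n -> R.
Hypothesis HM : forall j d, \sum_e coef_fun Phi t j [:: e] * M e d = (j == d)%:R.

(** [unadapt x] may have powers beyond k + 1; dropping them changes F_t of it only from order k + 2
    on, beyond the coefficients that [Psi] reads. *)
Lemma Psi_unadapt k (x : 'M[R]_(k.+1, n)) :
  Psi Phi t (poly_jet k.+1 (unadapt (coef_fun Phi t) M x)) = x.
Proof.
set ua := unadapt _ _ _.
have ua0 e : (ua e)`_0 = 0 by exact: (@unadapt_ord _ _ _ _ _ _ _ 0).
apply/matrixP => m e; rewrite (Psi_coef_fun _ m e HF).
have FX := poly_filtration R.
have H1 := @adapt_unadapt _ _ (coef_fun Phi t) M HM k x e.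
have H2 := @filt_pform_sub _ n _ FX k.+2
  (fun m => polyc (pos_part (taylor_coef (coef_fun Phi t e)) m)) ua
  (jet_poly (poly_jet k.+1 ua)) 1 k.+2 0 (fun _ _ => @poly_ord0 _ _)
  (fun j => @unadapt_ord _ _ _ _ _ x j) (fun j => @jet_poly_ord _ _ _ _ j) (fun m s => ltac:(by []))
  (fun j => @poly_jet_ord k.+1 ua j (ua0 j)).
rewrite addn0 in H2.
have mk : (m.+1 < k.+2)%N by rewrite ltnS ltn_ord.
by rewrite -(poly_ord_sub H2 mk) /ua (poly_ord_sub H1 mk) coef_jet_poly.
Qed.

Lemma expands_unadapt k (f : R -> V) (x : 'M[R]_(k.+1, n)) :
  (forall d, uniform_O D0 k.+2
     (fun z => f z.2 ord0 d - (unadapt (coef_fun Phi t) M x d).[z.2])) ->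
  expands f (poly_jet k.+1 (unadapt (coef_fun Phi t) M x)).
Proof. by move=> H; apply: expands_poly => // e; exact: (@unadapt_ord _ _ _ _ _ _ _ 0). Qed.

End Adapted.

Lemma near0_le (e : R) : 0 < e -> \forall s \near (0 : R), `|s| <= e.
Proof.
move=> e0; apply/nbhs_ballP; exists e => //= s; rewrite /ball /= sub0r normrN; exact: ltW.
Qed.

Section StrongJets.
Variable M : topologicalType.

Definition strong_jet (c : chart R M n) K (gamma : R -> M) (b : 'M[R]_(K, n)) : Prop :=
  (exists2 d : R, 0 < d & forall s, `|s| <= d -> cdom c (gamma s)) /\
  expands (fun s => cmap c (gamma s) - cmap c (gamma 0)) b.

Lemma strong_jet_is_jet (c : chart R M n) K gamma (b : 'M[R]_(K, n)) :
  strong_jet c gamma b -> is_jet c gamma b.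
Proof.
move=> [[d d0 Hd] Hb]; split.
  by near=> s; apply: Hd; near: s; exact: near0_le.
have [C [d' [C0 d'0 d'1 H]]] := @filt_sum _ _ FO 'I_n (index_enum _) xpredT
  (fun e z => `|(cmap c (gamma z.2) - cmap c (gamma 0)) ord0 e - (jet_poly b e).[z.2]|) K.+1
  (fun e _ => uniform_O_norm (Hb e)).
apply/eqoP => e e0; near=> s.
have sd : `|s| <= d' by near: s; exact: near0_le.
have se : `|s| <= e / (C + 1).
  near: s; apply: near0_le.
  by rewrite divr_gt0// ltr_wpDl.
have /= := H 0 s _ sd; rewrite lexx => /(_ isT); rewrite fct_sumE ger0_norm ?sumr_ge0// => Hs.
apply: mx_norm_le; first by rewrite mulr_ge0// ltW.
move=> i a; rewrite ord1.
have -> : (cmap c (gamma s) - (cmap c (gamma 0) + \sum_(i < K) s ^+ i.+1 *: row i b)) ord0 a =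
   (cmap c (gamma s) - cmap c (gamma 0)) ord0 a - (jet_poly b a).[s].
  rewrite horner_jet_poly !mxE summxE opprD addrA; congr (_ - _).
  by apply: eq_bigr => m _; rewrite !mxE mulrC.
apply: (@le_trans _ _ (C * `|s| ^+ K.+1)).
  by apply: le_trans Hs; rewrite (bigD1 a)//= lerDl sumr_ge0.
rewrite exprS mulrA normrX ler_wpM2r ?exprn_ge0//.
have C1 : 0 < C + 1 by rewrite ltr_wpDl.
apply: (@le_trans _ _ ((C + 1) * `|s|)); first by rewrite ler_wpM2r// lerDl.
by rewrite mulrC -ler_pdivlMr.
Unshelve. all: by end_near. Qed.

End StrongJets.

End Expansions.

(** * Estimates and continuation in a chart *)

Section LinearEquation.
Variables (R : realType) (n l : nat) (a b : R).
Hypothesis ab : a <= b.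
Variables (W w : R -> R) (u : R -> 'I_l -> R) (c : 'I_l -> 'I_n -> 'I_n -> R -> R).
Variable eta : R -> 'I_n -> R.
Hypothesis CW : caratheodory a b W w.
Hypothesis w0 : forall t, 0 <= w t.
Hypothesis uw : forall t i, `|u t i| <= w t.
Hypothesis cc : forall i d j, ccont a b (c i d j).
Hypothesis Ceta : forall j, caratheodory a b (eta ^~ j)
  (fun t => - \sum_i u t i * \sum_d eta t d * c i d j t).

Lemma bounded_family (I : finType) (g : I -> R -> R) : (forall i, ccont a b (g i)) ->
  exists2 C : R, 0 < C & forall t i, a <= t <= b -> `|g i t| <= C.
Proof.
move=> Hg; have H i : exists C : R, 0 < C /\ forall t, a <= t <= b -> `|g i t| <= C.
  by have [C C0 HC] := continuous_itv_bounded (Hg i); exists C.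
have [B /all_and2[B0 HB]] := choice H.
exists (1 + \sum_i B i).
  by rewrite ltr_wpDr// sumr_ge0// => i _; rewrite ltW.
move=> t i tab; rewrite (le_trans (HB i t tab))// (bigD1 i)//= addrCA lerDl addr_ge0//.
by rewrite sumr_ge0// => j _; rewrite ltW.
Qed.

Lemma sum_cst_ord m (x : R) : \sum_(i < m) x = m%:R * x.
Proof. by rewrite big_const_ord iter_addr_0 mulr_natl. Qed.

(** The function exp(K W) |eta|^2 does not decrease, since the derivative of |eta|^2 is at least -K
    w |eta|^2; being zero at b, it is zero at a. *)
Lemma linear_backward : (forall j, eta b j = 0) -> forall j, eta a j = 0.
Proof.
move=> eb.
have [C0 C00 HC] := @bounded_family ('I_l * 'I_n * 'I_n)%type
  (fun p => c p.1.1 p.1.2 p.2) (fun p => @cc _ _ _).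
pose N t := \sum_j eta t j * eta t j.
pose dN t := \sum_j ((- \sum_i u t i * \sum_d eta t d * c i d j t) * eta t j +
  eta t j * (- \sum_i u t i * \sum_d eta t d * c i d j t)).
have CN : caratheodory a b N dN.
  exact: (car_sum (index_enum _) (P := xpredT) (fun j _ => carM (Ceta j) (Ceta j))).
have N0 t : 0 <= N t by apply: sumr_ge0 => j _; rewrite -expr2 sqr_ge0.
have sqN t j : eta t j ^+ 2 <= N t.
  by rewrite /N (bigD1 j)//= -expr2 lerDl sumr_ge0// => i _; rewrite -expr2 sqr_ge0.
have NN t j d : `|eta t j * eta t d| <= N t.
  have H1 := sqN t j; have H2 := sqN t d.
  have : `|eta t j * eta t d| * 2 <= eta t j ^+ 2 + eta t d ^+ 2.
    rewrite normrM -[eta t j ^+ 2]real_normK ?num_real// -[eta t d ^+ 2]real_normK ?num_real//.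
    rewrite -subr_ge0.
    have -> : `|eta t j| ^+ 2 + `|eta t d| ^+ 2 - `|eta t j| * `|eta t d| * 2 =
      (`|eta t j| - `|eta t d|) ^+ 2 by ring.
    exact: sqr_ge0.
  lra.
(* n components, each with the two halves of the derivative of a square; each half is bounded by l n
   terms of size C0 w N. *)
pose K : R := n%:R * (l%:R * (n%:R * C0)) + n%:R * (l%:R * (n%:R * C0)).
have B1 t j : a <= t <= b ->
    `|eta t j * \sum_i u t i * \sum_d eta t d * c i d j t| <= l%:R * (n%:R * C0) * (w t * N t).
  move=> tab; rewrite mulr_sumr (le_trans (ler_norm_sum _ _ _))//.
  have -> : l%:R * (n%:R * C0) * (w t * N t) = \sum_(i < l) \sum_(d < n) C0 * (w t * N t).
    by rewrite !sum_cst_ord; ring.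
  apply: ler_sum => i _; rewrite [X in _ * X]mulr_sumr [X in `|X|]mulr_sumr (le_trans (ler_norm_sum _ _ _))//.
  apply: ler_sum => d _.
  rewrite (_ : _ * _ = c i d j t * (u t i * (eta t j * eta t d))); last by ring.
  rewrite !normrM ler_pM ?mulr_ge0//; first exact: (HC t (i, d, j)).
  by rewrite ler_pM ?uw// -normrM.
have CG := carM (car_expR (carZr K CW)) CN.
have H := @car_le _ a b (fun=> 0) _ (fun=> 0) _ ab (car_cst a b 0) CG.
have Nb : N b = 0 by rewrite /N big1// => j _; rewrite eb mul0r.
have Na : N a = 0.
  apply/eqP; rewrite eq_le N0 andbT.
  move: H; rewrite Nb mulr0 subrr sub0r oppr_ge0 => H.
  have /H : {ae lebesgue_measure, forall t, a < t < b ->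
      0 <= (K *: w t) * expR (K *: W t) * N t + expR (K *: W t) * dN t}.
    apply: aeW => t /andP[ta tb]; have tab : a <= t <= b by rewrite !ltW.
    rewrite [_ * expR _]mulrC -mulrA -mulrDr mulr_ge0 ?expR_ge0//.
    rewrite -lerBlDl sub0r lerNl (le_trans (ler_norm _))// normrN.
    rewrite (le_trans (ler_norm_sum _ _ _))//.
    have -> : K *: w t * N t = \sum_(j < n) (l%:R * (n%:R * C0) * (w t * N t) +
       l%:R * (n%:R * C0) * (w t * N t)).
      by rewrite sum_cst_ord /K /GRing.scale /=; ring.
    apply: ler_sum => j _; rewrite mulNr mulrN (le_trans (ler_normD _ _))// !normrN.
    by rewrite [X in `|X|]mulrC lerD// B1.
  by rewrite pmulr_rle0 ?expR_gt0.
move=> j; apply/eqP; rewrite -sqrf_eq0 eq_le sqr_ge0 andbT -Na; exact: sqN.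
Qed.

End LinearEquation.

Section ContinuousInverse.
Variables (R : realType) (a b : R).

Lemma ccont_eqf (f g : R -> R) : (forall t, a <= t <= b -> f t = g t) ->
  ccont a b f -> ccont a b g.
Proof.
move=> fg; apply: subspace_eq_continuous => t; rewrite inE /= in_itv /= => tab; exact: fg.
Qed.

Lemma ccont_inv (f : R -> R) : (forall t, a <= t <= b -> f t != 0) ->
  ccont a b f -> ccont a b (fun t => (f t)^-1).
Proof.
move=> f0 cf; apply/subspace_continuousP => t tab.
apply: cvgV; first by apply: f0; move: tab; rewrite /= in_itv.
exact: ((@subspace_continuousP _ _ _ _).1 cf).
Qed.

Lemma ccont_det n (A : R -> 'M[R]_n) : (forall i j, ccont a b (fun t => A t i j)) ->
  ccont a b (fun t => \det (A t)).
Proof.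
move=> cA; apply: ccont_sum => s _; apply: ccontM; first exact: ccont_cst.
by apply: ccont_prod => i _; exact: cA.
Qed.

Lemma ccont_invmx n (A : R -> 'M[R]_n) : (forall i j, ccont a b (fun t => A t i j)) ->
  (forall t, a <= t <= b -> A t \in unitmx) ->
  forall i j, ccont a b (fun t => invmx (A t) i j).
Proof.
move=> cA uA i j.
apply: (@ccont_eqf (fun t => (\det (A t))^-1 * ((-1) ^+ (j + i) * \det (row' j (col' i (A t)))))).
  by move=> t /uA uAt; rewrite /invmx uAt !mxE.
apply: ccontM.
  apply: ccont_inv; last exact: ccont_det.
  by move=> t /uA; rewrite unitmxE unitfE.
apply: ccontM; first exact: ccont_cst.
apply: ccont_det => i' j'; apply: ccont_eq (cA (lift j i') (lift i j')) => t.
by rewrite !mxE.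
Qed.

Lemma row_free_inj m n (A : 'M[R]_(m, n)) : (forall v : 'rV_m, v *m A = 0 -> v = 0) -> row_free A.
Proof.
move=> H; rewrite -kermx_eq0; apply/eqP/row_matrixP => i.
by rewrite row0; apply: H; rewrite -row_mul mulmx_ker row0.
Qed.

Lemma unitmx_inj n (A : 'M[R]_n) : (forall v : 'rV_n, v *m A = 0 -> v = 0) -> A \in unitmx.
Proof. by move=> H; rewrite -row_free_unit; exact: row_free_inj. Qed.

(** Applying L to the equation gives u = (L G)^(-1) L y', where G has the g_i as columns. The
    inverse is continuous in t and y' is summable as the derivative of an absolutely continuous
    curve. *)
Lemma control_summable n l (y : R -> 'rV[R]_n) (u : R -> 'I_l -> R)
    (g : 'I_l -> R -> 'rV[R]_n) (L : 'M[R]_(l, n)) : a <= b ->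
  caratheodory a b y (fun t => \sum_i u t i *: g i t) ->
  (forall i e, ccont a b (fun t => g i t ord0 e)) ->
  (forall t, a <= t <= b -> L *m (\matrix_(e, i) g i t ord0 e) \in unitmx) ->
  forall i, summable_on a b (fun t => u t i).
Proof.
move=> ab Cy cg uL i; pose H t := L *m (\matrix_(e, i) g i t ord0 e).
have cH j i' : ccont a b (fun t => H t j i').
  apply: (ccont_eq (f := fun t => \sum_e L j e * g i' t ord0 e)).
    by move=> t; rewrite mxE; apply: eq_bigr => e _; rewrite mxE.
  by apply: ccont_sum => e _; apply: ccontM => //; exact: ccont_cst.
have Cz j := car_sum (index_enum 'I_n) (P := xpredT)
  (fun e _ => carZr (L j e) ((car_mxP _ _ _ _).1 Cy ord0 e)).
have Sz j := car_summable ab (Cz j).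
have := @summable_sum _ a b 'I_l (index_enum _) xpredT _
  (fun j _ => summableM (@ccont_invmx _ H cH uL i j) (Sz j)).
apply: summable_eq; apply: aeW => t /andP[ta tb].
have tab : a <= t <= b by rewrite !ltW.
have E j : \sum_e L j e *: (\sum_i0 u t i0 *: g i0 t) ord0 e = (H t *m (\col_i0 u t i0)) j ord0.
  rewrite mxE; under [RHS]eq_bigr => i' _ do rewrite !mxE mulr_suml.
  rewrite exchange_big; apply: eq_bigr => e _.
  rewrite summxE /GRing.scale /= mulr_sumr; apply: eq_bigr => i' _.
  by rewrite !mxE; ring.
under eq_bigr => j _ do rewrite E.
transitivity ((invmx (H t) *m (H t *m (\col_i0 u t i0))) i ord0); first by rewrite mxE.
by rewrite mulKmx ?uL// mxE.
Qed.

End ContinuousInverse.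

Section TubeGronwall.
Variables (R : realType) (n l : nat) (a b : R).
Local Notation V := 'rV[R]_n.
Hypothesis ab : a <= b.
Variables (U : set V) (X : 'I_l -> V -> V) (y : R -> V).
Variables (W w : R -> R) (u du : R -> 'I_l -> R).
Hypothesis oU : open U.
Hypothesis sX : forall i, smooth_on U (X i).
Hypothesis yU : forall t, a <= t <= b -> U (y t).
Hypothesis cy : {within `[a, b], continuous y}.
Hypothesis Cy : caratheodory a b y (fun t => \sum_i u t i *: X i (y t)).
Hypothesis CW : caratheodory a b W w.
Hypothesis w0 : forall t, 0 <= w t.
Hypothesis uw : forall t i, `|u t i| <= w t.
Hypothesis duw : forall t i, `|du t i| <= w t.

Lemma taylor_tube_family N : exists r C : R, [/\ 0 < r, r <= 1, 0 < C &
  forall t v, a <= t <= b -> `|v| <= r -> U (y t + v) /\ forall i e,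
    `|X i (y t + v) ord0 e - pform N (taylor_coef (jet_coef (X i) (y t) e)) (coords v)|
       <= C * `|v| ^+ N].
Proof.
have H i : exists rC : R * R, [/\ 0 < rC.1, rC.1 <= 1, 0 < rC.2 &
  forall t v, a <= t <= b -> `|v| <= rC.1 -> U (y t + v) /\ forall e,
    `|X i (y t + v) ord0 e - pform N (taylor_coef (jet_coef (X i) (y t) e)) (coords v)|
       <= rC.2 * `|v| ^+ N].
  have [r [r0 r1 [C [C0 HC]]]] := taylor_tube N ab cy oU (sX i) yU.
  by exists (r, C).
have [rC HrC] := choice H.
(* A radius for U alone, from the zero map: with l = 0 the fields would supply none. *)
have [r0 [r01 [r00 Hr0]]] : exists r0 : R, 0 < r0 /\ r0 <= 1 /\
    forall t v, a <= t <= b -> `|v| <= r0 -> U (y t + v).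
  have [r [r0 r1 [C [C0 HC]]]] := @taylor_tube _ _ U (fun=> 0) y a b 0 ab cy oU
    (fun vs x _ => ltac:(
      have -> : Defs.iterD (fun=> 0 : V) vs = (fun=> 0 : V);
        [elim: vs => //= v vs ->; apply/funext => z; exact: derive_cst|exact: differentiable_cst])) yU.
  by exists r; split=> //; split => // t v tab vr; have [] := HC t v tab vr.
(* A product of radii in ]0, 1] is below each factor, and the sum of the constants is above each of
   them. *)
exists (r0 * \prod_i (rC i).1), (1 + \sum_i (rC i).2).
have P01 (A : pred 'I_l) : 0 <= \prod_(i | A i) (rC i).1 <= 1.
  rewrite prodr_ge0 /=; last by move=> i _; case: (HrC i) => /ltW.
  rewrite prodr_ile1// => i _; by case: (HrC i) => /ltW -> ->.
have Pp : 0 < \prod_i (rC i).1 by apply: prodr_gt0 => i _; case: (HrC i).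
have /andP[_ P1] := P01 xpredT.
split; first exact: mulr_gt0.
- by rewrite mulr_ile1// ltW.
- by rewrite ltr_wpDr// sumr_ge0// => i _; case: (HrC i) => _ _ /ltW.
move=> t v tab vr; split.
  apply: Hr0 => //; apply: le_trans vr _; by rewrite ler_piMr// ltW.
move=> i e; case: (HrC i) => ri0 ri1 Ci0 /(_ t v tab)[|_ /(_ e) H1].
  apply: le_trans vr _; rewrite (bigD1 i)//= mulrCA ler_piMr// ?(ltW ri0)//.
  have /andP[p0 p1] := P01 (predC1 i).
  by rewrite mulr_ile1// ltW.
apply: le_trans H1 _; rewrite ler_wpM2r ?exprn_ge0// (bigD1 i)//= addrCA lerDl addr_ge0//.
by rewrite sumr_ge0// => j _; case: (HrC j) => _ _ /ltW.
Qed.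

Lemma ccont_field i e s : ccont a b (fun t => jet_coef (X i) (y t) e s).
Proof.
apply/subspace_continuousP => t tab; rewrite /jet_coef.
have Dt : a <= t <= b by move: tab; rewrite /= in_itv.
have d := smooth_differentiable (basis_seq R s) (sX i) (yU Dt).
have c2 : {for Defs.iterD (X i) (basis_seq R s) (y t), continuous (fun v : V => v ord0 e)}.
  exact: coord_continuous.
have c1 := continuous_comp (differentiable_continuous d) c2.
have c0 := (@subspace_continuousP _ _ _ _).1 cy t tab.
exact: (cvg_comp _ _ c0 c1).
Qed.

(** Gronwall's inequality for the sum of squares of z - y, a differentiable substitute for the norm.
    The time x is arbitrary, so the bound holds as long as z stays in the tube, as the continuation
    argument requires. *)
Lemma tube_gronwall : exists r E : R, [/\ 0 < r, r <= 1, 0 < E,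
  forall t v, a <= t <= b -> `|v| <= r -> U (y t + v) &
  forall x s z, a <= x <= b -> `|s| <= 1 ->
    caratheodory a x z (fun t => \sum_i (u t i + s * du t i) *: X i (z t)) ->
    (forall t, a <= t <= x -> `|z t - y t| <= r) ->
    `|z x - y x| <= E * (`|z a - y a| + `|s|)].
Proof.
have [r [C [r0 r1 C0 HC]]] := taylor_tube_family 1.
have [B B0 HB] := @bounded_family _ a b ('I_l * 'I_n)%type
  (fun p t => jet_coef (X p.1) (y t) p.2 [::]) (fun p => @ccont_field p.1 p.2 [::]).
have [D D0 HD] := continuous_itv_bounded (ac_continuous CW.1).
(* Bounds the velocity of z - y: C is the Lipschitz constant, C + B bounds |X_i| on the tube and
   multiplies s du_i. *)
pose K1 : R := l%:R * (2 * C + B).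
pose K : R := 4 * n%:R * K1.
have K10 : 0 <= K1 by rewrite mulr_ge0// addr_ge0 ?mulr_ge0// ltW.
have K0 : 0 <= K by apply: mulr_ge0 => //; exact: mulr_ge0.
pose G := expR (K * (D + D)).
have G1 : 1 <= G by rewrite -expR0 ler_expR mulr_ge0// addr_ge0// ltW.
(* N a is at most (n + 1)(|z a - y a| + |s|)^2; the square root of (n + 1) G is bounded by (n + 1)
   G, which is at least 1. *)
exists r, (n.+1%:R * G); split => //; first by rewrite mulr_gt0// (lt_le_trans _ G1).
  by move=> t v tab vr; have [] := HC t v tab vr.
move=> x s z axb s1 Cz Hz; have /andP[ax xb] := axb.
pose be t := z t - y t.
pose db t e := \sum_i (u t i * (X i (z t) ord0 e - X i (y t) ord0 e) + s * du t i * X i (z t) ord0 e).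
have Cb e : caratheodory a x (fun t => be t ord0 e) (fun t => db t e).
  have C1 := (car_mxP _ _ _ _).1 (carB Cz (car_sub (lexx a) xb Cy)) ord0 e.
  apply: car_eq C1 => t _; rewrite !mxE !summxE -sumrB; apply: eq_bigr => i _.
  by rewrite !mxE; ring.
(* The constant s^2 absorbs the inhomogeneous terms s du_i X_i, so that the inequality takes the
   form dN <= K w N. *)
pose N t := \sum_e be t ord0 e * be t ord0 e + s ^+ 2.
have CN : caratheodory a x N (fun t => \sum_e (db t e * be t ord0 e + be t ord0 e * db t e) + 0).
  exact: carD (car_sum (index_enum _) (P := xpredT) (fun e _ => carM (Cb e) (Cb e))) (car_cst _ _ _).
have S0 t : 0 <= \sum_e be t ord0 e * be t ord0 e.
  by apply: sumr_ge0 => e _; rewrite -expr2 sqr_ge0.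
have N0 t : 0 <= N t by rewrite addr_ge0// sqr_ge0.
have beN t : `|be t| ^+ 2 <= N t.
  have : `|be t| <= Num.sqrt (N t).
    apply: mx_norm_le; first exact: sqrtr_ge0.
    move=> i e; rewrite ord1 -sqrtr_sqr ler_wsqrtr// /N (bigD1 e)//= -expr2 -addrA lerDl.
    by rewrite addr_ge0 ?sqr_ge0// sumr_ge0// => j _; rewrite -expr2 sqr_ge0.
  by move=> H; rewrite -[leRHS](sqr_sqrtr (N0 t)) ler_pXn2r// nnegrE// sqrtr_ge0.
have sN t : `|s| ^+ 2 <= N t by rewrite real_normK ?num_real// lerDr S0.
have dbB t e : a <= t <= x -> `|db t e| <= K1 * w t * (`|be t| + `|s|).
  move=> tax; have tab : a <= t <= b by case/andP: tax => -> /le_trans->.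
  rewrite /db (le_trans (ler_norm_sum _ _ _))//.
  have -> : K1 * w t * (`|be t| + `|s|) = \sum_(i < l) w t * ((2 * C + B) * (`|be t| + `|s|)).
    by rewrite sum_cst_ord /K1; ring.
  apply: ler_sum => i _.
  have [_ /(_ i e)] := HC t (be t) tab (Hz t tax).
  rewrite (_ : y t + be t = z t); last by rewrite /be addrC subrK.
  rewrite /be /pform big_ord1 /= /taylor_coef invr1 mul1r expr1 => H1.
  rewrite [jet_coef _ _ _ _]/(X i (y t) ord0 e) in H1.
  have H2 : `|X i (y t) ord0 e| <= B := HB t (i, e) tab.
  have H3 : `|X i (z t) ord0 e| <= C + B.
    rewrite -[X i (z t) ord0 e](subrK (X i (y t) ord0 e)) (le_trans (ler_normD _ _))// lerD//.
    by rewrite (le_trans H1)// ler_piMr ?(ltW C0)// (le_trans (Hz t tax)).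
  rewrite (le_trans (ler_normD _ _))// !normrM.
  apply: (@le_trans _ _ (w t * (C * `|z t - y t|) + `|s| * w t * (C + B))).
    by rewrite lerD// ?ler_pM ?mulr_ge0//.
  have p1 : 0 <= `|z t - y t| by [].
  have p2 : 0 <= `|s| by [].
  rewrite [`|s| * _]mulrC -mulrA -mulrDr ler_wpM2l//.
  have : 0 <= C * `|s| by rewrite mulr_ge0// ltW.
  have : 0 <= C * `|z t - y t| by rewrite mulr_ge0// ltW.
  have : 0 <= B * `|z t - y t| by rewrite mulr_ge0// ltW.
  rewrite -/(be t); lra.
have HN : N x <= N a * expR (K *: W x - K *: W a).
  apply: (gronwall ax CN (car_sub (lexx a) xb (carZr K CW))).
  apply: aeW => t /andP[ta tx]; have tax : a <= t <= x by rewrite !ltW.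
  rewrite addr0 (le_trans (ler_norm _))// (le_trans (ler_norm_sum _ _ _))//.
  have -> : K *: w t * N t = \sum_(e < n) 4 * (K1 * w t * N t).
    by rewrite sum_cst_ord /K /GRing.scale /=; ring.
  apply: ler_sum => e _.
  rewrite (_ : _ + _ = 2 * (db t e * be t ord0 e)); last by ring.
  rewrite normrM [`|2|]ger0_norm// normrM.
  have H1 := dbB t e tax; have H2 := mx_norm_coord (be t) ord0 e.
  have H3 := beN t; have H4 := sN t.
  apply: (@le_trans _ _ (2 * (K1 * w t * (`|be t| + `|s|) * `|be t|))).
    by rewrite ler_wpM2l// ler_pM.
  have -> : 2 * (K1 * w t * (`|be t| + `|s|) * `|be t|) =
    K1 * w t * (2 * ((`|be t| + `|s|) * `|be t|)) by ring.
  have -> : 4 * (K1 * w t * N t) = K1 * w t * (4 * N t) by ring.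
  apply: ler_wpM2l; first exact: mulr_ge0.
  have : 0 <= (`|be t| - `|s|) ^+ 2 by exact: sqr_ge0.
  have := N0 t; move: H3 H4; rewrite !expr2; lra.
have HG : expR (K *: W x - K *: W a) <= G.
  rewrite ler_expR -mulrBr ler_wpM2l// (le_trans (ler_norm _))// (le_trans (ler_normB _ _))//.
  by rewrite lerD ?HD ?lexx.
have Na : N a <= n.+1%:R * (`|be a| + `|s|) ^+ 2.
  have p1 : 0 <= `|be a| by []. have p2 : 0 <= `|s| by [].
  rewrite -natr1 mulrDl mul1r lerD//.
    rewrite -sum_cst_ord; apply: ler_sum => e _; rewrite -expr2 -[leLHS]real_normK ?num_real//.
    by rewrite ler_pXn2r ?nnegrE ?addr_ge0// (le_trans (mx_norm_coord _ _ _))// lerDl.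
  by rewrite -[leLHS]real_normK ?num_real// ler_pXn2r ?nnegrE ?addr_ge0// lerDr.
have E1 : 1 <= n.+1%:R * G :> R.
  by rewrite (le_trans G1)// ler_peMl ?(le_trans ler01 G1)// ler1n.
rewrite -(@ler_pXn2r _ 2)// ?nnegrE ?mulr_ge0 ?addr_ge0// ?(le_trans ler01 G1)//.
rewrite (le_trans (beN x))// (le_trans HN)// (le_trans (ler_pM (N0 a) (expR_ge0 _) Na HG))//.
by rewrite mulrAC exprMn ler_wpM2r ?sqr_ge0// expr2 ler_peMl// (le_trans ler01 E1).
Qed.

End TubeGronwall.

Section Continuation.
Variables (R : realType) (n : nat) (M : topologicalType) (c : chart R M n).
Local Notation V := 'rV[R]_n.
Hypothesis hM : hausdorff_space M.
Hypothesis Hc : is_chart c.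
Local Notation U := (cmap c @` cdom c).

Lemma within_near (N : topologicalType) (a b t : R) (Q : R -> N) (S : set N) :
  {within `[a, b], continuous Q} -> a <= t <= b -> nbhs (Q t) S ->
  exists2 d : R, 0 < d & forall s, a <= s <= b -> `|s - t| < d -> S (Q s).
Proof.
move=> cQ tab /((@subspace_continuousP _ _ _ _).1 cQ t _) H.
have {}H : nbhs (Q x @[x --> within `[a, b] (nbhs t)]) S by apply: H; rewrite /= in_itv.
move: H => /nbhs_ballP[d d0 Hd]; exists d => // s sab sd; apply: Hd.
  by rewrite /ball /= distrC.
by rewrite /= in_itv.
Qed.

Lemma cmap_near p (e : R) : cdom c p -> 0 < e ->
  nbhs p (fun p' => cdom c p' /\ `|cmap c p' - cmap c p| < e).
Proof.
case: Hc => od _ _ cm _ dp e0; apply: filterI; first exact: open_nbhs_nbhs.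
move: cm; rewrite continuous_open_subspace// => cm.
have /cvgr_dist_lt/(_ e e0) := cm p (mem_set dp).
by apply: filterS => p' /=; rewrite distrC.
Qed.

Lemma cmap_continuous (a b : R) (Q : R -> M) : {within `[a, b], continuous Q} ->
  (forall t, a <= t <= b -> cdom c (Q t)) -> {within `[a, b], continuous (cmap c \o Q)}.
Proof.
move=> cQ dQ; apply/subspace_continuousP => t tab.
have Dt : a <= t <= b by move: tab; rewrite /= in_itv.
suff H : (cmap c (Q x)) @[x --> within `[a, b] (nbhs t)] --> cmap c (Q t) by exact: H.
apply/cvgrPdist_lt => e e0; have [d d0 Hd] := within_near cQ Dt (cmap_near (dQ t Dt) e0).
apply/nbhs_ballP; exists d => // s; rewrite /ball /= distrC => ts /=; rewrite in_itv /= => sab.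
by have [_] := Hd s sab ts; rewrite distrC.
Qed.

(** A product of segments is compact, and so is its image under the continuous inverse chart; M
    being Hausdorff, the image is closed. A limit of its points therefore cannot leave the chart. *)
Lemma closed_chart_ball (y : V) (r : R) : 0 < r ->
  (forall v : V, `|v| <= r -> U (y + v)) ->
  let B := [set z : V | forall i, `[y ord0 i - r, y ord0 i + r]%classic (z ord0 i)] in
  closed (cinv c @` B) /\ forall p, (cinv c @` B) p -> cdom c p.
Proof.
case: Hc => _ _ inv _ ci r0 yr B.
have BU : B `<=` U.
  move=> z zB; rewrite -[z](subrK y) addrC; apply: yr.
  apply: mx_norm_le => [|i j]; first exact: ltW.
  rewrite ord1 !mxE; have := zB j.
  rewrite /= in_itv /= => /andP[h1 h2]; rewrite ler_norml; apply/andP; split; lra.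
split.
  apply: compact_closed => //; apply: continuous_compact.
    by apply: continuous_subspaceW ci; exact: BU.
  apply: (@rV_compact _ _ (fun i => `[y ord0 i - r, y ord0 i + r]%classic)) => i.
  exact: segment_compact.
by move=> _ [z /BU[p dp <-] <-]; rewrite inv.
Qed.

Section Curve.
Variables (a b r : R) (q Q : R -> M).
Hypothesis ab : a <= b.
Hypothesis r0 : 0 < r.
Hypothesis cq : {within `[a, b], continuous q}.
Hypothesis dq : forall t, a <= t <= b -> cdom c (q t).
Hypothesis cQ : {within `[a, b], continuous Q}.
Hypothesis tube : forall t v, a <= t <= b -> `|v| <= r -> U (cmap c (q t) + v).
Let be t := cmap c (Q t) - cmap c (q t).
Let good t := forall s, a <= s <= t -> cdom c (Q s) /\ `|be s| <= r.
Hypothesis est : forall t, a <= t <= b -> good t -> `|be t| <= r / 2.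
Hypothesis init : cdom c (Q a) /\ `|be a| <= r / 2.

Lemma be_near t (e : R) : a <= t <= b -> cdom c (Q t) -> 0 < e ->
  exists2 d : R, 0 < d & forall s, a <= s <= b -> `|s - t| < d ->
    cdom c (Q s) /\ `|be s - be t| < e.
Proof.
move=> tab dQt e0; have e20 : 0 < e / 2 by rewrite divr_gt0.
have [d1 d10 H1] := within_near cQ tab (cmap_near dQt e20).
have [d2 d20 H2] := within_near cq tab (cmap_near (dq tab) e20).
exists (Num.min d1 d2); first by rewrite lt_min d10.
move=> s sab; rewrite lt_min => /andP[sd1 sd2].
have [dQs Q_s] := H1 s sab sd1; have [_ q_s] := H2 s sab sd2; split => //.
rewrite (_ : be s - be t = (cmap c (Q s) - cmap c (Q t)) - (cmap c (q s) - cmap c (q t))).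
  by rewrite (le_lt_trans (ler_normB _ _))// [e]splitr ltrD.
by apply/matrixP => i j; rewrite /be !mxE; ring.
Qed.

(** Just before t, Q s is within r/2 of q s, itself within r/2 of q t, so it lies in the closed
    image of the ball of radius r about q t. Its limit Q t stays there, and the bound r/2 passes to
    the limit. *)
Lemma stay_at t : a <= t <= b ->
  (forall s, a <= s < t -> cdom c (Q s) /\ `|be s| <= r / 2) ->
  cdom c (Q t) /\ `|be t| <= r / 2.
Proof.
move=> tab H; have /andP[at_ tb] := tab.
have [<-|a_t] := eqVneq a t; first exact: init.
have {a_t at_} at_ : a < t by rewrite lt_neqAle a_t.
have left_near (d : R) : 0 < d -> exists s, [/\ a <= s < t, a <= s <= b & `|s - t| < d].
  move=> d0; exists (Num.max a (t - d / 2)).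
  have h : Num.max a (t - d / 2) < t by rewrite gt_max at_ ltrBlDr ltrDl divr_gt0.
  have h' : a <= Num.max a (t - d / 2) by rewrite le_max lexx.
  split; [by rewrite h'|by rewrite h' (le_trans (ltW h))|].
  rewrite ltr0_norm ?subr_lt0// opprB ltrBlDr -ltrBlDl.
  by rewrite lt_max [X in _ || X](_ : _ = true) ?orbT//; lra.
have r20 : 0 < r / 2 by rewrite divr_gt0.
have [clB BU] := closed_chart_ball r0 (fun v => @tube t v tab).
have dQt : cdom c (Q t).
  apply: BU; apply: clB => S NS.
  have [d1 d10 H1] := within_near cQ tab NS.
  have [d2 d20 H2] := within_near cq tab (cmap_near (dq tab) r20).
  have [s [s_t sab]] := left_near (Num.min d1 d2) ltac:(by rewrite lt_min d10).
  rewrite lt_min => /andP[sd1 sd2]; exists (Q s); split; last exact: H1.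
  have [dQs bs] := H s s_t; have [_ qs] := H2 s sab sd2.
  have [_ _ inv _ _] := Hc; exists (cmap c (Q s)); last exact: inv.
  move=> i; rewrite /= in_itv /=.
  have : `|(cmap c (Q s) - cmap c (q t)) ord0 i| <= r.
    rewrite (le_trans (mx_norm_coord _ _ _))//.
    rewrite (_ : _ - _ = be s + (cmap c (q s) - cmap c (q t))); last by rewrite /be addrA subrK.
    by rewrite (le_trans (ler_normD _ _))// [r]splitr lerD// ltW.
  by rewrite !mxE ler_norml => /andP[h1 h2]; apply/andP; split; lra.
split => //; rewrite leNgt; apply/negP => bt.
have [d d0 Hd] := be_near tab dQt (e := `|be t| - r / 2) ltac:(by rewrite subr_gt0).
have [s [s_t sab sd]] := left_near d d0.
have [_ bs] := H s s_t; have [_ ] := Hd s sab sd.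
rewrite distrC => hs; have := lerB_dist (be t) (be s); lra.
Qed.

(** The a priori estimate improves the bound r to r/2, and this margin lets the good interval extend
    beyond any time. The induction by [cousin] is applied to implications, which compose. *)
Lemma continuation t : a <= t <= b -> cdom c (Q t) /\ `|be t| <= r.
Proof.
have r2r : r / 2 <= r by rewrite ler_pdivrMr// ler_peMr ?(ltW r0)// ler1n.
suff Gb : good b by exact: Gb.
have Ga : good a.
  move=> s sa; have -> : s = a by apply: le_anti; rewrite andbC.
  by have [? ba] := init; split => //; exact: le_trans ba r2r.
apply: (@cousin _ (fun x y => good x -> good y) a b ab) Ga => [x y z _ _ _ _ xy yz /xy/yz//|t' tab].
(* If no good time lies shortly before t', the implication holds vacuously there; otherwise all
   times before t' are good. *)
have [[d d0 Hd]|H] := pselect (exists2 d : R, 0 < d &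
    forall x, a <= x -> x <= t' -> t' - d < x -> ~ good x).
  by exists d => // x y ax xt ty yb tdx _ gx; case: (Hd x ax xt tdx gx).
have {}H (d : R) : 0 < d -> exists x, [/\ a <= x, x <= t', t' - d < x & good x].
  move=> d0; apply: contrapT => nx; apply: H; exists d => // x ax xt tdx gx; apply: nx.
  by exists x.
have /andP[at_ tb] := tab.
have Hl s : a <= s < t' -> cdom c (Q s) /\ `|be s| <= r / 2.
  move=> /andP[as_ st]; have [x [ax xt sx gx]] := H (t' - s) ltac:(by rewrite subr_gt0).
  have {}sx : s <= x by apply: ltW; move: sx; rewrite opprB addrC subrK.
  have gs : good s by move=> s' /andP[as' ss']; apply: gx; rewrite as' (le_trans ss').
  have sab : a <= s <= b by rewrite as_ (le_trans (ltW st)).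
  by split; [case: (gs s); rewrite ?as_ ?lexx|exact: est].
have [dQt bt] := stay_at tab Hl.
have r20 : 0 < r / 2 by rewrite divr_gt0.
have [d d0 Hd] := be_near tab dQt r20.
exists d => // x y ax xt ty yb xd yd gx s /andP[as_ sy].
have [st|ts] := ltP s t'.
  by have [? bs] := Hl s ltac:(by rewrite as_); split => //; exact: le_trans bs r2r.
have [|dQs bs] := Hd s ltac:(by rewrite as_ (le_trans sy)).
  by rewrite ger0_norm ?subr_ge0// ltrBlDl; exact: le_lt_trans yd.
split => //; rewrite -[be s](subrK (be t')) (le_trans (ler_normD _ _))// [r]splitr.
by rewrite lerD// ltW.
Qed.

End Curve.
End Continuation.

Section Piece.
Variables (R : realType) (n l : nat) (M : topologicalType) (c : chart R M n).
Local Notation V := 'rV[R]_n.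
Hypothesis hM : hausdorff_space M.
Hypothesis Hc : is_chart c.
Local Notation U := (cmap c @` cdom c).
Variables (X : 'I_l -> V -> V) (a b : R) (u du : R -> 'rV[R]_l) (W w : R -> R).
Variables (q : R -> M) (Q : R -> R -> M) (Phi : coefs R n).
Hypothesis ab : a <= b.
Hypothesis sX : forall i, smooth_on U (X i).
Hypothesis CW : caratheodory a b W w.
Hypothesis w0 : forall t, 0 <= w t.
Hypothesis uw : forall t i, `|u t ord0 i| <= w t.
Hypothesis duw : forall t i, `|du t ord0 i| <= w t.
Hypothesis sdu : forall i, summable_on a b (fun t => du t ord0 i).
Hypothesis cq : {within `[a, b], continuous q}.
Hypothesis dq : forall t, a <= t <= b -> cdom c (q t).
Local Notation y := (cmap c \o q).
Hypothesis Cy : caratheodory a b y (fun t => \sum_i u t ord0 i *: X i (y t)).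
Hypothesis Q0 : forall t, Q 0 t = q t.
Hypothesis cQ : forall s, {within `[a, b], continuous (Q s)}.
Hypothesis CQ : forall s x, a <= x -> x <= b ->
  (forall t, a <= t <= x -> cdom c (Q s t)) ->
  caratheodory a x (cmap c \o Q s)
    (fun t => \sum_i (u t ord0 i + s * du t ord0 i) *: X i (cmap c (Q s t))).
Hypothesis HF : forall m t, (0 < m)%N -> a <= t <= b ->
  multilinear (@Phi m t) /\ symmetric_map (@Phi m t).
Hypothesis CF : forall m, (0 < m)%N -> forall v : V, caratheodory a b
  (fun t => @Phi m t (fun=> v))
  (fun t => - \sum_(i < l) u t ord0 i *: adapted_rhs Phi m t (X i) (y t) v).

Definition coef1 t : 'M[R]_n := \matrix_(e, j) coef_fun Phi t e [:: j].
Definition coef1_inv t d e := invmx (coef1 t) d e.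
Definition field_coef t i e s := jet_coef (X i) (y t) e s.

Let oU : open U. Proof. by case: Hc. Qed.
Let yU t : a <= t <= b -> U (y t). Proof. by move=> tab; exists (q t) => //; exact: dq. Qed.
Let cy : {within `[a, b], continuous y}. Proof. exact: cmap_continuous. Qed.

Lemma ccont_coef_fun e s : ccont a b (fun t => coef_fun Phi t e s).
Proof.
have [H _] := car_coef_fun HF CF e s.
exact: (ac_continuous H).
Qed.

Lemma ccont_field_coef i e s : ccont a b (fun t => field_coef t i e s).
Proof. exact: (@ccont_field _ _ _ _ _ _ X y sX yU cy i e s). Qed.

(** If v annihilates Phi^(1)(t), the covector v Phi^(1) solves a linear equation and vanishes at
    time t, hence already at a, where Phi^(1) is invertible. *)
Lemma coef1_unit t : coef1 a \in unitmx -> a <= t <= b -> coef1 t \in unitmx.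
Proof.
move=> ua /andP[at_ tb]; apply: unitmx_inj => v v0.
pose eta t j := \sum_e v ord0 e * coef_fun Phi t e [:: j].
have vE s j : eta s j = (v *m coef1 s) ord0 j.
  by rewrite mxE; apply: eq_bigr => e _; rewrite mxE.
suff Ha j : eta a j = 0.
  rewrite -[v](mulmxK ua) (_ : v *m _ = 0) ?mul0mx//.
  by apply/rowP => j; rewrite -vE Ha mxE.
have cc i d j' : ccont a t (fun s => field_coef s i d [:: j']).
  apply: continuous_subspaceW (@ccont_field_coef i d [:: j']) => s /=.
  by rewrite !in_itv /= => /andP[-> /le_trans->].
have Hb := (@linear_backward R n l a t at_ W w (fun s i => u s ord0 i)
  (fun i d j s => field_coef s i d [:: j]) eta (car_sub (lexx a) tb CW) uw cc).
apply: Hb => {}j; last by rewrite vE v0 mxE.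
have C1 e := carZr (v ord0 e) (car_coef_fun HF CF e [:: j]).
have C2 := car_sub (lexx a) tb (car_sum (index_enum _) (P := xpredT) (fun e _ => C1 e)).
have ode1 := coef_fun_ode oU sX yU HF CF 1.
apply: car_ae_eq C2; apply: filterS ode1 => s Hs /andP[as_ st].
have sab : a < s < b by rewrite as_ (lt_le_trans st).
have E e : coef_deriv X y u Phi s e [:: j] = - \sum_i u s ord0 i *
    \sum_d coef_fun Phi s e [:: d] * field_coef s i d [:: j].
  have := Hs sab e ord0 (fun j' => (j' == j)%:R).
  rewrite -[nseq _ _]/[seq (fun j' => (j' == i)%:R) | i <- [:: j]] mform_basis => ->.
  congr (- _); apply: eq_bigr => i _; congr (_ * _); rewrite big_ord1 bin1 mul1r /=.
  apply: eq_bigr => d _; rewrite mulrC; congr (_ * _).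
  rewrite (bigD1 j)//= eqxx mul1r big1 ?addr0// => j' /negbTE->; exact: mul0r.
under eq_bigr => e _ do rewrite E /GRing.scale /= mulrN mulr_sumr.
rewrite sumrN exchange_big; congr (- _); apply: eq_bigr => i _.
rewrite /eta; under [in RHS]eq_bigr => d _ do rewrite mulr_suml.
rewrite exchange_big mulr_sumr; apply: eq_bigr => e _.
rewrite mulrCA; congr (_ * _); rewrite mulr_sumr; apply: eq_bigr => d _; exact: mulrA.
Qed.


Lemma ccont_coef1_inv d e : coef1 a \in unitmx -> ccont a b (fun t => coef1_inv t d e).
Proof.
move=> ua; apply: ccont_invmx => [i j|t tab]; last exact: coef1_unit.
by apply: ccont_eq (@ccont_coef_fun i [:: j]) => t; rewrite mxE.
Qed.

Lemma coef1_mul_inv t j d : coef1 t \in unitmx ->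
  \sum_e coef_fun Phi t j [:: e] * coef1_inv t e d = (j == d)%:R.
Proof.
move=> ut; transitivity ((coef1 t *m invmx (coef1 t)) j d); last by rewrite mulmxV// mxE.
by rewrite mxE; apply: eq_bigr => e _; rewrite mxE.
Qed.

Lemma coef1_inv_mul t j d : coef1 t \in unitmx ->
  \sum_e coef1_inv t d e * coef_fun Phi t e [:: j] = (d == j)%:R.
Proof.
move=> ut; transitivity ((invmx (coef1 t) *m coef1 t) d j); last by rewrite mulVmx// mxE.
by rewrite mxE; apply: eq_bigr => e _; rewrite mxE.
Qed.

(** The jet at the initial time bounds the initial displacement by C1 |s|, Gronwall turns this into
    C |s| inside the tube, and for small s the continuation lemma shows that the tube is never
    left. *)
Lemma family_tube r k (b0 : 'M[R]_(k, n)) : strong_jet c (fun s => Q s a) b0 -> 0 < r ->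
  exists C d : R, [/\ 0 < C, 0 < d, d <= 1 & forall s t, `|s| <= d -> a <= t <= b ->
    [/\ cdom c (Q s t), `|cmap c (Q s t) - y t| <= r & `|cmap c (Q s t) - y t| <= C * `|s|]].
Proof.
move=> [[d1 d10 Hd1] Hb0] r0.
have [C1 [d2 [C10 d20 d21 Hd2]]] := expands_norm Hb0.
have [r1 [E [r10 r11 E0 tube gron]]] := tube_gronwall ab oU sX yU cy Cy CW w0 uw duw.
pose r' := Num.min r r1; have r'0 : 0 < r' by rewrite lt_min r0.
have rl : r' <= r by rewrite ge_min lexx.
have rr : r' <= r1 by rewrite ge_min lexx orbT.
pose C := E * (C1 + 1); have C0 : 0 < C by rewrite mulr_gt0// ltr_wpDl.
(* Dominates both constants, so one choice of d makes the initial displacement and the propagated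
   one at most r'/2. *)
pose C2 := C + C1; have C20 : 0 < C2 by rewrite ltr_wpDr.
pose d := Num.min (Num.min d1 d2) (r' / 2 / C2).
have d0 : 0 < d by rewrite !lt_min d10 d20 !divr_gt0.
have dle (s : R) : `|s| <= d -> [/\ `|s| <= d1, `|s| <= d2 & C2 * `|s| <= r' / 2].
  rewrite !le_min => /andP[/andP[-> ->] h]; split=> //.
  by rewrite mulrC -ler_pdivlMr.
have ya s : `|s| <= d -> `|cmap c (Q s a) - y a| <= C1 * `|s|.
  by move=> /dle[_ h _]; have := Hd2 s h; rewrite Q0.
have est s x : `|s| <= d -> a <= x <= b ->
    (forall t, a <= t <= x -> cdom c (Q s t) /\ `|cmap c (Q s t) - y t| <= r') ->
    `|cmap c (Q s x) - y x| <= C * `|s|.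
  move=> sd axb Hx; have /andP[ax xb] := axb; have [_ s2 _] := dle s sd.
  have := gron x s (cmap c \o Q s) axb (le_trans s2 d21)
    (CQ ax xb (fun t tax => (Hx t tax).1))
    (fun t tax => le_trans (Hx t tax).2 rr).
  move=> /le_trans; apply; rewrite -mulrA ler_wpM2l ?(ltW E0)// mulrDl mul1r lerD2r.
  exact: ya.
have Cs (s : R) : `|s| <= d -> C * `|s| <= r' / 2.
  by move=> /dle[_ _]; apply: le_trans; rewrite ler_wpM2r// lerDl.
have C1s (s : R) : `|s| <= d -> C1 * `|s| <= r' / 2.
  by move=> /dle[_ _]; apply: le_trans; rewrite ler_wpM2r// lerDr ltW.
have cont s : `|s| <= d -> forall t, a <= t <= b ->
    cdom c (Q s t) /\ `|cmap c (Q s t) - y t| <= r'.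
  move=> sd t0 t0ab.
  apply: (continuation hM Hc ab r'0 cq dq (@cQ s) _ _ _ t0ab) => //.
  - by move=> t v tab vr; apply: tube => //; exact: le_trans vr rr.
  - by move=> t tab gt; exact: le_trans (est s t sd tab gt) (Cs s sd).
  - split; first by apply: Hd1; case: (dle s sd).
    exact: le_trans (ya s sd) (C1s s sd).
exists C, d; split => //.
  by rewrite !ge_min d21 !orbT.
move=> s t sd tab; have [dQ Qr] := cont s sd t tab; split => //.
  exact: le_trans Qr rl.
apply: est => // t' /andP[at' t't]; apply: cont => //.
by rewrite at' (le_trans t't)//; case/andP: tab.
Qed.


(** The curve x is constructed independently, as the solution of the triangular system; the
    bootstrap then proves that it describes the family. The existence of the jet in s at each t is
    thus a conclusion. *)
Theorem piece_jets k (b0 : 'M[R]_(k.+1, n)) : coef1 a \in unitmx ->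
  strong_jet c (fun s => Q s a) b0 ->
  exists x : R -> 'M[R]_(k.+1, n), [/\ x a = Psi Phi a b0,
    forall m e, caratheodory a b (fun t => x t m e) (fun t => \sum_i du t ord0 i *
       adapted_field (coef_fun Phi t) (coef1_inv t) (field_coef t) i (x t) m e) &
    forall t, a <= t <= b -> exists2 b', strong_jet c (fun s => Q s t) b' & Psi Phi t b' = x t].
Proof.
move=> ua sj.
have [x [xa Cx]] := @adapted_solution R n l k.+1 a b (coef_fun Phi) coef1_inv field_coef
  ccont_coef_fun (fun d e => @ccont_coef1_inv d e ua) ccont_field_coef
  (fun t i => du t ord0 i) (Psi Phi a b0) sdu.
exists x; split => // t tab.
have [r2 [C2 [r20 r21 C20 HT]]] := taylor_tube_family ab oU sX yU cy k.+2.
have [C [d [C0 d0 d1 Hd]]] := family_tube sj r20.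
pose beta (z : R * R) (j : 'I_n) := (cmap c (Q z.2 z.1) - y z.1) ord0 j.
pose Y (i : 'I_l) (z : R * R) (j : 'I_n) := X i (cmap c (Q z.2 z.1)) ord0 j.
have Haa : a <= a <= b by rewrite lexx.
have H e : uniform_O [set t | a <= t <= b] k.+2 (fun z => beta z e -
    unadapt_fun (coef_fun Phi) coef1_inv x e z).
  apply: (@unadapt_expansion R n l k a b ab (coef_fun Phi) (coef_deriv X y u Phi) coef1_inv
    field_coef (fun t i => u t ord0 i) (fun t i => du t ord0 i) W w beta Y) => //.
  - exact: ccont_coef_fun.
  - by move=> d' e'; exact: ccont_coef1_inv.
  - exact: ccont_field_coef.
  - move=> i j; exists (C2 * C ^+ k.+2), d; split => //.
      by rewrite mulr_ge0 ?exprn_ge0// ltW.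
    move=> t' s tab' sd /=; have [_ Qr QC] := Hd s t' sd tab'.
    have [_ /(_ i j)] := HT t' _ tab' Qr.
    rewrite (_ : y t' + _ = cmap c (Q s t')); last by rewrite addrC subrK.
    move=> /le_trans; apply.
    rewrite -mulrA ler_wpM2l ?(ltW C20)// -exprMn ler_pXn2r// nnegrE// mulr_ge0// ltW//.
  - move=> j; exists C, d; split => //; first exact: ltW.
    move=> t' s tab' sd; have [_ _ QC] := Hd s t' sd tab'.
    exact: le_trans (mx_norm_coord _ _ _) QC.
  - exists d => // s sd j.
    have C1 := CQ ab (lexx b) (fun t' tab' => let: And3 h _ _ := Hd s t' sd tab' in h).
    have := (car_mxP _ _ _ _).1 (carB C1 Cy) ord0 j; apply: car_eq => t' _.
    rewrite !mxE !summxE -sumrB; apply: eq_bigr => i _.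
    by rewrite !mxE.
  - exact: car_coef_fun.
  - by move=> t' e' tab'; exact: (coef_fun_symmetric_itv HF).
  - exact: (coef_fun_ode oU sX yU HF CF).
  - move=> t' tab' d' j; apply: coef1_inv_mul; exact: coef1_unit.
  - move=> e'; have [C3 [d3 [C30 d30 d31 H3]]] := expands_Psi (fun m m0 => HF m0 Haa) e' sj.2.
    exists C3, d3; split => // t' s _ sd /=.
    have := H3 0 s _ sd; rewrite /= lexx => /(_ isT).
    by rewrite /adapted_pos /jet_fun xa /beta /= -Q0.
have Dt : [set t | a <= t <= b] t by [].
have ut := coef1_unit ua tab.
have HMt j d' := coef1_mul_inv j d' ut.
exists (poly_jet k.+1 (unadapt (coef_fun Phi t) (coef1_inv t) (x t))); last first.
  by apply: Psi_unadapt => // m m0; exact: HF.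
split; first by exists d => // s sd; have [] := Hd s t sd tab.
apply: expands_unadapt => e; have := uniform_O_slice Dt (H e).
by apply: uniform_O_eq => t' s _; rewrite /beta /= Q0.
Qed.

End Piece.

Section FreeRows.
Variable R : realType.

Lemma row_free_seq m n (f : 'I_m -> 'rV[R]_n) :
  free [seq f i | i <- enum 'I_m] -> row_free (\matrix_i f i).
Proof.
move=> Hf; have sz : size [seq f i | i <- enum 'I_m] == m by rewrite size_map size_enum_ord.
have /freeP H : free (Tuple sz) by [].
apply: row_free_inj => v v0; apply/rowP => i; rewrite mxE.
apply: (H (fun i => v ord0 i)); rewrite -[RHS]v0 mulmx_sum_row; apply: eq_bigr => j _.
by rewrite rowK (nth_map j) ?size_enum_ord// nth_ord_enum.
Qed.

End FreeRows.

(** * Integrability of the controls and passage between charts *)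

Section Trajectories.
Variables (R : realType) (n l : nat) (M : topologicalType) (A : set (chart R M n)).
Local Notation V := 'rV[R]_n.
Variables (X : 'I_l -> chart R M n -> V -> V) (T : R) (q0 : M).
Hypothesis HA : smooth_atlas A.
Hypothesis sX : forall i, smooth_vector_field A (X i).
Hypothesis iX : pointwise_independent A X.
Hypothesis T0 : 0 < T.

(** Integrability is local by [cousin]. Near t the curve lies in one chart, and a left inverse of
    the matrix of the X_i at Q t remains usable for nearby times. *)
Lemma trajectory_summable v Q : is_trajectory A X T q0 v Q ->
  forall i, summable_on 0 T (fun t => v t ord0 i).
Proof.
move=> [_ cQ trQ] i; have [HA1 HA2 _] := HA.
apply: (@cousin _ (fun x y => summable_on x y (fun t => v t ord0 i)) 0 T (ltW T0)).
  by move=> x y z _ xy yz _; exact: summable_cat.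
move=> t tT; have [c Ac ct] := HA2 (Q t); have Hc := HA1 c Ac.
have [oc oU inv _ _] := Hc.
have Nc : nbhs (Q t) (cdom c) by exact: open_nbhs_nbhs.
have [d1 d10 Hd1] := within_near cQ tT Nc.
have d120 : 0 < d1 / 2 by rewrite divr_gt0.
pose a1 := Num.max 0 (t - d1 / 2); pose b1 := Num.min T (t + d1 / 2).
have [t0 tT'] := andP tT.
have sub (s : R) : a1 <= s <= b1 -> 0 <= s <= T.
  by rewrite ge_max le_min => /andP[/andP[-> _] /andP[-> _]].
have dQ (s : R) : a1 <= s <= b1 -> cdom c (Q s).
  move=> sab; apply: Hd1; first exact: sub.
  move: sab; rewrite ge_max le_min => /andP[/andP[_ h1] /andP[_ h2]].
  by rewrite ltr_norml; apply/andP; split; lra.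
have tab : a1 <= t <= b1.
  by rewrite ge_max le_min t0 tT' /=; apply/andP; split; lra.
have cQ1 : {within `[a1, b1], continuous Q}.
  apply: continuous_subspaceW cQ => s /=; rewrite !in_itv; exact: sub.
have cy := cmap_continuous Hc cQ1 dQ.
have yU s : a1 <= s <= b1 -> (cmap c @` cdom c) ((cmap c \o Q) s).
  by move=> sab; exists (Q s) => //; exact: dQ.
have cg j e : ccont a1 b1 (fun s => X j c (cmap c (Q s)) ord0 e).
  exact: (@ccont_field _ _ _ _ _ _ (fun j => X j c) _ (fun j => (sX j).1 c Ac) yU cy j e [::]).
pose G s : 'M[R]_(n, l) := \matrix_(e, j) X j c (cmap c (Q s)) ord0 e.
(* Independence at Q t gives a right inverse of the matrix whose rows are the X_i; its transpose is
   a left inverse of [G t]. *)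
have /row_freeP[B HB] := row_free_seq (iX Ac ct).
pose L := B^T.
have L1 : L *m G t = 1%:M.
  rewrite -[LHS]trmxK trmx_mul trmxK -[RHS]trmx1 -HB; congr (_ *m _)^T.
  by apply/matrixP => j e; rewrite !mxE.
have cH j j' : ccont a1 b1 (fun s => (L *m G s) j j').
  apply: (ccont_eq (f := fun s => \sum_e L j e * X j' c (cmap c (Q s)) ord0 e)).
    move=> s; rewrite [RHS]mxE; apply: eq_bigr => e _; congr (_ * _).
    by rewrite /G mxE.
  by apply: ccont_sum => e _; apply: ccontM => //; exact: ccont_cst.
(* The determinant of L G is 1 at t, so it stays nonzero as long as it moves by less than 1. *)
have [d2 d20 Hd2] := continuous_itv_near (ccont_det cH) tab ltr01.
have Hu s : a1 <= s <= b1 -> `|s - t| < d2 -> L *m G s \in unitmx.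
  move=> sab std; have := Hd2 s sab std; rewrite L1 det1 unitmxE unitfE.
  by apply: contraTneq => ->; rewrite sub0r normrN normr1 ltxx.
exists (Num.min (d1 / 2) d2); first by rewrite lt_min d120.
move=> x y x0 xt ty yT; rewrite ltrBlDr -ltrBlDl lt_min => /andP[tx1 tx2].
rewrite -ltrBlDl lt_min => /andP[yt1 yt2].
have sab s : x <= s <= y -> a1 <= s <= b1.
  move=> /andP[xs sy]; rewrite ge_max le_min (le_trans x0 xs) (le_trans sy yT) /=.
  by apply/andP; split; lra.
have [xab yab] : (a1 <= x <= b1) /\ (a1 <= y <= b1).
  by split; apply: sab; rewrite lexx ?(le_trans xt).
have xy := le_trans xt ty.
have Cy := trQ c x y Ac x0 xy yT (fun s sxy => dQ s (sab s sxy)).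
apply: (@control_summable _ x y n l (cmap c \o Q) (fun t i => v t ord0 i)
  (fun j s => X j c (cmap c (Q s))) L xy Cy) => [j e|s sxy].
  apply: continuous_subspaceW (cg j e) => s /=; rewrite !in_itv /=; exact: sab.
apply: Hu; first exact: sab.
by case/andP: sxy => xs sy; rewrite ltr_norml; apply/andP; split; lra.
Qed.

Lemma open_overlap c c' : A c -> A c' -> open (cmap c @` (cdom c `&` cdom c')).
Proof.
have [HA1 _ _] := HA; move=> /HA1[oc oU inv _ ci] /HA1[oc' _ _ _ _].
rewrite openE => _ [p [cp c'p] <-].
move: ci; rewrite continuous_open_subspace// => ci.
have Up : (cmap c @` cdom c) (cmap c p) by exists p.
have N1 : nbhs (cmap c p) (cmap c @` cdom c) by exact: open_nbhs_nbhs.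
have N2 : nbhs (cmap c p) (fun y => cdom c' (cinv c y)).
  by apply: (ci _ (mem_set Up)); rewrite inv//; exact: open_nbhs_nbhs.
apply: filterS2 N1 N2 => y [p' cp' <-]; rewrite inv// => c'p'.
by exists p'.
Qed.

(** Small s keep gamma in the overlap of the charts, where the transition map is smooth and composes
    with the expansion. *)
Lemma strong_jet_transition c c' K (gamma : R -> M) (b : 'M[R]_(K, n)) : A c -> A c' ->
  cdom c' (gamma 0) -> strong_jet c gamma b -> exists b', strong_jet c' gamma (b' : 'M[R]_(K, n)).
Proof.
move=> Ac Ac' c'0 [[d d0 Hd] Hb]; have [HA1 _ HA3] := HA.
have [oc oU inv _ _] := HA1 c Ac.
have c0 : cdom c (gamma 0) by apply: Hd; rewrite normr0 ltW.
have [C [d1 [C0 d10 d11 H1]]] := expands_norm Hb.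
have W0 : (cmap c @` (cdom c `&` cdom c')) (cmap c (gamma 0)) by exists (gamma 0).
have oW := open_overlap Ac Ac'.
have /nbhs_ballP[e e0 He] : nbhs (cmap c (gamma 0)) (cmap c @` (cdom c `&` cdom c')).
  exact: open_nbhs_nbhs.
pose d2 := Num.min (Num.min d d1) (e / 2 / (C + 1)).
have C1 : 0 < C + 1 by rewrite ltr_wpDl.
have d20 : 0 < d2 by rewrite !lt_min d0 d10 !divr_gt0.
have in' s : `|s| <= d2 -> cdom c (gamma s) /\ cdom c' (gamma s).
  rewrite !le_min => /andP[/andP[sd sd1] se]; have cs := Hd s sd; split => //.
  have : ball (cmap c (gamma 0)) e (cmap c (gamma s)).
    rewrite -ball_normE /= distrC (le_lt_trans (H1 s sd1))//.
    apply: (@le_lt_trans _ _ (e / 2)); last by rewrite ltr_pdivrMr// ltr_pMr// ltr1n.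
    rewrite (@le_trans _ _ ((C + 1) * `|s|))//; first by rewrite ler_wpM2r// lerDl.
    by rewrite mulrC -ler_pdivlMr.
  by move=> /He[p [cp c'p] /(congr1 (cinv c))]; rewrite !inv// => <-.
have [b' Hb'] := expands_smooth Hb oW (HA3 c c' Ac Ac') W0.
exists b'; split; first by exists d2 => // s /in'[].
move=> e'; have [C2 [d3 [C20 d30 d31 H3]]] := Hb' e'.
exists C2, (Num.min d2 d3); split => //; first by rewrite lt_min d20.
  by rewrite ge_min d31 orbT.
move=> t s t0; rewrite le_min => /andP[sd2 sd3]; have := H3 t s t0 sd3.
have [cs c's] := in' s sd2.
rewrite -[(t, s).2]/s (_ : cmap c (gamma 0) + _ = cmap c (gamma s)); last by rewrite addrC subrK.
by rewrite /transition /= !inv.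
Qed.

Lemma Psi1 (Phi : coefs R n) t (b : 'M[R]_(1, n)) e :
  (forall m, (0 < m)%N -> multilinear (Phi m t) /\ symmetric_map (Phi m t)) ->
  Psi Phi t b ord0 e = \sum_j b ord0 j * coef_fun Phi t e [:: j].
Proof.
move=> HF; rewrite Psi_coef_fun//.
rewrite (@pform_pos_part R n {poly R} polyC 0 (coef_fun Phi t e) (jet_poly b) (polyC0 _)).
rewrite coefD coef_sum [X in _ + X](_ : _ = 0) ?addr0.
  apply: eq_bigr => j _; rewrite coefMC; congr (_ * _).
  exact: (coef_jet_poly b j ord0).
by rewrite /pform big_ord_recl big_ord1 !mform0 ?addr0 ?coef0.
Qed.

(** Straight lines in the chart c realise every 1-jet b at p, and compatibility equates its images
    under Phi^(1) and Phi'^(1). A covector that annihilates Phi'^(1) then annihilates Phi^(1) on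
    every b. *)
Lemma coef1_transition c c' p (Phi Phi' : coefs R n) t : A c -> A c' ->
  cdom c p -> cdom c' p ->
  (forall m, (0 < m)%N -> multilinear (Phi m t) /\ symmetric_map (Phi m t)) ->
  (forall m, (0 < m)%N -> multilinear (Phi' m t) /\ symmetric_map (Phi' m t)) ->
  (forall gamma (b b' : 'M[R]_(1, n)), gamma 0 = p ->
     is_jet c gamma b -> is_jet c' gamma b' -> Psi Phi t b = Psi Phi' t b') ->
  coef1 Phi t \in unitmx -> coef1 Phi' t \in unitmx.
Proof.
move=> Ac Ac' cp c'p HF HF' compat u1.
have [HA1 _ _] := HA; have [oc oU inv _ _] := HA1 c Ac.
have Up : (cmap c @` cdom c) (cmap c p) by exists p.
have /nbhs_ballP[e e0 He] : nbhs (cmap c p) (cmap c @` cdom c) by exact: open_nbhs_nbhs.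
have jet (b : 'M[R]_(1, n)) : exists b' : 'M[R]_(1, n), Psi Phi t b = Psi Phi' t b'.
  pose gamma s := cinv c (cmap c p + s *: (b : 'rV[R]_n)).
  have g0 : gamma 0 = p by rewrite /gamma scale0r addr0 inv.
  pose d := Num.min 1 (e / 2 / (`|b| + 1)).
  have b1 : 0 < `|b| + 1 by rewrite ltr_wpDl.
  have d0 : 0 < d by rewrite lt_min ltr01 !divr_gt0.
  have gs s : `|s| <= d -> exists2 p', cdom c p' & cmap c p' = cmap c p + s *: (b : 'rV[R]_n).
    rewrite le_min => /andP[_ sd]; apply: He.
    rewrite -ball_normE /= opprD addrA subrr sub0r normrN normrZ.
    apply: (@le_lt_trans _ _ (e / 2)); last by rewrite ltr_pdivrMr// ltr_pMr// ltr1n.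
    rewrite (@le_trans _ _ (`|s| * (`|b| + 1)))//; first by rewrite ler_wpM2l// lerDl.
    by rewrite -ler_pdivlMr.
  have sj : strong_jet c gamma b.
    split; first by exists d => // s /gs[p' cp' E]; rewrite /gamma -E inv.
    move=> e'; exists 0, d; split => //; first by rewrite ge_min lexx.
    move=> _ s _ /gs[p' cp' E] /=; rewrite mul0r g0 /gamma -E inv// E.
    rewrite horner_jet_poly big_ord1 expr1 !mxE.
    rewrite (_ : _ - _ = 0) ?normr0//; ring.
  have [|b' sj'] := strong_jet_transition Ac Ac' _ sj; first by rewrite g0.
  exists b'; apply: (compat gamma) => //; exact: strong_jet_is_jet.
apply: unitmx_inj => v v0.
rewrite -[v](mulmxK u1) (_ : v *m coef1 Phi t = 0) ?mul0mx//.
apply/rowP => j; have [b' E] := jet (delta_mx ord0 j).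
have col (f : coefs R n) (HFf : forall m, (0 < m)%N -> multilinear (f m t) /\ symmetric_map (f m t)) (b : 'M[R]_(1, n)) :
    v *m (Psi f t b)^T = (v *m coef1 f t) *m b^T.
  rewrite -mulmxA; congr (_ *m _); apply/matrixP => i z; rewrite ord1 [LHS]mxE (Psi1 b i HFf) [RHS]mxE.
  by apply: eq_bigr => j' _; rewrite !mxE mulrC.
have H : (v *m coef1 Phi t) *m (delta_mx ord0 j)^T = 0 :> 'M[R]_1.
  by rewrite -col// E col// v0 mul0mx.
have := congr1 (fun m : 'M[R]_1 => m ord0 ord0) H; rewrite !mxE (bigD1 j)//= big1 => [|i ij].
  by rewrite addr0 !mxE !eqxx mulr1.
by rewrite !mxE (negbTE ij) andbF mulr0.
Qed.

Lemma coef1_basis (Phi : coefs R n) t :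
  basis_of fullv [seq (\row_(i < n) Phi 1%N t (fun=> delta_mx ord0 i) ord0 a : 'rV[R]_n)
     | a <- enum 'I_n] -> coef1 Phi t \in unitmx.
Proof.
move=> /basis_free/row_free_seq; rewrite row_free_unit.
set B := \matrix_i _; have -> // : coef1 Phi t = B.
apply/matrixP => a i; rewrite !mxE /coef_fun /=; congr (Phi _ t _ ord0 a).
by apply/funext => -[[|z] z1].
Qed.

End Trajectories.

(** * Gluing the pieces *)

Section Assembly.
Variables (R : realType) (n l : nat) (M : topologicalType) (A : set (chart R M n)).
Local Notation V := 'rV[R]_n.
Variables (X : 'I_l -> chart R M n -> V -> V) (T : R) (q0 : M).
Variables (Omega : set (R -> 'rV[R]_l)) (End : R -> (R -> 'rV[R]_l) -> M).
Variables (u : R -> 'rV[R]_l) (P : adapted_coords R M n).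
Hypothesis HM : smooth_manifold A.
Hypothesis sX : forall i, smooth_vector_field A (X i).
Hypothesis iX : pointwise_independent A X.
Hypothesis T0 : 0 < T.
Hypothesis cO : control_space T Omega.
Hypothesis tr : forall v, Omega v -> is_trajectory A X T q0 v (fun t => End t v).
Hypothesis Ou : Omega u.
Hypothesis HP : is_adapted A X T u (fun t => End t u) P.

Let q t := End t u.
Let tm := time P.
Let N := pieces P.
Let ch := chart_at P.
Let Phi j : coefs R n := coef P j.

Let hM : hausdorff_space M. Proof. by case: HM. Qed.
Let HA : smooth_atlas A. Proof. by case: HM. Qed.
Let tm0 : tm 0%N = 0. Proof. by case: HP => -[]. Qed.
Let tmN : tm N = T. Proof. by case: HP => -[]. Qed.
Let piece j : (j < N)%N -> [/\ tm j < tm j.+1, A (ch j) &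
  forall t, tm j <= t <= tm j.+1 -> cdom (ch j) (q t)].
Proof. by case: HP => -[_ _ H] _ _ _ _ /H. Qed.

Let tm_le i j : (i <= j)%N -> (j <= N)%N -> tm i <= tm j.
Proof.
move=> ij; elim: j ij => [|j IH]; first by rewrite leqn0 => /eqP->.
rewrite leq_eqVlt => /predU1P[->//|ij] jN.
by rewrite (le_trans (IH ij (ltnW jN)))// ltW//; case: (piece jN).
Qed.

Let N0 : (0 < N)%N.
Proof. by rewrite lt0n; apply: contraTneq T0 => e; rewrite -tmN e tm0 ltxx. Qed.

Let sub_piece j t : (j < N)%N -> tm j <= t <= tm j.+1 -> 0 <= t <= T.
Proof.
move=> jN /andP[jt tj]; rewrite -tm0 -tmN.
by rewrite (le_trans (tm_le (leq0n j) (ltnW jN)) jt) (le_trans tj (tm_le jN (leqnn N))).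
Qed.

Let tm_ge0 j : (j <= N)%N -> 0 <= tm j.
Proof. by move=> jN; rewrite -tm0 tm_le. Qed.

Let tm_leT j : (j <= N)%N -> tm j <= T.
Proof. by move=> jN; rewrite -tmN tm_le. Qed.

Let HF j : (j < N)%N -> forall m t, (0 < m)%N -> tm j <= t <= tm j.+1 ->
  multilinear (@Phi j m t) /\ symmetric_map (@Phi j m t).
Proof. by case: HP => _ H _ _ _ jN m t; exact: H. Qed.

(** A total choice of the piece containing t. Only its value in the interiors of the pieces affects
    a trajectory, since the switching times form a null set. *)
Let piece_index (t : R) : nat := find (fun j => t < tm j.+1) (iota 0 N).

Let piece_indexE j t : (j < N)%N -> tm j < t < tm j.+1 -> piece_index t = j.
Proof.
move=> jN /andP[jt tj]; rewrite /piece_index -(subnKC (ltnW jN)) iotaD find_cat.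
have -> : has (fun i => t < tm i.+1) (iota 0 j) = false.
  apply/hasPn => i; rewrite mem_iota add0n => /andP[_ ij].
  by rewrite -leNgt (le_trans _ (ltW jt))// tm_le// ltnW.
rewrite size_iota add0n; case E : (N - j)%N => [|r] /=; last by rewrite tj addn0.
by move: jN; rewrite -subn_gt0 E.
Qed.

(** Defined for every real t, outside [0, T] with arbitrary coefficients: homogeneity and projection
    of [adapted_field] hold for any coefficients. *)
Definition adapted_flow k i (t : R) : 'M[R]_(k, n) -> 'M[R]_(k, n) :=
  let j := piece_index t in
  adapted_field (coef_fun (Phi j) t) (coef1_inv (Phi j) t)
    (field_coef (ch j) (fun i => X i (ch j)) q t) i.

Let Hc j : (j < N)%N -> is_chart (ch j).
Proof. by move=> /piece[_ Aj _]; case: HA => H _ _; exact: H. Qed.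

Let sXj j : (j < N)%N -> forall i, smooth_on (cmap (ch j) @` cdom (ch j)) (X i (ch j)).
Proof. by move=> /piece[_ Aj _] i; case: (sX i) => H _; exact: H. Qed.

Let traj_continuous j v : (j < N)%N -> Omega v ->
  {within `[tm j, tm j.+1], continuous (fun t => End t v)}.
Proof.
move=> jN /tr[_ cv _]; apply: continuous_subspaceW cv => t /=; rewrite !in_itv /=.
exact: sub_piece.
Qed.

Let traj_car j v x : (j < N)%N -> Omega v -> tm j <= x -> x <= tm j.+1 ->
  (forall t, tm j <= t <= x -> cdom (ch j) (End t v)) ->
  caratheodory (tm j) x (fun t => cmap (ch j) (End t v))
    (fun t => \sum_(i < l) v t ord0 i *: X i (ch j) (cmap (ch j) (End t v))).
Proof.
move=> jN /tr[_ _ H] jx xj dv; case: (piece jN) => _ Aj _.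
apply: H => //; first by rewrite tm_ge0// ltnW.
exact: le_trans xj (tm_leT jN).
Qed.

Let CF j : (j < N)%N -> forall m, (0 < m)%N -> forall v : V, caratheodory (tm j) (tm j.+1)
  (fun t => @Phi j m t (fun=> v))
  (fun t => - \sum_(i < l) u t ord0 i *: adapted_rhs (Phi j) m t (X i (ch j)) (cmap (ch j) (q t)) v).
Proof. by case: HP => _ _ _ H _ jN m m0; case: (H j m jN m0). Qed.

(** The sum of all |u_i| and |v_i| is a common integrable majorant, with primitive W. *)
Let domination v : Omega v -> exists W w : R -> R, [/\ caratheodory 0 T W w,
  forall t, 0 <= w t, forall t i, `|u t ord0 i| <= w t & forall t i, `|v t ord0 i| <= w t].
Proof.
move=> Ov; have su v' i : Omega v' -> summable_on 0 T (fun t => `|v' t ord0 i|).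
  by move=> Ov'; apply: summable_norm; exact: (trajectory_summable HA sX iX T0 (tr Ov')).
have [W CW] := summable_primitive (summable_sum (index_enum _) (P := xpredT)
  (fun i _ => summableD (su u i Ou) (su v i Ov))).
have ge0 t (i : 'I_l) : 0 <= \sum_(j < l | j != i) (`|u t ord0 j| + `|v t ord0 j|).
  by apply: sumr_ge0 => j _; rewrite addr_ge0.
exists W, (fun t => \sum_i (`|u t ord0 i| + `|v t ord0 i|)); split => // t.
- by apply: sumr_ge0 => j _; rewrite addr_ge0.
- by move=> i; rewrite (bigD1 i)//= -addrA lerDl addr_ge0.
- by move=> i; rewrite (bigD1 i)//= addrAC addrC lerDl addr_ge0.
Qed.

Let coef1_piece j : (j < N)%N -> coef1 (Phi j) (tm j) \in unitmx.
Proof.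
elim: j => [_|j IH jN].
  by rewrite tm0; apply: coef1_basis; case: HP.
have jN' := ltnW jN; have [tjj Aj cj] := piece jN'; have [tjj' Aj' cj'] := piece jN.
have j1 : tm j <= tm j.+1 <= tm j.+1 by rewrite lexx ltW.
have j1' : tm j.+1 <= tm j.+1 <= tm j.+2 by rewrite lexx ltW.
apply: (coef1_transition HA Aj Aj' (cj _ j1) (cj' _ j1') (fun m m0 => HF jN' m0 j1)
  (fun m m0 => HF jN m0 j1')).
  by case: HP => _ _ _ _ H gamma b b'; exact: H.
have [W [w [CW _ uw _]]] := domination Ou.
have CWj := car_sub (tm_ge0 (ltnW jN')) (tm_leT jN') CW.
exact: (coef1_unit (Hc jN') (sXj jN') CWj uw (traj_continuous jN' Ou) cj (HF jN') (CF jN') (IH jN') j1).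
Qed.

Lemma strong_jet_cst (c : chart R M n) K p : cdom c p ->
  strong_jet c (fun=> p) (0 : 'M[R]_(K, n)).
Proof.
move=> cp; split; first by exists 1.
move=> e; apply: uniform_O_eq (filt0 (uniform_O_filtration _) _) => t s _ /=.
by rewrite subrr mxE horner_jet_poly big1 ?subrr// => m _; rewrite mxE mul0r.
Qed.

Lemma Psi0 K (F : coefs R n) t : (forall m, (0 < m)%N -> multilinear (F m t) /\ symmetric_map (F m t)) ->
  Psi F t 0 = 0 :> 'M[R]_(K, n).
Proof.
move=> HFt; apply/matrixP => m e; rewrite Psi_coef_fun// mxE /pform coef_sum big1// => -[[|r] rk] _.
  by rewrite /= coef0.
rewrite /= big1 ?coef0// => j _; rewrite /jet_poly big1 ?mul0r// => m' _.
by rewrite mxE polyC0 mulr0.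
Qed.

Let family (du : R -> 'rV[R]_l) (s t : R) := End t (u + s *: du).

(** Induction on the number of pieces covered. The last clause re-expresses the jet at the switching
    time in the next chart, which is the initial datum required on the next piece. *)
Lemma adapted_trajectory k du : Omega du -> forall j, (j <= N)%N ->
  exists x : R -> 'M[R]_(k.+1, n), [/\ x 0 = 0,
    forall m e, caratheodory 0 (tm j) (fun t => x t m e)
      (fun t => \sum_i du t ord0 i * adapted_flow i t (x t) m e),
    forall i t, (i < j)%N -> tm i <= t <= tm i.+1 ->
      exists2 b, strong_jet (ch i) (fun s => family du s t) b & Psi (Phi i) t b = x t &
    (j < N)%N -> exists2 b, strong_jet (ch j) (fun s => family du s (tm j)) b &
      Psi (Phi j) (tm j) b = x (tm j)].
Proof.
move=> Odu; have Os s : Omega (u + s *: du).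
  by case: cO => _ _ H; rewrite addrC; exact: H.
have fam0 t : family du 0 t = q t by rewrite /family scale0r addr0.
have [W [w [CW w0 uw duw]]] := domination Odu.
elim=> [_|j IH jN].
  exists (fun=> 0); split => //.
    by move=> m e; apply: car_eq (car_cst _ _ _) => t; rewrite tm0 => /andP[t0 /(lt_trans t0)]; rewrite ltxx.
  move=> _; have [t1 A0 c0] := piece N0.
  have j0 : tm 0 <= tm 0 <= tm 1 by rewrite lexx ltW.
  exists 0; last by apply: Psi0 => m m0; exact: HF.
  have -> : (fun s => family du s (tm 0)) = (fun=> q0).
    by apply/funext => s; rewrite tm0; case: (tr (Os s)).
  apply: strong_jet_cst; have := c0 _ j0; rewrite tm0 /q.
  by case: (tr Ou) => ->.
have [x [x0 Cx jx /(_ jN)[b0 sj0 Pb0]]] := IH (ltnW jN).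
have [tjj Aj cj] := piece jN.
have ab := ltW tjj.
have a0 := tm_ge0 (ltnW jN); have bT := tm_leT jN.
have CQ s t : tm j <= t -> t <= tm j.+1 ->
    (forall r, tm j <= r <= t -> cdom (ch j) (family du s r)) ->
    caratheodory (tm j) t (cmap (ch j) \o family du s)
      (fun r => \sum_i (u r ord0 i + s * du r ord0 i) *: X i (ch j) (cmap (ch j) (family du s r))).
  move=> jt tj dQ; apply: car_eq (traj_car jN (Os s) jt tj dQ) => r _.
  by apply: eq_bigr => i _; rewrite !mxE.
have [x' [x'a Cx' jx']] := @piece_jets R n l M (ch j) hM (Hc jN) (fun i => X i (ch j))
  (tm j) (tm j.+1) u du W w q (family du) (Phi j) ab (sXj jN) (car_sub a0 bT CW) w0 uw duw
  (fun i => summable_sub a0 bT (trajectory_summable HA sX iX T0 (tr Odu) i))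
  (traj_continuous jN Ou) cj (traj_car jN Ou ab (lexx _) cj) fam0
  (fun s => traj_continuous jN (Os s)) CQ (HF jN) (CF jN) k b0 (coef1_piece jN) sj0.
(* The two curves match at the switching time: x' starts at the image of the jet [b0] under the new
   maps, which is [x (tm j)]. *)
pose z t := if t <= tm j then x t else x' t.
have zl t : t <= tm j -> z t = x t by rewrite /z => ->.
have zr t : tm j <= t -> z t = x' t.
  move=> jt; rewrite /z; case: (leP t (tm j)) => // tj.
  have -> : t = tm j by apply: le_anti; rewrite tj jt.
  by rewrite x'a Pb0.
have jz i t : (i < j.+1)%N -> tm i <= t <= tm i.+1 ->
    exists2 b, strong_jet (ch i) (fun s => family du s t) b & Psi (Phi i) t b = z t.
  rewrite ltnS leq_eqVlt => /predU1P[->|ij] /andP[it ti].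
    by rewrite zr//; apply: jx'; rewrite it.
  rewrite zl; first by apply: jx => //; rewrite it.
  by rewrite (le_trans ti)// tm_le// ltnW.
exists z; split.
- by rewrite (zl _ a0).
- move=> m e; apply: (car_cat a0 ab).
    apply: car_eqf (car_eq _ (Cx m e)) => t /andP[_ tj]; first by rewrite zl.
    by rewrite zl// ltW.
  apply: car_eqf (car_eq _ (Cx' m e)) => t /andP[jt tj]; first by rewrite zr.
  have tjj' : tm j < t < tm j.+1 by rewrite jt.
  by rewrite (zr t (ltW jt)) /adapted_flow (piece_indexE jN tjj').
- exact: jz.
- move=> j'N; have [tjj' Aj' cj'] := piece j'N.
  have j1 : tm j <= tm j.+1 <= tm j.+1 by rewrite lexx ltW.
  have j1' : tm j.+1 <= tm j.+1 <= tm j.+2 by rewrite lexx ltW.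
  have [b sj Pb] := jz j _ (ltnSn j) j1.
  have [|b' sj'] := strong_jet_transition HA Aj Aj' _ sj.
    by rewrite fam0; exact: cj'.
  exists b' => //; rewrite -Pb; apply: esym.
  case: HP => _ _ _ _ H; apply: (H j k.+1 (fun s => family du s (tm j.+1))) => //.
  - exact: strong_jet_is_jet.
  - exact: strong_jet_is_jet.
Qed.

Lemma car_scalel (W : normedModType R) a b (f df : R -> R) (w : W) :
  caratheodory a b f df -> caratheodory a b (fun t => f t *: w) (fun t => df t *: w).
Proof.
move=> [acf Hf]; split; first exact: acZl.
by apply: filterS Hf => t Ht /Ht; exact: is_derive_scalel.
Qed.

Lemma gspace_sum k (I : Type) (r : seq I) (c : I -> R) (y : I -> 'M[R]_(k, n)) :
  \sum_(i <- r) c i *: ((0, y i) : gspace R n k) = (0, \sum_(i <- r) c i *: y i).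
Proof.
elim: r => [|i r IH]; first by rewrite !big_nil.
rewrite !big_cons IH; transitivity ((c i * 0 + 0, c i *: y i +
  \sum_(j <- r) c j *: y j) : gspace R n k) => //.
by rewrite mulr0 addr0.
Qed.

Lemma car_pair k a b (x dx : R -> 'M[R]_(k, n)) : caratheodory a b x dx ->
  caratheodory a b (fun t => (t, x t) : gspace R n k) (fun t => (1, dx t)).
Proof.
move=> /car_mxP Cx.
have Cid : caratheodory a b (fun t : R => t) (fun=> 1).
  by split; [exact: ac_id|apply: aeW => t _; exact: is_derive_id].
have C := carD (car_scalel ((1, 0) : gspace R n k) Cid)
  (car_sum (index_enum _) (P := xpredT) (fun (me : 'I_k * 'I_n) _ =>
     car_scalel ((0, delta_mx me.1 me.2) : gspace R n k) (Cx me.1 me.2))).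
have E (t : R) (y : 'M[R]_(k, n)) : t *: ((1, 0) : gspace R n k) +
    \sum_(me : 'I_k * 'I_n) y me.1 me.2 *: ((0, delta_mx me.1 me.2) : gspace R n k) = (t, y).
  rewrite gspace_sum; transitivity ((t * 1 + 0, t *: 0 +
    \sum_(me : 'I_k * 'I_n) y me.1 me.2 *: delta_mx me.1 me.2) : gspace R n k) => //.
  rewrite mulr1 addr0 scaler0 add0r [y in RHS]matrix_sum_delta pair_big//.
apply: car_eqf (car_eq _ C) => t _; first exact: E.
by rewrite -(E 1 (dx t)).
Qed.

End Assembly.

Theorem theorem3p5 (R : realType) (n l : nat) (M : topologicalType)
    (A : set (chart R M n)) (X : 'I_l -> chart R M n -> 'rV[R]_n -> 'rV[R]_n)
    (T : R) (q0 : M) (Omega : set (R -> 'rV[R]_l))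
    (End : R -> (R -> 'rV[R]_l) -> M)
    (u : R -> 'rV[R]_l) (P : adapted_coords R M n) :
  smooth_manifold A ->
  (forall i, smooth_vector_field A (X i)) ->
  pointwise_independent A X ->
  0 < T ->
  control_space T Omega ->
  (forall v, Omega v -> is_trajectory A X T q0 v (fun t => End t v)) ->
  Omega u ->
  is_adapted A X T u (fun t => End t u) P ->
  exists (D : forall k, gspace R n k -> set (gspace R n k))
         (Y : forall k, 'I_l -> gspace R n k -> gspace R n k),
    (forall k, (0 < k)%N ->
       [/\ forall p, D k p = affine_distribution (Y k) p,
           forall i, homogeneous (-1) (Y k i) &
           forall du, Omega du ->
             exists x : R -> 'M[R]_(k, n),
               [/\ forall t, 0 <= t <= T ->
                     jet_image P t (fun s => End t (u + s *: du)) (x t),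
                   x 0 = 0 &
                   caratheodory 0 T (fun t => (t, x t) : gspace R n k)
                     (fun t => dt R n k +
                        \sum_(i < l) du t ord0 i *: Y k i (t, x t))]]) /\
    (forall k, (0 < k)%N -> forall i,
       projects_to (@gproj R n k) (Y k.+1 i) (Y k i)).
Proof.
move=> HM sX iX T0 cO tr Ou HP.
pose G k := adapted_flow X End u P (k := k).
pose Y k i := mx_field (G k i).
exists (fun k => affine_distribution (Y k)), Y; split.
  move=> [//|k] _; split => // [i|du Odu].
    apply: homogeneous_mx_field => t m e; exact: adapted_field_wpoly.
  have [x [x0 Cx jx _]] := adapted_trajectory HM sX iX T0 cO tr Ou HP k Odu (leqnn (pieces P)).
  exists x; split => //.
    move=> t tT j jN tj; have [b sj Pb] := jx j t jN tj; exists b => //.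
    exact: strong_jet_is_jet.
  have TE : time P (pieces P) = T by case: HP => -[].
  have Cm : caratheodory 0 T x (fun t => \sum_i du t ord0 i *: G k.+1 i t (x t)).
    apply/car_mxP => m e; rewrite -TE; apply: car_eq (Cx m e) => t _.
    by rewrite summxE; apply: eq_bigr => i _; rewrite [RHS]mxE.
  apply: car_eq (car_pair Cm) => t _; rewrite /Y /mx_field /dt gspace_sum.
  transitivity ((1 + 0, 0 + \sum_i du t ord0 i *: G k.+1 i t (x t)) : gspace R n k.+1) => //.
  by rewrite addr0 add0r.
move=> k _ i; apply: projects_mx_field => t p; exact: adapted_field_proj.
Qed.
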